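(* Let $k$ be a commutative ring, $G$ a finite group, $H$ a subgroup of $G$, and $\mathfrak{P}$ a nonempty collection of subgroups of $H$. Let $$\mathfrak{X}=\{gP_1g^{-1}\cap P_2 \mid P_1,P_2\in\mathfrak{P},\ g\in G\setminus H\}.$$ Let $\mathcal{C}_G$, $\mathcal{C}_H$ be a pair of corresponding categories from the list in the context, and let $V$ be a finitely generated $kG$-module that is free as a $k$-module. Let either $\mathbf{A}_G=\mathcal{A}(\mathcal{C}_G)$ and $\mathbf{A}_H=\mathcal{A}(\mathcal{C}_H)$, or $\mathbf{A}_G=\mathcal{A}_{V\text{-split}}(\mathcal{C}_G)$ and $\mathbf{A}_H=\mathcal{A}_{V_{\downarrow H}\text{-split}}(\mathcal{C}_H)$. Assume that $\mathbf{A}_G$ is a thick subcategory of $\mathcal{C}_G$ and that $\mathbf{A}_H$ is a thick subcategory of $\mathcal{C}_H$. Then there are (mutually inverse) equivalences of categories $$\mathcal{I}:\frac{\mathfrak{P}\text{-}\mathbf{Proj}(\mathbf{A}_H)}{\mathfrak{X}\text{-}\mathbf{Proj}(\mathbf{A}_H)}\longrightarrow\frac{\mathfrak{P}\text{-}\mathbf{Proj}(\mathbf{A}_G)}{\mathfrak{X}\text{-}\mathbf{Proj}(\mathbf{A}_G)},\qquad \mathcal{R}:\frac{\mathfrak{P}\text{-}\mathbf{Proj}(\mathbf{A}_G)}{\mathfrak{X}\text{-}\mathbf{Proj}(\mathbf{A}_G)}\longrightarrow\frac{\mathfrak{P}\text{-}\mathbf{Proj}(\mathbf{A}_H)}{\mathfrak{X}\text{-}\mathbf{Proj}(\mathbf{A}_H)}$$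 that are induced by the induction and restriction operations.
   Context: Complexes. $\mathbf{Cpx}(kG)$ is the category of cochain complexes of $kG$-modules and chain maps; $\mathbf{Cpx}^+,\mathbf{Cpx}^-,\mathbf{Cpx}^b$ are the full subcategories of complexes bounded above, bounded below, and both. $\mathbf{cpxFL}(kG)$ is the full subcategory of complexes all of whose terms are $kG$-modules of finite composition length, with bounded versions $\mathbf{cpxFL}^{+},\mathbf{cpxFL}^{-},\mathbf{cpxFL}^{b}$. Here $\otimes=\otimes_k$ with diagonal group action. Categories allowed. $\mathbf{C}_G$ is any one of $\mathbf{Cpx}(kG)$, $\mathbf{Cpx}^{*}(kG)$, $\mathbf{cpxFL}(kG)$, $\mathbf{cpxFL}^{*}(kG)$ with $*\in\{+,-,b\}$, and $\mathbf{C}_H$ is the same with $H$ in place of $G$. An exact sequence $E$ of complexes is term split if in each degree it is a split sequence of $kG$-modules; $V$-split if $V\otimes E$ is split as a sequence of complexes; $V$-term split if $V\otimes E$ is term split; term+$V$-split if it is both term split and $V$-split. For a class $\mathscr{E}$ of exact sequences, an object $P$ is $\mathscr{E}$-projective if $\mathrm{Hom}(P,-)$ sends every sequence in $\mathscr{E}$ to an exact sequence; $\mathbf{C}/\mathscr{E}\text{-}\mathbf{Proj}$ has the objects of $\mathbf{C}$ and the morphisms of $\mathbf{C}$ modulo those factoring through an $\mathscr{E}$-projective object. $\mathcal{K}(\mathbf{C})$, $\mathcal{K}_{V\text{-split}}(\mathbf{C})$, $\mathcal{K}_{V\text{-ts}}(\mathbf{C})$, $\mathcal{K}_{\mathrm{ts}+V\text{-split}}(\mathbf{C})$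 denote this quotient for $\mathscr{E}$ the class of term split (usual homotopy category), $V$-split, $V$-term split, and term+$V$-split sequences in $\mathbf{C}$. $\mathcal{C}_G$ is $\mathbf{C}_G$ or one of these homotopy categories of $\mathbf{C}_G$, and $\mathcal{C}_H$ is the corresponding category for $H$, with $V$ replaced by its restriction $V_{\downarrow H}$. (The hypothesis that the acyclic objects form a thick subcategory presupposes that $\mathcal{C}_G,\mathcal{C}_H$ are triangulated.) Acyclic objects. $\mathcal{A}(\mathcal{C}_G)$ is the full subcategory of $\mathcal{C}_G$ consisting of the complexes that are exact (zero homology). $\mathcal{A}_{V\text{-split}}(\mathcal{C}_G)$ is the full subcategory consisting of the complexes $X$ that are exact and $V$-split, i.e. exact with $V\otimes X$ contractible. A subcategory of a triangulated category is thick if it is a full triangulated subcategory (closed under shifts, and containing the third object of any triangle when it contains two of them) and is closed under direct summands. Relative projectivity. For a collection $\mathfrak{U}$ of subgroups of $H$, an object of $\mathcal{C}_G$ is $\mathfrak{U}$-projective if it is a direct summand of a direct sum of objects induced from objects of $\mathcal{C}_P$, $P\in\mathfrak{U}$; similarly for $\mathcal{C}_H$, with induction to $H$. $\mathfrak{U}\text{-}\mathbf{Proj}(\mathbf{A}_G)$ is the full subcategory of $\mathbf{A}_G$ of $\mathfrak{U}$-projective objects, and likewise for $H$. The quotients displayed have the objects of the numerator and morphisms modulo those factoring through an object of the denominator. Functors. $\mathcal{I}$ is induced by $X\mapsto X^{\uparrow G}=kG\otimes_{kH}X$. $\mathcal{R}$ is restriction to $H$ followed by the equivalence that discards $\mathfrak{Y}$-projective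 summands, where $\mathfrak{Y}=\{gPg^{-1}\cap H\mid P\in\mathfrak{P},\ g\in G\setminus H\}$. *)

(* Defs.v *)
From Stdlib Require Import Setoid Morphisms.
From HB Require Import structures.
From mathcomp Require Import all_boot all_order all_fingroup all_algebra.
From mathcomp Require Import generic_quotient boolp.

Set Implicit Arguments.
Unset Strict Implicit.
Unset Printing Implicit Defensive.

Import GRing.Theory Order.TTheory Num.Theory.
Local Open Scope ring_scope.
Local Open Scope quotient_scope.

(** * k-modules presented by generators *)

(* [pres tests] is the k-module generated by S in which two formal sums are
   identified exactly when every map b : S -> A satisfying [tests] gives them
   the same value; it is the universal module receiving such a map whenever
   [tests] is a class of maps cut out by k-linear relations. *)
Section Presentation.
Variables (k : comPzRingType) (S : choiceType).
Variable tests : forall A : lmodType k, (S -> A) -> Prop.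

Definition evl (A : lmodType k) (b : S -> A) (s : seq (k * S)) : A :=
  \sum_(p <- s) p.1 *: b p.2.

Definition pres_eq : rel (seq (k * S)) := fun s t =>
  `[< forall (A : lmodType k) (b : S -> A), tests b -> evl b s = evl b t >].

Lemma pres_eq_refl : reflexive pres_eq.
Proof. by move=> s; apply/asboolP. Qed.
Lemma pres_eq_sym : symmetric pres_eq.
Proof.
by move=> s t; apply/idP/idP => /asboolP e; apply/asboolP => A b /e ->.
Qed.
Lemma pres_eq_trans : transitive pres_eq.
Proof.
move=> t s u /asboolP e1 /asboolP e2; apply/asboolP => A b tb.
by rewrite e1 // e2.
Qed.
Canonical pres_equiv :=
  EquivRel pres_eq pres_eq_refl pres_eq_sym pres_eq_trans.

Definition pres := {eq_quot pres_equiv}.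
HB.instance Definition _ := Choice.on pres.
HB.instance Definition _ := EqQuotient.on pres.

Definition pev (A : lmodType k) (b : S -> A) (x : pres) : A := evl b (repr x).

Lemma pev_pi (A : lmodType k) (b : S -> A) s :
  tests b -> pev b (\pi_pres s) = evl b s.
Proof.
move=> tb; rewrite /pev; case: piP => t /eqmodP /= /asboolP e.
by rewrite e.
Qed.

Lemma pev_inj (x y : pres) :
  (forall (A : lmodType k) (b : S -> A), tests b -> pev b x = pev b y) ->
  x = y.
Proof.
move=> e; rewrite -[x]reprK -[y]reprK; apply/eqmodP/asboolP => A b tb.
exact: e.
Qed.

Lemma evl_cat (A : lmodType k) (b : S -> A) s t :
  evl b (s ++ t) = evl b s + evl b t.
Proof. by rewrite /evl big_cat. Qed.

Lemma evl_scale (A : lmodType k) (b : S -> A) a s :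
  evl b [seq (a * p.1, p.2) | p <- s] = a *: evl b s.
Proof.
rewrite /evl big_map scaler_sumr; apply: eq_bigr => p _.
by rewrite scalerA.
Qed.

Definition pres_add (x y : pres) : pres := \pi_pres (repr x ++ repr y).
Definition pres_zero : pres := \pi_pres [::].
Definition pres_scale (a : k) (x : pres) : pres :=
  \pi_pres [seq (a * p.1, p.2) | p <- repr x].
Definition pres_opp (x : pres) : pres := pres_scale (-1) x.

Lemma pevD (A : lmodType k) (b : S -> A) x y :
  tests b -> pev b (pres_add x y) = pev b x + pev b y.
Proof. by move=> tb; rewrite pev_pi // evl_cat. Qed.
Lemma pev0 (A : lmodType k) (b : S -> A) : tests b -> pev b pres_zero = 0.
Proof. by move=> tb; rewrite pev_pi // /evl big_nil. Qed.
Lemma pevZ (A : lmodType k) (b : S -> A) a x :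
  tests b -> pev b (pres_scale a x) = a *: pev b x.
Proof. by move=> tb; rewrite pev_pi // evl_scale. Qed.
Lemma pevN (A : lmodType k) (b : S -> A) x :
  tests b -> pev b (pres_opp x) = - pev b x.
Proof. by move=> tb; rewrite pevZ // scaleN1r. Qed.

Lemma pres_addA : associative pres_add.
Proof. by move=> x y z; apply: pev_inj => A b tb; rewrite !pevD // addrA. Qed.
Lemma pres_addC : commutative pres_add.
Proof. by move=> x y; apply: pev_inj => A b tb; rewrite !pevD // addrC. Qed.
Lemma pres_add0 : left_id pres_zero pres_add.
Proof. by move=> x; apply: pev_inj => A b tb; rewrite pevD // pev0 // add0r. Qed.
Lemma pres_addN : left_inverse pres_zero pres_opp pres_add.
Proof.
by move=> x; apply: pev_inj => A b tb; rewrite pevD // pevN // pev0 // addNr.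
Qed.
HB.instance Definition _ :=
  GRing.isZmodule.Build pres pres_addA pres_addC pres_add0 pres_addN.

Lemma pres_scaleA a c x : pres_scale a (pres_scale c x) = pres_scale (a * c) x.
Proof. by apply: pev_inj => A b tb; rewrite !pevZ // scalerA. Qed.
Lemma pres_scale1 : left_id 1 pres_scale.
Proof. by move=> x; apply: pev_inj => A b tb; rewrite pevZ // scale1r. Qed.
Lemma pres_scaleDr : right_distributive pres_scale +%R.
Proof.
move=> a x y; apply: pev_inj => A b tb.
by rewrite /GRing.add /= pevZ // !pevD // !pevZ // scalerDr.
Qed.
Lemma pres_scaleDl x : {morph pres_scale^~ x : a c / a + c}.
Proof.
move=> a c; apply: pev_inj => A b tb.
by rewrite [in RHS]/GRing.add /= pevZ // pevD // !pevZ // scalerDl.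
Qed.
HB.instance Definition _ :=
  GRing.Zmodule_isLmodule.Build k pres
    pres_scaleA pres_scale1 pres_scaleDr pres_scaleDl.

Definition gen (s : S) : pres := \pi_pres [:: (1, s)].

Lemma pev_gen (A : lmodType k) (b : S -> A) s : tests b -> pev b (gen s) = b s.
Proof. by move=> tb; rewrite pev_pi // /evl big_seq1 scale1r. Qed.

End Presentation.

Section PresentationMap.
Variables (k : comPzRingType) (S S' : choiceType).
Variable tests : forall A : lmodType k, (S -> A) -> Prop.
Variable tests' : forall A : lmodType k, (S' -> A) -> Prop.

Definition pres_compat (f : S -> S') : Prop :=
  forall (A : lmodType k) (b : S' -> A), tests' b -> tests (b \o f).

Definition pres_fun f (_ : pres_compat f) (x : pres tests) : pres tests' :=
  \pi_(pres tests') [seq (p.1, f p.2) | p <- repr x].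

Lemma pev_fun f (cf : pres_compat f) (A : lmodType k) (b : S' -> A) x :
  tests' b -> pev b (pres_fun cf x) = pev (b \o f) x.
Proof.
by move=> tb; rewrite pev_pi // /pev /evl big_map.
Qed.

Lemma pres_fun_linear f (cf : pres_compat f) : linear (pres_fun cf).
Proof.
move=> a x y; apply: pev_inj => A b tb.
have tbf := cf _ _ tb.
rewrite /GRing.add /GRing.scale /= pevD // pevZ // !pev_fun //.
by rewrite pevD // pevZ.
Qed.
HB.instance Definition _ f (cf : pres_compat f) :=
  GRing.isLinear.Build k (pres tests) (pres tests') *:%R (pres_fun cf)
    (pres_fun_linear cf).

Definition pres_map f (cf : pres_compat f) : {linear pres tests -> pres tests'} :=
  pres_fun cf.

End PresentationMap.

(** * kG-modules *)

(* A kG-module is a k-module with a k-linear action of G.  All groups are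
   subgroups of an ambient finite group gT; the values of [act] outside G are
   irrelevant: no definition below depends on them. *)
Record gmod (k : comPzRingType) (gT : finGroupType) (G : {group gT}) := Gmod {
  gcar :> lmodType k;
  act : gT -> {linear gcar -> gcar};
  act1 : forall m, act 1%g m = m;
  actM : forall g h, g \in G -> h \in G -> forall m, act (g * h)%g m = act g (act h m)
}.

Record ghom (k : comPzRingType) (gT : finGroupType) (G : {group gT})
    (M N : gmod k G) := Ghom {
  ghom_lin :> {linear M -> N};
  ghom_act : forall g, g \in G -> forall m,
    ghom_lin (act M g m) = act N g (ghom_lin m)
}.

Section Modules.
Variables (k : comPzRingType) (gT : finGroupType).

Section OneGroup.
Variable G : {group gT}.
Implicit Types M N L : gmod k G.

Lemma ghom_id_subproof M g : g \in G -> forall m : M,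
  (idfun : {linear M -> M}) (act M g m) = act M g ((idfun : {linear M -> M}) m).
Proof. by []. Qed.
Definition ghom_id M : ghom M M := Ghom (@ghom_id_subproof M).

Lemma ghom_comp_subproof M N L (u : ghom N L) (v : ghom M N) g : g \in G ->
  forall m, (u \o v : {linear M -> L}) (act M g m) =
            act L g ((u \o v : {linear M -> L}) m).
Proof. by move=> gG m /=; rewrite !ghom_act. Qed.
Definition ghom_comp M N L (u : ghom N L) (v : ghom M N) : ghom M L :=
  Ghom (ghom_comp_subproof u v).

Lemma ghom_zero_subproof M N g : g \in G ->
  forall m, (\0 : {linear M -> N}) (act M g m) =
            act N g ((\0 : {linear M -> N}) m).
Proof. by move=> gG m /=; rewrite linear0. Qed.
Definition ghom_zero M N : ghom M N := Ghom (@ghom_zero_subproof M N).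

Lemma ghom_add_subproof M N (u v : ghom M N) g : g \in G ->
  forall m, (u \+ v : {linear M -> N}) (act M g m) =
            act N g ((u \+ v : {linear M -> N}) m).
Proof. by move=> gG m /=; rewrite linearD !ghom_act. Qed.
Definition ghom_add M N (u v : ghom M N) : ghom M N :=
  Ghom (ghom_add_subproof u v).

Lemma ghom_opp_subproof M N (u : ghom M N) g : g \in G ->
  forall m, (\- u : {linear M -> N}) (act M g m) =
            act N g ((\- u : {linear M -> N}) m).
Proof. by move=> gG m /=; rewrite linearN !ghom_act. Qed.
Definition ghom_opp M N (u : ghom M N) : ghom M N := Ghom (ghom_opp_subproof u).

Definition submodule M (U : M -> Prop) : Prop :=
  [/\ U 0,
      forall x y, U x -> U y -> U (x + y),
      forall a x, U x -> U (a *: x)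
    & forall g x, g \in G -> U x -> U (act M g x)].

Definition fin_gen M : Prop :=
  exists s : seq M, forall U : M -> Prop,
    submodule U -> (forall x, x \in s -> U x) -> forall x, U x.

Definition k_free M : Prop :=
  exists (B : choiceType) (b : B -> M),
    (forall x, exists s : seq (k * B), x = \sum_(p <- s) p.1 *: b p.2) /\
    (forall (s : seq B) (c : B -> k), uniq s ->
       \sum_(i <- s) c i *: b i = 0 -> forall i, i \in s -> c i = 0).

(* existence of a composition series *)
Definition finite_length M : Prop :=
  exists (n : nat) (F : nat -> M -> Prop),
    [/\ forall i, submodule (F i),
        forall x, F 0%N x <-> x = 0,
        forall x, F n x
      & forall i, (i < n)%N ->
          [/\ forall x, F i x -> F i.+1 x,
              exists x, F i.+1 x /\ ~ F i x
            & forall U : M -> Prop, submodule U ->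
                (forall x, F i x -> U x) -> (forall x, U x -> F i.+1 x) ->
                (forall x, U x -> F i x) \/ (forall x, F i.+1 x -> U x)]].

End OneGroup.

(** Restriction to a subgroup *)
Section Restriction.
Variables (G H : {group gT}) (sHG : H \subset G).

Lemma gres_actM (M : gmod k G) g h : g \in H -> h \in H ->
  forall m, act M (g * h)%g m = act M g (act M h m).
Proof. by move=> /(subsetP sHG) gG /(subsetP sHG) hG; apply: actM. Qed.
Definition gres (M : gmod k G) : gmod k H := Gmod (@act1 _ _ _ M) (@gres_actM M).

Lemma gres_map_subproof (M N : gmod k G) (u : ghom M N) g : g \in H ->
  forall m, (u : {linear M -> N}) (act M g m) = act N g (u m).
Proof. by move=> /(subsetP sHG); apply: ghom_act. Qed.
Definition gres_map (M N : gmod k G) (u : ghom M N) : ghom (gres M) (gres N) :=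
  @Ghom _ _ _ (gres M) (gres N) u (gres_map_subproof u).
End Restriction.

(** Tensor product over k, with diagonal action *)
Section Tensor.
Variable G : {group gT}.

Definition bilin (V M : lmodType k) (A : lmodType k) (b : V * M -> A) : Prop :=
  (forall v, linear (fun m => b (v, m))) /\ (forall m, linear (fun v => b (v, m))).

Definition tens (V M : lmodType k) : lmodType k := pres (@bilin V M).

Lemma tens_compat (V V' M M' : lmodType k) (f : {linear V -> V'})
    (u : {linear M -> M'}) :
  pres_compat (@bilin V M) (@bilin V' M') (fun p => (f p.1, u p.2)).
Proof.
move=> A b [b1 b2]; split=> [v|m] a x y /=; rewrite linearP.
  exact: b1.
exact: b2.
Qed.

Definition tens_map (V V' M M' : lmodType k) (f : {linear V -> V'})
    (u : {linear M -> M'}) : {linear tens V M -> tens V' M'} :=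
  pres_map (tens_compat f u).

Lemma gtens_act1 (V M : gmod k G) (x : tens V M) :
  tens_map (act V 1%g) (act M 1%g) x = x.
Proof.
apply: pev_inj => A b tb; rewrite pev_fun // /pev /evl.
by apply: eq_bigr => -[a [v m]] _ /=; rewrite !act1.
Qed.

Lemma gtens_actM (V M : gmod k G) g h : g \in G -> h \in G ->
  forall x : tens V M, tens_map (act V (g * h)%g) (act M (g * h)%g) x =
    tens_map (act V g) (act M g) (tens_map (act V h) (act M h) x).
Proof.
move=> gG hG x; apply: pev_inj => A b tb.
rewrite !pev_fun //; last exact: tens_compat.
by rewrite /pev /evl; apply: eq_bigr => -[a [v m]] _ /=; rewrite !actM.
Qed.

Definition gtens (V M : gmod k G) : gmod k G :=
  Gmod (@gtens_act1 V M) (@gtens_actM V M).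

Lemma gtens_map_subproof (V M N : gmod k G) (u : ghom M N) g : g \in G ->
  forall x : gtens V M, tens_map (idfun : {linear V -> V}) u (act (gtens V M) g x)
    = act (gtens V N) g (tens_map (idfun : {linear V -> V}) u x).
Proof.
move=> gG x; apply: pev_inj => A b tb.
rewrite !pev_fun //; try exact: tens_compat.
by rewrite /pev /evl; apply: eq_bigr => -[a [v m]] _ /=; rewrite ghom_act.
Qed.
Definition gtens_map (V M N : gmod k G) (u : ghom M N) :
    ghom (gtens V M) (gtens V N) :=
  @Ghom _ _ _ (gtens V M) (gtens V N) _ (gtens_map_subproof (V := V) u).
End Tensor.

(** Induction: kG (x)_{kK} M *)
Section Induction.
Variables (K G : {group gT}).

(* maps that factor through (x, m) |-> x (x) m in kG (x)_{kK} M *)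
Definition balanced (M : gmod k K) (A : lmodType k) (b : subg_of G * M -> A) : Prop :=
  (forall x, linear (fun m => b (x, m))) /\
  (forall (x y : subg_of G) m, val y \in K ->
     b ((x * y)%g, m) = b (x, act M (val y) m)).

Definition ind (M : gmod k K) : lmodType k := pres (@balanced M).

Lemma ind_act_compat (M : gmod k K) (g : gT) :
  pres_compat (@balanced M) (@balanced M) (fun p => ((subg G g * p.1)%g, p.2)).
Proof.
move=> A b [b1 b2]; split=> [x|x y m yK] /=; first exact: b1.
by rewrite mulgA b2.
Qed.
Definition ind_act (M : gmod k K) (g : gT) : {linear ind M -> ind M} :=
  pres_map (@ind_act_compat M g).

Lemma ind_act1 (M : gmod k K) (x : ind M) : ind_act M 1%g x = x.
Proof.
apply: pev_inj => A b tb; rewrite pev_fun // /pev /evl.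
apply: eq_bigr => -[a [v m]] _ /=.
by rewrite (_ : subg G 1%g = 1%g) ?mul1g //; apply: val_inj; rewrite /= subgK.
Qed.
Lemma ind_actM (M : gmod k K) g h : g \in G -> h \in G ->
  forall x, ind_act M (g * h)%g x = ind_act M g (ind_act M h x).
Proof.
move=> gG hG x; apply: pev_inj => A b tb.
rewrite !pev_fun //; last exact: ind_act_compat.
rewrite /pev /evl; apply: eq_bigr => -[a [v m]] _ /=.
by rewrite subgM // mulgA.
Qed.
Definition gind (M : gmod k K) : gmod k G := Gmod (@ind_act1 M) (@ind_actM M).

Lemma ind_map_compat (M N : gmod k K) (u : ghom M N) :
  pres_compat (@balanced M) (@balanced N) (fun p => (p.1, u p.2)).
Proof.
move=> A b [b1 b2]; split=> [x a m n|x y m yK] /=.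
  by rewrite linearP; apply: b1.
by rewrite b2 // ghom_act.
Qed.
Lemma gind_map_subproof (M N : gmod k K) (u : ghom M N) g : g \in G ->
  forall x : gind M, pres_map (ind_map_compat u) (act (gind M) g x) =
                     act (gind N) g (pres_map (ind_map_compat u) x).
Proof.
move=> gG x; apply: pev_inj => A b tb.
by rewrite !pev_fun //; [exact: ind_act_compat | exact: ind_map_compat].
Qed.
Definition gind_map (M N : gmod k K) (u : ghom M N) : ghom (gind M) (gind N) :=
  @Ghom _ _ _ (gind M) (gind N) _ (gind_map_subproof u).
End Induction.
End Modules.

(** * Preadditive categories *)

(* Morphisms are compared with a congruence [heq] rather than with Leibniz
   equality, so that a quotient category keeps the same morphisms and only
   coarsens [heq]. *)
Record pcat := Pcat {
  ob :> Type;
  hom : ob -> ob -> Type;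
  heq : forall X Y, hom X Y -> hom X Y -> Prop;
  hid : forall X, hom X X;
  hcomp : forall X Y Z, hom Y Z -> hom X Y -> hom X Z;
  hzero : forall X Y, hom X Y;
  hadd : forall X Y, hom X Y -> hom X Y -> hom X Y;
  hopp : forall X Y, hom X Y -> hom X Y;
  heq_refl : forall X Y (f : hom X Y), heq f f;
  heq_sym : forall X Y (f g : hom X Y), heq f g -> heq g f;
  heq_trans : forall X Y (f g h : hom X Y), heq f g -> heq g h -> heq f h;
  hcomp_heq : forall X Y Z (f f' : hom Y Z) (g g' : hom X Y),
    heq f f' -> heq g g' -> heq (hcomp f g) (hcomp f' g');
  hadd_heq : forall X Y (f f' g g' : hom X Y),
    heq f f' -> heq g g' -> heq (hadd f g) (hadd f' g');
  hopp_heq : forall X Y (f f' : hom X Y), heq f f' -> heq (hopp f) (hopp f');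
  hcomp1l : forall X Y (f : hom X Y), heq (hcomp (hid Y) f) f;
  hcomp1r : forall X Y (f : hom X Y), heq (hcomp f (hid X)) f;
  hcompA : forall X Y Z W (f : hom Z W) (g : hom Y Z) (h : hom X Y),
    heq (hcomp f (hcomp g h)) (hcomp (hcomp f g) h);
  haddA : forall X Y (f g h : hom X Y),
    heq (hadd f (hadd g h)) (hadd (hadd f g) h);
  haddC : forall X Y (f g : hom X Y), heq (hadd f g) (hadd g f);
  hadd0 : forall X Y (f : hom X Y), heq (hadd (hzero X Y) f) f;
  haddN : forall X Y (f : hom X Y), heq (hadd (hopp f) f) (hzero X Y);
  hcompDl : forall X Y Z (f f' : hom Y Z) (g : hom X Y),
    heq (hcomp (hadd f f') g) (hadd (hcomp f g) (hcomp f' g));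
  hcompDr : forall X Y Z (f : hom Y Z) (g g' : hom X Y),
    heq (hcomp f (hadd g g')) (hadd (hcomp f g) (hcomp f g'))
}.

Arguments hid {p} X.
Arguments hzero {p} X Y.

Declare Scope pcat_scope.
Delimit Scope pcat_scope with pc.
Local Open Scope pcat_scope.
Notation "f =h g" := (heq f g) (at level 70, no associativity) : pcat_scope.
Notation "f \oc g" := (hcomp f g) (at level 40, left associativity) : pcat_scope.
Notation "f +h g" := (hadd f g) (at level 50, left associativity) : pcat_scope.
Notation "f -h g" := (hadd f (hopp g)) (at level 50, left associativity) : pcat_scope.

#[export] Instance heq_equiv (C : pcat) (X Y : C) : Equivalence (@heq C X Y).
Proof.
split; [exact: heq_refl | exact: heq_sym | exact: heq_trans].
Qed.
#[export] Instance hcomp_proper (C : pcat) (X Y Z : C) :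
  Proper (@heq C Y Z ==> @heq C X Y ==> @heq C X Z) (@hcomp C X Y Z).
Proof. by move=> f f' e g g' e'; apply: hcomp_heq. Qed.
#[export] Instance hadd_proper (C : pcat) (X Y : C) :
  Proper (@heq C X Y ==> @heq C X Y ==> @heq C X Y) (@hadd C X Y).
Proof. by move=> f f' e g g' e'; apply: hadd_heq. Qed.
#[export] Instance hopp_proper (C : pcat) (X Y : C) :
  Proper (@heq C X Y ==> @heq C X Y) (@hopp C X Y).
Proof. by move=> f f' e; apply: hopp_heq. Qed.

#[export] Hint Resolve heq_refl : core.

Section PcatTheory.
Variable C : pcat.
Implicit Types X Y Z : C.

Lemma hadd0r X Y (f : hom X Y) : f +h hzero X Y =h f.
Proof. by rewrite haddC hadd0. Qed.
Lemma haddNr X Y (f : hom X Y) : f -h f =h hzero X Y.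
Proof. by rewrite haddC haddN. Qed.
Lemma hadd_cancel X Y (f g h : hom X Y) : f +h g =h f +h h -> g =h h.
Proof.
move=> e; rewrite -(hadd0 g) -(haddN f) -haddA e haddA haddN hadd0.
reflexivity.
Qed.
Lemma hopp_unique X Y (f g : hom X Y) : f +h g =h hzero X Y -> g =h hopp f.
Proof. by move=> e; apply: (@hadd_cancel _ _ f); rewrite e haddNr. Qed.
Lemma hoppK X Y (f : hom X Y) : hopp (hopp f) =h f.
Proof. by symmetry; apply: hopp_unique; rewrite haddN. Qed.
Lemma hopp0 X Y : hopp (hzero X Y) =h hzero X Y.
Proof. by symmetry; apply: hopp_unique; rewrite hadd0. Qed.
Lemma haddACA X Y (a b c d : hom X Y) :
  (a +h b) +h (c +h d) =h (a +h c) +h (b +h d).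
Proof. by rewrite -!haddA (haddA b) (haddC b c) -haddA. Qed.
Lemma hoppD X Y (f g : hom X Y) : hopp (f +h g) =h hopp f -h g.
Proof. by symmetry; apply: hopp_unique; rewrite haddACA !haddNr hadd0. Qed.
Lemma hcomp0l X Y Z (g : hom X Y) : hzero Y Z \oc g =h hzero X Z.
Proof.
apply: (@hadd_cancel _ _ (hzero Y Z \oc g)).
by rewrite -hcompDl hadd0 hadd0r.
Qed.
Lemma hcomp0r X Y Z (f : hom Y Z) : f \oc hzero X Y =h hzero X Z.
Proof.
apply: (@hadd_cancel _ _ (f \oc hzero X Y)).
by rewrite -hcompDr hadd0 hadd0r.
Qed.
Lemma hcompNl X Y Z (f : hom Y Z) (g : hom X Y) : hopp f \oc g =h hopp (f \oc g).
Proof. by apply: hopp_unique; rewrite -hcompDl haddNr hcomp0l. Qed.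
Lemma hcompNr X Y Z (f : hom Y Z) (g : hom X Y) : f \oc hopp g =h hopp (f \oc g).
Proof. by apply: hopp_unique; rewrite -hcompDr haddNr hcomp0r. Qed.
End PcatTheory.

(** Full subcategories *)
Section Full.
Variables (C : pcat) (P : C -> Prop).
Definition full : pcat := {|
  ob := {X : C | P X};
  hom := fun X Y => hom (sval X) (sval Y);
  heq := fun X Y => @heq C (sval X) (sval Y);
  hid := fun X => hid (sval X);
  hcomp := fun X Y Z => @hcomp C (sval X) (sval Y) (sval Z);
  hzero := fun X Y => hzero (sval X) (sval Y);
  hadd := fun X Y => @hadd C (sval X) (sval Y);
  hopp := fun X Y => @hopp C (sval X) (sval Y);
  heq_refl := fun X Y => @heq_refl C _ _;
  heq_sym := fun X Y => @heq_sym C _ _;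
  heq_trans := fun X Y => @heq_trans C _ _;
  hcomp_heq := fun X Y Z => @hcomp_heq C _ _ _;
  hadd_heq := fun X Y => @hadd_heq C _ _;
  hopp_heq := fun X Y => @hopp_heq C _ _;
  hcomp1l := fun X Y => @hcomp1l C _ _;
  hcomp1r := fun X Y => @hcomp1r C _ _;
  hcompA := fun X Y Z W => @hcompA C _ _ _ _;
  haddA := fun X Y => @haddA C _ _;
  haddC := fun X Y => @haddC C _ _;
  hadd0 := fun X Y => @hadd0 C _ _;
  haddN := fun X Y => @haddN C _ _;
  hcompDl := fun X Y Z => @hcompDl C _ _ _;
  hcompDr := fun X Y Z => @hcompDr C _ _ _
|}.
End Full.

(** Quotients *)
(* The morphisms factoring through an object of N, and their finite sums; the
   sums are already of that form when N is closed under binary direct sums. *)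
Inductive factors (C : pcat) (N : C -> Prop) (X Y : C) : hom X Y -> Prop :=
| factors_through W (a : hom X W) (b : hom W Y) : N W -> factors N (b \oc a)
| factors_zero : factors N (hzero X Y)
| factors_add f g : factors N f -> factors N g -> factors N (f +h g)
| factors_heq f g : f =h g -> factors N f -> factors N g.

Section Quotient.
Variables (C : pcat) (N : C -> Prop).
Implicit Types X Y Z : C.

Definition quot_eq X Y (f g : hom X Y) : Prop := factors N (f -h g).

Lemma factors_opp X Y (f : hom X Y) : factors N f -> factors N (hopp f).
Proof.
elim=> [W a b nW||g h _ ig _ ih|g h e _ ig].
- by apply: (factors_heq (hcompNl b a)); apply: factors_through.
- apply: factors_heq (factors_zero N X Y); symmetry; exact: hopp0.
- apply: factors_heq (factors_add ig ih); symmetry; exact: hoppD.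
- apply: factors_heq ig; exact: hopp_heq.
Qed.
Lemma factors_compl X Y Z (f : hom Y Z) (g : hom X Y) :
  factors N g -> factors N (f \oc g).
Proof.
elim=> [W a b nW||u v _ iu _ iv|u v e _ iu].
- apply: factors_heq (factors_through a (f \oc b) nW); symmetry; exact: hcompA.
- apply: factors_heq (factors_zero N X Z); symmetry; exact: hcomp0r.
- apply: factors_heq (factors_add iu iv); symmetry; exact: hcompDr.
- apply: factors_heq iu; apply: hcomp_heq => //; exact: heq_refl.
Qed.
Lemma factors_compr X Y Z (f : hom Y Z) (g : hom X Y) :
  factors N f -> factors N (f \oc g).
Proof.
elim=> [W a b nW||u v _ iu _ iv|u v e _ iu].
- apply: factors_heq (factors_through (a \oc g) b nW); exact: hcompA.
- apply: factors_heq (factors_zero N X Z); symmetry; exact: hcomp0l.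
- apply: factors_heq (factors_add iu iv); symmetry; exact: hcompDl.
- apply: factors_heq iu; apply: hcomp_heq => //; exact: heq_refl.
Qed.

Lemma quot_eq_heq X Y (f g : hom X Y) : f =h g -> quot_eq f g.
Proof.
move=> e; apply: factors_heq (factors_zero N X Y).
by rewrite e haddNr.
Qed.
Lemma quot_eq_sym X Y (f g : hom X Y) : quot_eq f g -> quot_eq g f.
Proof.
move=> /factors_opp; apply: factors_heq.
by rewrite hoppD hoppK haddC.
Qed.
Lemma quot_eq_trans X Y (f g h : hom X Y) :
  quot_eq f g -> quot_eq g h -> quot_eq f h.
Proof.
move=> fg gh; apply: factors_heq (factors_add fg gh).
by rewrite -haddA (haddA (hopp g)) haddN hadd0.
Qed.
Lemma quot_eq_comp X Y Z (f f' : hom Y Z) (g g' : hom X Y) :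
  quot_eq f f' -> quot_eq g g' -> quot_eq (f \oc g) (f' \oc g').
Proof.
move=> ef eg; apply: (@quot_eq_trans _ _ _ (f' \oc g)).
  apply: factors_heq (factors_compr g ef).
  by rewrite hcompDl hcompNl.
apply: factors_heq (factors_compl f' eg).
by rewrite hcompDr hcompNr.
Qed.
Lemma quot_eq_add X Y (f f' g g' : hom X Y) :
  quot_eq f f' -> quot_eq g g' -> quot_eq (f +h g) (f' +h g').
Proof.
move=> ef eg; apply: factors_heq (factors_add ef eg).
by rewrite hoppD haddACA.
Qed.
Lemma quot_eq_opp X Y (f f' : hom X Y) : quot_eq f f' -> quot_eq (hopp f) (hopp f').
Proof.
move=> /factors_opp; apply: factors_heq; exact: hoppD.
Qed.

Definition quot : pcat := {|
  ob := C;
  hom := @hom C;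
  heq := quot_eq;
  hid := @hid C;
  hcomp := @hcomp C;
  hzero := @hzero C;
  hadd := @hadd C;
  hopp := @hopp C;
  heq_refl := fun X Y f => quot_eq_heq (heq_refl f);
  heq_sym := quot_eq_sym;
  heq_trans := quot_eq_trans;
  hcomp_heq := quot_eq_comp;
  hadd_heq := quot_eq_add;
  hopp_heq := quot_eq_opp;
  hcomp1l := fun X Y f => quot_eq_heq (hcomp1l f);
  hcomp1r := fun X Y f => quot_eq_heq (hcomp1r f);
  hcompA := fun X Y Z W f g h => quot_eq_heq (hcompA f g h);
  haddA := fun X Y f g h => quot_eq_heq (haddA f g h);
  haddC := fun X Y f g => quot_eq_heq (haddC f g);
  hadd0 := fun X Y f => quot_eq_heq (hadd0 f);
  haddN := fun X Y f => quot_eq_heq (haddN f);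
  hcompDl := fun X Y Z f f' g => quot_eq_heq (hcompDl f f' g);
  hcompDr := fun X Y Z f g g' => quot_eq_heq (hcompDr f g g')
|}.
End Quotient.

(** Additive functors *)
Record functor (C D : pcat) := Functor {
  fob :> C -> D;
  fmap : forall X Y, hom X Y -> hom (fob X) (fob Y);
  fmap_heq : forall X Y (f g : hom X Y), f =h g -> fmap f =h fmap g;
  fmap_id : forall X, fmap (hid X) =h hid (fob X);
  fmap_comp : forall X Y Z (f : hom Y Z) (g : hom X Y),
    fmap (f \oc g) =h fmap f \oc fmap g;
  fmap_add : forall X Y (f g : hom X Y), fmap (f +h g) =h fmap f +h fmap g
}.

#[export] Instance fmap_proper (C D : pcat) (F : functor C D) (X Y : C) :
  Proper (@heq C X Y ==> @heq D (F X) (F Y)) (@fmap C D F X Y).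
Proof. by move=> f g; apply: fmap_heq. Qed.

Section Functors.
Variables C D : pcat.

Definition fid : functor C C := {|
  fob := fun X => X;
  fmap := fun X Y f => f;
  fmap_heq := fun X Y f g e => e;
  fmap_id := fun X => heq_refl _;
  fmap_comp := fun X Y Z f g => heq_refl _;
  fmap_add := fun X Y f g => heq_refl _
|}.

Lemma fmap_zero (F : functor C D) (X Y : C) :
  fmap F (hzero X Y) =h hzero (F X) (F Y).
Proof.
apply: (@hadd_cancel _ _ _ (fmap F (hzero X Y))).
by rewrite -fmap_add !hadd0r.
Qed.
Lemma fmap_opp (F : functor C D) (X Y : C) (f : hom X Y) :
  fmap F (hopp f) =h hopp (fmap F f).
Proof.
by apply: hopp_unique; rewrite -fmap_add haddNr fmap_zero.
Qed.

Definition carries (F : C -> D) (P : C -> Prop) (Q : D -> Prop) : Prop :=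
  forall X, P X -> Q (F X).

Definition full_functor (P : C -> Prop) (Q : D -> Prop) (F : functor C D)
    (h : carries F P Q) : functor (full P) (full Q) :=
  @Functor (full P) (full Q)
    (fun X : full P => exist Q (F (sval X)) (h _ (svalP X)))
    (fun X Y : full P => @fmap _ _ F (sval X) (sval Y))
    (fun X Y : full P => @fmap_heq _ _ F (sval X) (sval Y))
    (fun X : full P => @fmap_id _ _ F (sval X))
    (fun X Y Z : full P => @fmap_comp _ _ F (sval X) (sval Y) (sval Z))
    (fun X Y : full P => @fmap_add _ _ F (sval X) (sval Y)).

Lemma fmap_factors (P : C -> Prop) (Q : D -> Prop) (F : functor C D)
    (h : carries F P Q) (X Y : C) (f : hom X Y) :
  factors P f -> factors Q (fmap F f).
Proof.
elim=> [W a b nW||u v _ iu _ iv|u v e _ iu].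
- apply: factors_heq (factors_through (fmap F a) (fmap F b) (h _ nW)).
  symmetry; exact: fmap_comp.
- apply: factors_heq (factors_zero Q _ _); symmetry; exact: fmap_zero.
- apply: factors_heq (factors_add iu iv); symmetry; exact: fmap_add.
- by apply: factors_heq iu; apply: fmap_heq.
Qed.

Lemma quot_functor_heq (P : C -> Prop) (Q : D -> Prop) (F : functor C D)
    (h : carries F P Q) (X Y : C) (f g : hom X Y) :
  quot_eq P f g -> quot_eq Q (fmap F f) (fmap F g).
Proof.
move=> /(fmap_factors h); apply: factors_heq.
by rewrite fmap_add fmap_opp.
Qed.

Definition quot_functor (P : C -> Prop) (Q : D -> Prop) (F : functor C D)
    (h : carries F P Q) : functor (quot P) (quot Q) :=
  @Functor (quot P) (quot Q) F (@fmap _ _ F) (quot_functor_heq h)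
    (fun X => quot_eq_heq Q (fmap_id F X))
    (fun X Y Z f g => quot_eq_heq Q (fmap_comp F f g))
    (fun X Y f g => quot_eq_heq Q (fmap_add F f g)).

Definition nat_iso (F F' : functor C D) : Prop :=
  exists (eta : forall X, hom (F X) (F' X)) (theta : forall X, hom (F' X) (F X)),
    [/\ forall X, theta X \oc eta X =h hid (F X),
        forall X, eta X \oc theta X =h hid (F' X)
      & forall X Y (f : hom X Y), eta Y \oc fmap F f =h fmap F' f \oc eta X].
End Functors.

Arguments fid C : clear implicits.

Lemma fcomp_heq (C D E : pcat) (G : functor D E) (F : functor C D)
    (X Y : C) (f g : hom X Y) :
  f =h g -> fmap G (fmap F f) =h fmap G (fmap F g).
Proof. by move=> e; do 2!apply: fmap_heq. Qed.
Lemma fcomp_id (C D E : pcat) (G : functor D E) (F : functor C D) (X : C) :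
  fmap G (fmap F (hid X)) =h hid (G (F X)).
Proof. by rewrite !fmap_id. Qed.
Lemma fcomp_comp (C D E : pcat) (G : functor D E) (F : functor C D)
    (X Y Z : C) (f : hom Y Z) (g : hom X Y) :
  fmap G (fmap F (f \oc g)) =h fmap G (fmap F f) \oc fmap G (fmap F g).
Proof. by rewrite !fmap_comp. Qed.
Lemma fcomp_add (C D E : pcat) (G : functor D E) (F : functor C D)
    (X Y : C) (f g : hom X Y) :
  fmap G (fmap F (f +h g)) =h fmap G (fmap F f) +h fmap G (fmap F g).
Proof. by rewrite !fmap_add. Qed.
Definition fcomp (C D E : pcat) (G : functor D E) (F : functor C D) :
    functor C E :=
  @Functor C E (fun X => G (F X)) (fun X Y f => fmap G (fmap F f))
    (fcomp_heq G F) (fcomp_id G F) (fcomp_comp G F) (fcomp_add G F).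

Definition inverse_equivalences (C D : pcat) (F : functor C D) (G : functor D C) :
    Prop :=
  nat_iso (fcomp G F) (fid C) /\ nat_iso (fcomp F G) (fid D).

Definition is_equivalence (C D : pcat) (F : functor C D) : Prop :=
  exists G : functor D C, inverse_equivalences F G.

(** Direct sums and direct summands *)
Section Sums.
Variable C : pcat.
Implicit Types X Y Z D : C.

Definition is_iso X Y (f : hom X Y) : Prop :=
  exists g : hom Y X, g \oc f =h hid X /\ f \oc g =h hid Y.

Definition is_zero X : Prop := hid X =h hzero X X.

Definition is_biproduct X Y D : Prop :=
  exists (i : hom X D) (j : hom Y D) (p : hom D X) (q : hom D Y),
    [/\ p \oc i =h hid X, q \oc j =h hid Y, p \oc j =h hzero Y X,
        q \oc i =h hzero X Y & (i \oc p) +h (j \oc q) =h hid D].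

Definition direct_summand X D : Prop := exists Y, is_biproduct X Y D.

Definition is_direct_sum (I : Type) (W : I -> C) D : Prop :=
  exists inj : forall i, hom (W i) D,
    forall Y (f : forall i, hom (W i) Y),
      exists h : hom D Y,
        (forall i, h \oc inj i =h f i) /\
        (forall h' : hom D Y, (forall i, h' \oc inj i =h f i) -> h' =h h).

Definition additive : Prop :=
  (exists Z, is_zero Z) /\ (forall X Y, exists D, is_biproduct X Y D).
End Sums.

(** * Triangulated categories *)

Definition tri_class (C : pcat) (S : C -> C) : Type :=
  forall X Y Z : C, hom X Y -> hom Y Z -> hom Z (S X) -> Prop.

Definition tri_iso (C : pcat) (S : functor C C)
    (X Y Z : C) (f : hom X Y) (g : hom Y Z) (h : hom Z (S X))
    (X' Y' Z' : C) (f' : hom X' Y') (g' : hom Y' Z') (h' : hom Z' (S X')) : Prop :=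
  exists (a : hom X X') (b : hom Y Y') (c : hom Z Z'),
    [/\ is_iso a, is_iso b & is_iso c] /\
    [/\ b \oc f =h f' \oc a, c \oc g =h g' \oc b & fmap S a \oc h =h h' \oc c].

Record triangulation (C : pcat) := Triangulation {
  shift : functor C C;
  dist : tri_class shift;
  tri_additive : additive C;
  tri_shift : is_equivalence shift;
  tri_closed_iso : forall X Y Z (f : hom X Y) (g : hom Y Z) (h : hom Z (shift X))
      X' Y' Z' (f' : hom X' Y') (g' : hom Y' Z') (h' : hom Z' (shift X')),
    tri_iso f g h f' g' h' -> dist f g h -> dist f' g' h';
  tri_id : forall X Z, is_zero Z ->
    dist (hid X) (hzero X Z) (hzero Z (shift X));
  tri_cone : forall X Y (f : hom X Y),
    exists Z (g : hom Y Z) (h : hom Z (shift X)), dist f g h;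
  tri_rot : forall X Y Z (f : hom X Y) (g : hom Y Z) (h : hom Z (shift X)),
    dist f g h <-> dist g h (hopp (fmap shift f));
  tri_fill : forall X Y Z (f : hom X Y) (g : hom Y Z) (h : hom Z (shift X))
      X' Y' Z' (f' : hom X' Y') (g' : hom Y' Z') (h' : hom Z' (shift X'))
      (a : hom X X') (b : hom Y Y'),
    dist f g h -> dist f' g' h' -> b \oc f =h f' \oc a ->
    exists c : hom Z Z', c \oc g =h g' \oc b /\ fmap shift a \oc h =h h' \oc c;
  tri_octahedron : forall X Y Z (f : hom X Y) (g : hom Y Z)
      Z' (f' : hom Y Z') (f'' : hom Z' (shift X))
      Y' (h' : hom Z Y') (h'' : hom Y' (shift X))
      X' (g' : hom Z X') (g'' : hom X' (shift Y)),
    dist f f' f'' -> dist (g \oc f) h' h'' -> dist g g' g'' ->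
    exists (u : hom Z' Y') (v : hom Y' X'),
      dist u v (fmap shift f' \oc g'') /\
      [/\ u \oc f' =h h' \oc g, h'' \oc u =h f'', v \oc h' =h g'
        & g'' \oc v =h fmap shift f \oc h'']
}.

Definition thick (C : pcat) (T : triangulation C) (A : C -> Prop) : Prop :=
  [/\ forall X, A X <-> A (shift T X),
      forall X Y Z (f : hom X Y) (g : hom Y Z) (h : hom Z (shift T X)),
        dist f g h ->
        [/\ A X -> A Y -> A Z, A X -> A Z -> A Y & A Y -> A Z -> A X]
    & forall X Y, direct_summand X Y -> A Y -> A X].

(** * Relative projectivity with respect to a class of sequences *)

Definition seq_class (C : pcat) : Type :=
  forall X Y Z : C, hom X Y -> hom Y Z -> Prop.

Section RelativeExact.
Variables (C : pcat) (E : seq_class C).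

Definition E_projective (P : C) : Prop :=
  forall (X Y Z : C) (f : hom X Y) (g : hom Y Z), E f g ->
    [/\ forall u : hom P X, f \oc u =h hzero P Y -> u =h hzero P X,
        forall v : hom P Y, g \oc v =h hzero P Z <->
          exists u : hom P X, v =h f \oc u
      & forall w : hom P Z, exists v : hom P Y, w =h g \oc v].

Definition E_injective (Q : C) : Prop :=
  forall (X Y Z : C) (f : hom X Y) (g : hom Y Z), E f g ->
    [/\ forall w : hom Z Q, w \oc g =h hzero Y Q -> w =h hzero Z Q,
        forall v : hom Y Q, v \oc f =h hzero X Q <->
          exists w : hom Z Q, v =h w \oc g
      & forall u : hom X Q, exists v : hom Y Q, u =h v \oc f].

(* T is the triangulation of the stable category of a Frobenius category:
   the shift is the cokernel of an embedding into an E-projective-injective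
   object, and the triangles are those induced by the sequences in E. *)
Definition stable_triangulation (N : C -> Prop) (T : triangulation (quot N)) : Prop :=
  let S : C -> C := shift T in
  exists (J : C -> C) (iota : forall X, hom X (J X)) (pi : forall X, hom (J X) (S X)),
    [/\ forall X, [/\ E (iota X) (pi X), E_projective (J X) & E_injective (J X)],
        forall (X Y : C) (f : hom X Y),
          exists (u : hom (J X) (J Y)) (v : hom (S X) (S Y)),
            [/\ u \oc iota X =h iota Y \oc f, v \oc pi X =h pi Y \oc u
              & quot_eq N v (fmap (shift T) f)]
      & forall (X Y Z : C) (f : hom X Y) (g : hom Y Z) (h : hom Z (S X)),
          dist (t := T) f g h <->
          exists (X' Y' Z' : C) (f' : hom X' Y') (g' : hom Y' Z')
                 (u : hom Y' (J X')) (h' : hom Z' (S X')),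
            [/\ E f' g', u \oc f' =h iota X', h' \oc g' =h pi X' \oc u
              & @tri_iso (quot N) (shift T) X Y Z f g h X' Y' Z' f' g' h']].
End RelativeExact.

(** * Complexes of kG-modules *)

Record cpx (k : comPzRingType) (gT : finGroupType) (G : {group gT}) := Cpx {
  cx :> int -> gmod k G;
  cd : forall i, ghom (cx i) (cx (i + 1));
  cdd : forall i x, cd (i + 1) (cd i x) = 0
}.

Record chmap (k : comPzRingType) (gT : finGroupType) (G : {group gT})
    (X Y : cpx k G) := Chmap {
  cm :> forall i, ghom (X i) (Y i);
  cmd : forall i x, cm (i + 1) (cd X i x) = cd Y i (cm i x)
}.

Section Complexes.
Variables (k : comPzRingType) (gT : finGroupType).

Section OneGroup.
Variable G : {group gT}.
Implicit Types X Y Z : cpx k G.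

Definition cm_eq X Y (f g : chmap X Y) : Prop := forall i x, f i x = g i x.

Definition cm_id X : chmap X X :=
  @Chmap _ _ _ X X (fun i => ghom_id (X i)) (fun i x => erefl).

Lemma cm_comp_subproof X Y Z (f : chmap Y Z) (g : chmap X Y) i x :
  ghom_comp (f (i + 1)) (g (i + 1)) (cd X i x) = cd Z i (ghom_comp (f i) (g i) x).
Proof. by rewrite /= !cmd. Qed.
Definition cm_comp X Y Z (f : chmap Y Z) (g : chmap X Y) : chmap X Z :=
  Chmap (cm_comp_subproof f g).

Lemma cm_zero_subproof X Y i x :
  ghom_zero (X (i + 1)) (Y (i + 1)) (cd X i x) = cd Y i (ghom_zero (X i) (Y i) x).
Proof. by rewrite /= linear0. Qed.
Definition cm_zero X Y : chmap X Y := Chmap (@cm_zero_subproof X Y).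

Lemma cm_add_subproof X Y (f g : chmap X Y) i x :
  ghom_add (f (i + 1)) (g (i + 1)) (cd X i x) = cd Y i (ghom_add (f i) (g i) x).
Proof. by rewrite /= !cmd linearD. Qed.
Definition cm_add X Y (f g : chmap X Y) : chmap X Y :=
  Chmap (cm_add_subproof f g).

Lemma cm_opp_subproof X Y (f : chmap X Y) i x :
  ghom_opp (f (i + 1)) (cd X i x) = cd Y i (ghom_opp (f i) x).
Proof. by rewrite /= cmd linearN. Qed.
Definition cm_opp X Y (f : chmap X Y) : chmap X Y := Chmap (cm_opp_subproof f).

Definition CpxCat : pcat.
Proof.
refine (@Pcat (cpx k G) (@chmap k gT G) cm_eq cm_id cm_comp cm_zero cm_add cm_opp
  _ _ _ _ _ _ _ _ _ _ _ _ _ _ _).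
- by move=> X Y f i x.
- by move=> X Y f g e i x; rewrite e.
- by move=> X Y f g h e e' i x; rewrite e e'.
- by move=> X Y Z f f' g g' e e' i x /=; rewrite e' e.
- by move=> X Y f f' g g' e e' i x /=; rewrite e e'.
- by move=> X Y f f' e i x /=; rewrite e.
- by move=> X Y f i x.
- by move=> X Y f i x.
- by move=> X Y Z W f g h i x.
- by move=> X Y f g h i x /=; rewrite addrA.
- by move=> X Y f g i x /=; rewrite addrC.
- by move=> X Y f i x /=; rewrite add0r.
- by move=> X Y f i x /=; rewrite addNr.
- by move=> X Y Z f f' g i x.
- by move=> X Y Z f g g' i x /=; rewrite linearD.
Defined.

(* As i ranges over all integers, i + 1 ranges over all degrees. *)
Definition exact X : Prop :=
  forall i (x : X (i + 1)), cd X (i + 1) x = 0 -> exists y, cd X i y = x.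

Definition contractible X : Prop :=
  exists h : forall i, ghom (X (i + 1)) (X i),
    forall i x, x = cd X i (h i x) + h (i + 1) (cd X (i + 1) x).

Definition bounded_above X : Prop := exists n : int, forall i, n < i -> forall x : X i, x = 0.
Definition bounded_below X : Prop := exists n : int, forall i, i < n -> forall x : X i, x = 0.

(** Short exact sequences of complexes and their splittings *)
Definition short_exact X Y Z (f : chmap X Y) (g : chmap Y Z) : Prop :=
  forall i, [/\ injective (f i),
                forall y, g i y = 0 <-> exists x, f i x = y
              & forall z, exists y, g i y = z].

Definition splits Y Z (g : chmap Y Z) : Prop :=
  exists s : chmap Z Y, forall i z, g i (s i z) = z.

Definition term_splits Y Z (g : chmap Y Z) : Prop :=
  forall i, exists s : ghom (Z i) (Y i), forall z, g i (s z) = z.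

(** Tensor product with a kG-module *)
Lemma ctens_cdd (V : gmod k G) X i (x : gtens V (X i)) :
  gtens_map V (cd X (i + 1)) (gtens_map V (cd X i) x) = 0.
Proof.
apply: pev_inj => A b tb; rewrite !pev_fun //; last exact: tens_compat.
rewrite pev0 // /pev /evl big1 // => -[a [v m]] _ /=; rewrite cdd.
by have := tb.1 v (-1) 0 0; rewrite /= scaler0 addr0 scaleN1r addNr => ->; rewrite scaler0.
Qed.
Definition ctens (V : gmod k G) X : cpx k G :=
  @Cpx _ _ _ (fun i => gtens V (X i)) (fun i => gtens_map V (cd X i))
    (@ctens_cdd V X).

Lemma ctens_map_subproof (V : gmod k G) X Y (f : chmap X Y) i (x : ctens V X i) :
  gtens_map V (f (i + 1)) (cd (ctens V X) i x) =
  cd (ctens V Y) i (gtens_map V (f i) x).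
Proof.
apply: pev_inj => A b tb; rewrite !pev_fun //; try exact: tens_compat.
by rewrite /pev /evl; apply: eq_bigr => -[a [v m]] _ /=; rewrite cmd.
Qed.
Definition ctens_map (V : gmod k G) X Y (f : chmap X Y) :
    chmap (ctens V X) (ctens V Y) := 
  @Chmap _ _ _ (ctens V X) (ctens V Y) (fun i => gtens_map V (f i))
    (@ctens_map_subproof V X Y f).

End OneGroup.

(** Restriction and induction of complexes *)
Section Restriction.
Variables (G H : {group gT}) (sHG : H \subset G).

Definition cres (X : cpx k G) : cpx k H :=
  @Cpx _ _ _ (fun i => gres sHG (X i)) (fun i => gres_map sHG (cd X i)) (@cdd _ _ _ X).
Definition cres_map (X Y : cpx k G) (f : chmap X Y) : chmap (cres X) (cres Y) :=
  @Chmap _ _ _ (cres X) (cres Y) (fun i => gres_map sHG (f i)) (@cmd _ _ _ _ _ f).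

Definition Res : functor (CpxCat G) (CpxCat H).
Proof.
refine (@Functor (CpxCat G) (CpxCat H) cres cres_map _ _ _ _).
- by move=> X Y f g e i x; apply: e.
- by move=> X i x.
- by move=> X Y Z f g i x.
- by move=> X Y f g i x.
Defined.
End Restriction.

Section Induction.
Variables (K G : {group gT}).

Lemma cind_cdd (X : cpx k K) i (x : gind G (X i)) :
  gind_map G (cd X (i + 1)) (gind_map G (cd X i) x) = 0.
Proof.
apply: pev_inj => A b tb; rewrite !pev_fun //; last exact: ind_map_compat.
rewrite pev0 // /pev /evl big1 // => -[a [v m]] _ /=; rewrite cdd.
by have := tb.1 v (-1) 0 0; rewrite /= scaler0 addr0 scaleN1r addNr => ->; rewrite scaler0.
Qed.
Definition cind (X : cpx k K) : cpx k G :=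
  @Cpx _ _ _ (fun i => gind G (X i)) (fun i => gind_map G (cd X i)) (@cind_cdd X).

Lemma cind_map_subproof (X Y : cpx k K) (f : chmap X Y) i (x : cind X i) :
  gind_map G (f (i + 1)) (cd (cind X) i x) =
  cd (cind Y) i (gind_map G (f i) x).
Proof.
apply: pev_inj => A b tb; rewrite !pev_fun //; try exact: ind_map_compat.
by rewrite /pev /evl; apply: eq_bigr => -[a [v m]] _ /=; rewrite cmd.
Qed.
Definition cind_map (X Y : cpx k K) (f : chmap X Y) : chmap (cind X) (cind Y) :=
  @Chmap _ _ _ (cind X) (cind Y) (fun i => gind_map G (f i))
    (@cind_map_subproof X Y f).

Definition Ind : functor (CpxCat K) (CpxCat G).
Proof.
refine (@Functor (CpxCat K) (CpxCat G) cind cind_map _ _ _ _).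
- move=> X Y f g e i x; apply: pev_inj => A b tb; rewrite !pev_fun //.
  by rewrite /pev /evl; apply: eq_bigr => -[a [v m]] _ /=; rewrite e.
- move=> X i x; apply: pev_inj => A b tb; rewrite !pev_fun //.
  by rewrite /pev /evl; apply: eq_bigr => -[a [v m]] _.
- move=> X Y Z f g i x; apply: pev_inj => A b tb.
  by rewrite !pev_fun //; apply: ind_map_compat.
- move=> X Y f g i x; apply: pev_inj => A b tb.
  rewrite pev_fun // [RHS]pevD // !pev_fun // /pev /evl -big_split.
  apply: eq_bigr => -[a [v m]] _ /=.
  have := tb.1 v 1 (f i m) (g i m).
  by rewrite !scale1r => ->; rewrite scalerDr.
Defined.
End Induction.
End Complexes.

(** * The categories C_G and their homotopy categories *)

Variant bound := Unbounded | BoundedAbove | BoundedBelow | Bounded.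

(* [Plain] stands for the category of complexes itself. *)
Variant hkind := Plain | TermSplit | VSplit | VTermSplit | TermVSplit.

(* Which of the categories Cpx^*(kG), cpxFL^*(kG), which of their homotopy
   categories, and which of the two kinds of acyclic objects. *)
Record choices := Choices {
  finite_terms : bool;
  boundedness : bound;
  homotopy : hkind;
  acyclic_V_split : bool
}.

Section Categories.
Variables (k : comPzRingType) (gT : finGroupType) (c : choices).

Definition admissible (G : {group gT}) (X : cpx k G) : Prop :=
  (finite_terms c -> forall i, finite_length (X i)) /\
  match boundedness c with
  | Unbounded => True
  | BoundedAbove => bounded_above X
  | BoundedBelow => bounded_below X
  | Bounded => bounded_above X /\ bounded_below X
  end.

Section OneGroup.
Variables (G : {group gT}) (V : gmod k G).

Definition BC : pcat := full (fun X : CpxCat k G => admissible X).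

Definition sequences : seq_class BC := fun X Y Z f g =>
  short_exact f g /\
  match homotopy c with
  | Plain => False
  | TermSplit => term_splits g
  | VSplit => splits (ctens_map V g)
  | VTermSplit => term_splits (ctens_map V g)
  | TermVSplit => term_splits g /\ splits (ctens_map V g)
  end.

(* the objects killed in passing from BC to CC; none for [Plain] *)
Definition null_objects (P : BC) : Prop :=
  homotopy c <> Plain /\ E_projective sequences P.

Definition CC : pcat := quot null_objects.

Definition acyclic (X : CC) : Prop :=
  exact (sval X) /\ (acyclic_V_split c -> contractible (ctens V (sval X))).

(* A full subcategory is thick for the standard triangulation of CC; when CC
   is the category of complexes itself there is no standard triangulation and
   any one is accepted. *)
Definition thick_in_CC (A : CC -> Prop) : Prop :=
  exists T : triangulation CC,
    (homotopy c <> Plain -> stable_triangulation sequences T) /\ thick T A.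

(** Relative projectivity with respect to a collection of subgroups *)
Definition induced_from (U : {set {group gT}}) (W : CC) : Prop :=
  exists (P : {group gT}) (Z : cpx k P),
    [/\ P \in U, admissible Z & sval W = cind G Z].

Definition rel_projective (U : {set {group gT}}) (X : CC) : Prop :=
  exists (I : Type) (W : I -> CC) (D : CC),
    [/\ forall i, induced_from U (W i), is_direct_sum W D & direct_summand X D].

Definition AProj (U : {set {group gT}}) (X : CC) : Prop :=
  acyclic X /\ rel_projective U X.

(* U-Proj(A_G) / U'-Proj(A_G) *)
Definition AStab (U U' : {set {group gT}}) : pcat :=
  quot (fun X : full (AProj U) => AProj U' (sval X)).

End OneGroup.
End Categories.

(** * Induction and restriction on the quotient categories *)

Section Correspondence.
Variables (k : comPzRingType) (gT : finGroupType) (c : choices).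

(* [Phi] is the functor U-Proj(A_G)/U'-Proj(A_G) -> W-Proj(A_H)/W'-Proj(A_H)
   obtained from the functor F on complexes, which has to be compatible with
   every passage to a full subcategory and to a quotient. *)
Definition induced_by (G H : {group gT}) (VG : gmod k G) (VH : gmod k H)
    (F : functor (CpxCat k G) (CpxCat k H)) (U U' W W' : {set {group gT}})
    (Phi : functor (AStab c VG U U') (AStab c VH W W')) : Prop :=
  exists (h1 : carries F (fun X => admissible c X) (fun X => admissible c X)),
  let F1 : functor (BC k c G) (BC k c H) := full_functor h1 in
  exists (h2 : carries F1 (null_objects (c := c) VG) (null_objects (c := c) VH)),
  let F2 : functor (CC c VG) (CC c VH) := quot_functor h2 in
  exists (h3 : carries F2 (AProj U) (AProj W)),
  let F3 : functor (full (AProj (c := c) (V := VG) U)) (full (AProj (c := c) (V := VH) W))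
    := full_functor h3 in
  exists (h4 : carries F3 (fun X => AProj U' (sval X)) (fun X => AProj W' (sval X))),
  Phi = quot_functor h4.

Variables (G H : {group gT}).

Definition collX (PP : {set {group gT}}) : {set {group gT}} :=
  [set Q : {group gT} | [exists P1 in PP, exists P2 in PP, exists g in G :\: H,
     Q == (P1 :^ g^-1 :&: P2)%G]].

Definition collY (PP : {set {group gT}}) : {set {group gT}} :=
  [set Q : {group gT} | [exists P in PP, exists g in G :\: H,
     Q == (P :^ g^-1 :&: H)%G]].

End Correspondence.

(* Main.v *)
(* For morphisms of complexes let J_U be the ideal generated by the traces tr_P^G(th), with
   P in U and th a map of complexes of kP-modules, and by the morphisms through null objects.
   By Higman's criterion X is U-projective iff its identity lies in J_U, and two morphisms of
   U-Proj(A)/U'-Proj(A) are equal iff their difference lies in J_U'.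

   Mackey's formula gives J_Y J_P <= J_X over H, res J_X^G <= J_Y^H, and, for A P-projective
   over H, that the projection of Res Ind A onto its summand A is an isomorphism modulo J_Y.
   With the adjunction between induction and restriction, both I and the functor
   J : P-Proj/X-Proj -> (P u Y)-Proj/Y-Proj over H induced by the identity are fully faithful,
   and every object of their targets is a retract of an object in the image.  As
   Res I is isomorphic to J, it remains to know that idempotents split in P-Proj/X-Proj over H.

   If the terms have finite length this is Fitting's lemma in each degree.  Otherwise the
   categories admit countable sums A^oo, and the image of e is obtained as the cone of
   (1 - e) + shift o e on A^oo: modulo X-projectives this map is split mono and
   misses only the e-part of the 0-th copy, and a split mono can be made honest by adding an
   X-projective summand to its target. *)

Require Import Defs.
From Stdlib Require Import Setoid Morphisms.
From HB Require Import structures.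
From mathcomp Require Import all_boot all_order all_fingroup all_algebra.
From mathcomp Require Import boolp.
From mathcomp Require classical_sets generic_quotient.

Set Implicit Arguments.
Unset Strict Implicit.
Unset Printing Implicit Defensive.

Import GRing.Theory.
Import Defs. (* again: all_fingroup shadows [act] *)
Local Open Scope ring_scope.

(** Over an arbitrary commutative ring k there is no Krull-Schmidt theorem in general, and
    idempotents of a quotient category need not lift. This is why the functors are first shown dense
    only up to retracts: Res of a P-projective complex is merely (P u Y)-projective, and cutting out
    the P-projective part amounts to splitting an idempotent modulo X-projectives. Countable sums
    destroy finite length and Fitting's lemma needs it, so the two arguments complement each other.
    Finite length itself has to pass between kG and kH; both are compared with length over k. Traces
    are defined for plain functions that are equivariant under a subgroup, possibly between modules
    over different groups. The identity of Ind M is then the trace of the projection onto 1 (x) M,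
    Ind f is the trace of unit f proj, and Mackey's formula applies to Res Ind without choosing a
    decomposition. The same formula induces contracting homotopies and splittings of V (x) Z, which
    need not come from maps of Z. Relative projectivity allows direct sums of any size; they are
    absorbed because only finitely many subgroups occur. *)

Section CosetSums.
Variables (gT : finGroupType) (A : nmodType).
Implicit Types (Q K L : {group gT}) (phi : gT -> A).

(** * Sums over left cosets of functions that do not depend on the representative *)

Definition rinv (Q L : {set gT}) phi :=
  forall x q, x \in L -> q \in Q -> phi (x * q)%g = phi x.

Lemma mem_repr_lcoset Q x : repr (x *: Q)%g \in (x *: Q)%g.
Proof. exact: mem_repr (lcoset_refl Q x). Qed.

Lemma mem_repr_lcosets Q L C : Q \subset L -> C \in lcosets Q L ->
  repr C \in C /\ repr C \in L.
Proof.
move=> sQL /lcosetsP[x xL ->].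
have m := mem_repr_lcoset Q x; split=> //.
by case/lcosetP: m => q /(subsetP sQL) qL ->; rewrite groupM.
Qed.

Lemma lcoset_repr Q L C : Q \subset L -> C \in lcosets Q L -> (repr C *: Q = C)%g.
Proof.
move=> sQL CQ; have [m _] := mem_repr_lcosets sQL CQ.
case/lcosetsP: CQ m => x xL -> m; exact/lcoset_eqP.
Qed.

Lemma sum_repr_lcoset Q L phi x : Q \subset L -> rinv Q L phi -> x \in L ->
  phi (repr (x *: Q)%g) = phi x.
Proof.
move=> sQL phiP xL; have /lcosetP[q qQ ->] := mem_repr_lcoset Q x.
exact: phiP.
Qed.

(** Right Q-invariance makes the sum the same for every transversal. Translation, transitivity and
    Mackey's formula are then three choices of the transversal t. *)
Lemma sum_transversal (I : finType) (S : {set I}) (t : I -> gT) (T : {set {set gT}})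
    Q L phi : Q \subset L -> rinv Q L phi ->
  {in S, forall i, t i \in L} -> {in S &, injective (fun i => t i *: Q)%g} ->
  T = [set (t i *: Q)%g | i in S] ->
  \sum_(C in T) phi (repr C) = \sum_(i in S) phi (t i).
Proof.
move=> sQL phiP tL tinj ->; rewrite big_imset //=.
by apply: eq_bigr => i iS; rewrite (sum_repr_lcoset sQL phiP) // tL.
Qed.

Lemma sum_shift Q L phi l : Q \subset L -> rinv Q L phi -> l \in L ->
  \sum_(C in lcosets Q L) phi (l * repr C)%g = \sum_(C in lcosets Q L) phi (repr C).
Proof.
move=> sQL phiP lL; symmetry; apply: (sum_transversal sQL phiP).
- by move=> C CQ; rewrite groupM // (mem_repr_lcosets sQL CQ).2.
- move=> C D CQ DQ /=; rewrite !lcosetM !(lcoset_repr sQL) // => e.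
  by rewrite -(lcosetK l C) e lcosetK.
apply/setP => C; apply/idP/imsetP => [CQ|[D DQ ->]].
  exists (l^-1 *: C)%g.
    case/lcosetsP: CQ => x xL ->; apply/lcosetsP.
    by exists (l^-1 * x)%g; rewrite ?groupM ?groupV // lcosetM.
  have lCQ : (l^-1 *: C)%g \in lcosets Q L.
    case/lcosetsP: CQ => x xL ->; apply/lcosetsP.
    by exists (l^-1 * x)%g; rewrite ?groupM ?groupV // lcosetM.
  by rewrite lcosetM (lcoset_repr sQL) // lcosetKV.
by apply/lcosetsP; exists (l * repr D)%g; rewrite // groupM // (mem_repr_lcosets sQL DQ).2.
Qed.

Lemma sum_trans Q K L phi : Q \subset K -> K \subset L -> rinv Q L phi ->
  \sum_(C in lcosets K L) \sum_(B in lcosets Q K) phi (repr C * repr B)%g =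
  \sum_(D in lcosets Q L) phi (repr D).
Proof.
move=> sQK sKL phiP; have sQL := subset_trans sQK sKL.
rewrite pair_big_dep /=.
transitivity (\sum_(p in setX (lcosets K L) (lcosets Q K)) phi (repr p.1 * repr p.2)%g).
  by apply: eq_bigl => -[C B]; rewrite in_setX.
symmetry; apply: (sum_transversal (t := fun p => (repr p.1 * repr p.2)%g) sQL phiP).
- move=> [C B] /setXP[/= CK BK]; rewrite groupM // ?(mem_repr_lcosets sKL CK).2 //.
  by rewrite (subsetP sKL) // (mem_repr_lcosets sQK BK).2.
- move=> [C B] [C' B'] /setXP[/= CK BK] /setXP[/= CK' BK'] /=.
  rewrite !lcosetM !(lcoset_repr sQK) // => e.
  have inK D : D \in lcosets Q K -> (D * K = K)%g.
    by case/lcosetsP => x xK ->; rewrite -mulgA mulSGid // lcoset_id.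
  (* Multiplying on the right by K absorbs the coset inside K and leaves C. *)
  have eC : C = C'.
    rewrite -(lcoset_repr sKL CK) -(lcoset_repr sKL CK').
    by move/(congr1 (fun X => X * K)%g): e; rewrite -!mulgA (inK _ BK) (inK _ BK').
  by rewrite -eC in e *; rewrite -(lcosetK (repr C) B) e lcosetK.
apply/setP => D; apply/lcosetsP/imsetP => [[x xL ->]|[[C B] /setXP[/= CK BK] ->]].
  have xK : (x *: K)%g \in lcosets K L by apply/lcosetsP; exists x.
  have /lcosetP[y yK ey] := mem_repr_lcoset K x.
  have yQ : (y^-1 *: Q)%g \in lcosets Q K by apply/lcosetsP; exists y^-1%g; rewrite ?groupV.
  exists ((x *: K)%g, (y^-1 *: Q)%g); first by rewrite in_setX xK.
  by rewrite /= lcosetM (lcoset_repr sQK) // ey -lcosetM mulgK.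
exists (repr C * repr B)%g => //; rewrite groupM // ?(mem_repr_lcosets sKL CK).2 //.
by rewrite (subsetP sKL) // (mem_repr_lcosets sQK BK).2.
Qed.

Definition dcosets (K Q L : {set gT}) : {set {set gT}} :=
  [set (K * C)%g | C in lcosets Q L].

Lemma dcosets_repr K Q L D : K \subset L -> Q \subset L -> D \in dcosets K Q L ->
  repr D \in L /\ (K * (repr D *: Q) = D)%g.
Proof.
move=> sKL sQL /imsetP[_ /lcosetsP[x xL ->] ->].
have x0 : x \in (K * (x *: Q))%g.
  by rewrite -{1}[x]mul1g mem_mulg // lcoset_refl.
have /mulsgP[k _ kK /lcosetP[q qQ ->] ->] := mem_repr x x0.
split; first by rewrite (groupM (subsetP sKL _ kK)) // (groupM xL) ?(subsetP sQL).
by rewrite !lcosetM (lcoset_id qQ) mulgA (rcoset_id kK).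
Qed.

(** The left cosets of Q inside KgQ are the y g Q with y in K, and y matters only modulo the
    intersection of K with gQg^-1. Since [:^] conjugates on the right, gQg^-1 is written
    [Q :^ g^-1]. *)
Lemma sum_mackey K Q L phi : K \subset L -> Q \subset L -> rinv Q L phi ->
  \sum_(C in lcosets Q L) phi (repr C) =
  \sum_(D in dcosets K Q L)
    \sum_(B in lcosets ((Q :^ (repr D)^-1)%g :&: K) K) phi (repr B * repr D)%g.
Proof.
move=> sKL sQL phiP.
rewrite (partition_big (fun C => K * C)%g (mem (dcosets K Q L))) /=; last first.
  by move=> C CQ; apply/imsetP; exists C.
apply: eq_bigr => D DD; have [gL gD] := dcosets_repr sKL sQL DD.
set g := repr D in gL gD *.
under eq_bigl => C do rewrite -(in_set (fun C => (C \in lcosets Q L) && (K * C == D)%g)).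
have sQK : (Q :^ g^-1 :&: K)%g \subset K by exact: subsetIr.
have sub B : B \in lcosets ((Q :^ g^-1)%g :&: K) K ->
    repr B \in K /\ (repr B *: (Q :^ g^-1 :&: K) = B)%g.
  by move=> BQ; rewrite (mem_repr_lcosets (Q := (Q :^ g^-1 :&: K)%G) sQK BQ).2
    (lcoset_repr (Q := (Q :^ g^-1 :&: K)%G) sQK BQ).
apply: (sum_transversal (t := fun B => (repr B * g)%g) sQL phiP).
- by move=> B /sub[BK _]; rewrite groupM // (subsetP sKL).
- move=> B B' /sub[BK eB] /sub[BK' eB'] /= e; rewrite -eB -eB'.
  have BB : ((repr B')^-1 * repr B)%g \in K by rewrite groupM ?groupV.
  apply/(lcoset_eqP (G := (Q :^ g^-1 :&: K)%G)); rewrite mem_lcoset inE BB andbT.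
  have : (repr B * g)%g \in (repr B' * g *: Q)%g by rewrite -e lcoset_refl.
  by rewrite mem_lcoset mem_conjg invgK conjgE invMg !mulgA.
apply/setP => C; rewrite inE; apply/andP/imsetP => [[/lcosetsP[x xL ->] /eqP e]|[B BQ ->]].
  have : x \in (K * (g *: Q))%g.
    by rewrite gD -e -{1}[x]mul1g mem_mulg // lcoset_refl.
  case/mulsgP => y _ yK /lcosetP[q qQ ->] ->.
  have yQ : (y *: ((Q :^ g^-1)%g :&: K))%g \in lcosets ((Q :^ g^-1)%g :&: K) K.
    by apply/lcosetsP; exists y.
  exists (y *: (Q :^ g^-1 :&: K))%g => //.
  have /lcosetP[z] := mem_repr_lcoset (Q :^ g^-1 :&: K)%G y.
  rewrite inE mem_conjg invgK => /andP[zQ zK] ->.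
  apply/lcoset_eqP; rewrite mem_lcoset.
  move: zQ; rewrite conjgE => zQ.
  have -> : ((y * z * g)^-1 * (y * (g * q)))%g = ((g^-1 * (z * g))^-1 * q)%g.
    by rewrite !invMg !invgK !mulgA mulgKV.
  by rewrite groupM ?groupV.
have [BK _] := sub _ BQ; split.
  by apply/lcosetsP; exists (repr B * g)%g; rewrite // groupM // (subsetP sKL).
by rewrite lcosetM mulgA (rcoset_id BK) gD.
Qed.

End CosetSums.

Definition lin_of (k : comPzRingType) (M N : lmodType k) (f : M -> N)
    (h : linear f) : {linear M -> N} :=
  HB.pack_for {linear M -> N} f (GRing.isLinear.Build k M N *:%R f h).

(** * Maps equivariant under a subgroup, and relative traces *)

Section EquivariantMaps.
Variables (k : comPzRingType) (gT : finGroupType).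

(** Source and target may be modules over different groups and only equivariance under Q is asked,
    so that maps between modules over H and over G compose without inserting restrictions. *)
Definition gmap (Q : {set gT}) (G1 G2 : {group gT}) (M : gmod k G1)
    (N : gmod k G2) (f : M -> N) : Prop :=
  linear f /\ forall q, q \in Q -> forall m, f (act M q m) = act N q (f m).

Section Basic.
Variables (Q : {set gT}) (G1 G2 : {group gT}) (M : gmod k G1) (N : gmod k G2).
Variables (f : M -> N) (hf : gmap Q f).

Lemma gmapP a x y : f (a *: x + y) = a *: f x + f y. Proof. exact: hf.1. Qed.
Lemma gmapD x y : f (x + y) = f x + f y.
Proof. by have := gmapP 1 x y; rewrite !scale1r. Qed.
Lemma gmap0 : f 0 = 0.
Proof. by apply: (addrI (f 0)); rewrite -gmapD !addr0. Qed.
Lemma gmapZ a x : f (a *: x) = a *: f x.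
Proof. by have := gmapP a x 0; rewrite gmap0 !addr0. Qed.
Lemma gmapN x : f (- x) = - f x.
Proof. by rewrite -scaleN1r gmapZ scaleN1r. Qed.
Lemma gmapB x y : f (x - y) = f x - f y.
Proof. by rewrite gmapD gmapN. Qed.
Lemma gmap_sum (I : Type) (r : seq I) (P : pred I) (F : I -> M) :
  f (\sum_(i <- r | P i) F i) = \sum_(i <- r | P i) f (F i).
Proof. exact: (big_morph f gmapD gmap0). Qed.
Lemma gmap_act q m : q \in Q -> f (act M q m) = act N q (f m).
Proof. by move=> qQ; apply: hf.2. Qed.
End Basic.

Lemma gmap_sub (Q Q' : {set gT}) (G1 G2 : {group gT}) (M : gmod k G1)
    (N : gmod k G2) (f : M -> N) : Q' \subset Q -> gmap Q f -> gmap Q' f.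
Proof. by move=> /subsetP s [h1 h2]; split=> // q /s; apply: h2. Qed.

Lemma gmap_comp (Q : {set gT}) (G1 G2 G3 : {group gT}) (M : gmod k G1)
    (N : gmod k G2) (L : gmod k G3) (f : N -> L) (g : M -> N) :
  gmap Q f -> gmap Q g -> gmap Q (fun m => f (g m)).
Proof.
move=> hf hg; split=> [a x y|q qQ m]; first by rewrite (gmapP hg) (gmapP hf).
by rewrite (gmap_act hg) // (gmap_act hf).
Qed.

Lemma gmap_id (Q : {set gT}) (G : {group gT}) (M : gmod k G) : gmap Q (fun m : M => m).
Proof. by split. Qed.

Lemma gmap_ghom (G : {group gT}) (M N : gmod k G) (u : ghom M N) : gmap G u.
Proof. by split=> [a x y|q qG m]; [rewrite linearP | rewrite ghom_act]. Qed.

Definition mkhom (G : {group gT}) (M N : gmod k G) (f : M -> N) (h : gmap G f) :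
    ghom M N := @Ghom _ _ _ M N (lin_of h.1) h.2.

Lemma gactK (G : {group gT}) (M : gmod k G) g : g \in G -> cancel (act M g) (act M g^-1%g).
Proof. by move=> gG m; rewrite -actM ?groupV // mulVg act1. Qed.
Lemma gactKV (G : {group gT}) (M : gmod k G) g : g \in G -> cancel (act M g^-1%g) (act M g).
Proof. by move=> gG m; rewrite -actM ?groupV // mulgV act1. Qed.

Section Trace.
Variables (G1 G2 : {group gT}) (M : gmod k G1) (N : gmod k G2).
Implicit Types (f : M -> N).

Definition conjf (g : gT) f : M -> N := fun m => act N g (f (act M g^-1%g m)).

(** The relative trace from Q to L. The choice made by [repr] is harmless when f is Q-equivariant,
    by [conj_rinv]. *)
Definition tr (Q L : {set gT}) f : M -> N :=
  fun m => \sum_(C in lcosets Q L) conjf (repr C) f m.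

Variables (L : {group gT}) (sL1 : L \subset G1) (sL2 : L \subset G2).
Let in1 x : x \in L -> x \in G1. Proof. exact: (subsetP sL1). Qed.
Let in2 x : x \in L -> x \in G2. Proof. exact: (subsetP sL2). Qed.

Lemma conjfM f x y m : x \in L -> y \in L ->
  conjf (x * y)%g f m = conjf x (conjf y f) m.
Proof.
by move=> xL yL; rewrite /conjf invMg !actM ?groupV ?in1 ?in2.
Qed.

Lemma conjf_fix (Q : {group gT}) f q m : Q \subset L -> gmap Q f -> q \in Q ->
  conjf q f m = f m.
Proof.
move=> /subsetP sQL hf qQ; rewrite /conjf -(gmap_act hf) // gactKV //.
by apply/in1/sQL.
Qed.

Lemma conjf_linear f x : linear f -> linear (conjf x f).
Proof. by move=> hf a u v; rewrite /conjf linearP hf linearP. Qed.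

Lemma conj_gmap (Q : {group gT}) f g : Q \subset L -> gmap Q f -> g \in L ->
  gmap (Q :^ g^-1)%g (conjf g f).
Proof.
move=> /subsetP sQL hf gL; split=> [|q]; first exact: conjf_linear hf.1.
rewrite mem_conjg invgK conjgE => qQ m.
have qL : q \in L.
  by have := sQL _ qQ; rewrite groupMl ?groupV // groupMr.
have cL := sQL _ qQ; have gV : g^-1%g \in L by rewrite groupV.
rewrite /conjf -(actM (in2 qL) (in2 gL)) -(actM (in1 gV) (in1 qL)).
have -> : (g^-1 * q = (g^-1 * (q * g)) * g^-1)%g by rewrite !mulgA mulgK.
rewrite (actM (in1 cL) (in1 gV)) (gmap_act hf _ qQ).
by rewrite -(actM (in2 gL) (in2 cL)) !mulgA mulgV mul1g.
Qed.

Lemma conj_rinv (Q : {group gT}) f m : Q \subset L -> gmap Q f ->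
  rinv Q L (fun x => conjf x f m).
Proof.
move=> sQL hf x q xL qQ; rewrite conjfM // ?(subsetP sQL) //.
by rewrite {1}/conjf (conjf_fix _ sQL hf).
Qed.

Lemma tr_gmap (Q : {group gT}) f : Q \subset L -> gmap Q f -> gmap L (tr Q L f).
Proof.
move=> sQL hf; split=> [a x y|l lL m].
  rewrite /tr scaler_sumr -big_split; apply: eq_bigr => C _.
  exact: (conjf_linear _ hf.1).
rewrite /tr linear_sum -(sum_shift sQL (conj_rinv _ sQL hf) lL).
apply: eq_bigr => C CQ; have [_ CL] := mem_repr_lcosets sQL CQ.
rewrite conjfM // /conjf gactK //; exact: in1.
Qed.

Lemma tr_ext (Q : {set gT}) f f' : (forall m, f m = f' m) ->
  forall m, tr Q L f m = tr Q L f' m.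
Proof. by move=> e m; apply: eq_bigr => C _; rewrite /conjf e. Qed.

Lemma tr_add (Q : {set gT}) f f' m :
  tr Q L (fun x => f x + f' x) m = tr Q L f m + tr Q L f' m.
Proof.
by rewrite /tr -big_split; apply: eq_bigr => C _; rewrite /conjf linearD.
Qed.

Lemma tr_trans (Q K : {group gT}) f m : Q \subset K -> K \subset L -> gmap Q f ->
  tr K L (tr Q K f) m = tr Q L f m.
Proof.
move=> sQK sKL hf; have sQL := subset_trans sQK sKL.
rewrite /tr -(sum_trans sQK sKL (conj_rinv _ sQL hf)); apply: eq_bigr => C CK.
rewrite {1}/conjf linear_sum; apply: eq_bigr => B BQ.
rewrite conjfM ?(mem_repr_lcosets sKL CK).2 //.
exact: (subsetP sKL _ (mem_repr_lcosets sQK BQ).2).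
Qed.

Lemma tr_mackey (Q K : {group gT}) f m : K \subset L -> Q \subset L -> gmap Q f ->
  tr Q L f m =
  \sum_(D in dcosets K Q L) tr ((Q :^ (repr D)^-1)%g :&: K) K (conjf (repr D) f) m.
Proof.
move=> sKL sQL hf; rewrite /tr (sum_mackey sKL sQL (conj_rinv _ sQL hf)).
apply: eq_bigr => D DD; have [DL _] := dcosets_repr sKL sQL DD.
apply: eq_bigr => B BQ; rewrite conjfM //.
have sQK : (Q :^ (repr D)^-1)%g :&: K \subset K by exact: subsetIr.
exact: (subsetP sKL _ (mem_repr_lcosets (Q := ((Q :^ (repr D)^-1) :&: K)%G) sQK BQ).2).
Qed.
End Trace.

Section TraceComp.
Variables (G1 G2 G3 : {group gT}) (M : gmod k G1) (N : gmod k G2) (P : gmod k G3).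
Variables (Q L : {group gT}).
Hypothesis sQL : Q \subset L.

Lemma tr_compl (f : M -> N) (g : N -> P) m : gmap L g ->
  g (tr Q L f m) = tr Q L (fun x => g (f x)) m.
Proof.
move=> hg; rewrite /tr (gmap_sum hg); apply: eq_bigr => C CQ.
by rewrite /conjf (gmap_act hg) // (mem_repr_lcosets sQL CQ).2.
Qed.

Lemma tr_compr (f : N -> P) (g : M -> N) m : gmap L g ->
  tr Q L f (g m) = tr Q L (fun x => f (g x)) m.
Proof.
move=> hg; apply: eq_bigr => C CQ.
by rewrite /conjf (gmap_act hg) // groupV (mem_repr_lcosets sQL CQ).2.
Qed.
End TraceComp.
End EquivariantMaps.

(** * Linear maps out of modules given by generators *)

Section PresentedModules.
Variables (k : comPzRingType) (S : choiceType).
Variable tests : forall A : lmodType k, (S -> A) -> Prop.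

Lemma pev_linear (A : lmodType k) (b : S -> A) :
  tests b -> linear (pev b : pres tests -> A).
Proof. by move=> tb a x y; rewrite /GRing.add /GRing.scale /= pevD // pevZ. Qed.

Definition pevl (A : lmodType k) (b : S -> A) (tb : tests b) :
  {linear pres tests -> A} := lin_of (pev_linear tb).

Lemma pevlE (A : lmodType k) (b : S -> A) (tb : tests b) x : pevl tb x = pev b x.
Proof. by []. Qed.

Lemma pevl_gen (A : lmodType k) (b : S -> A) (tb : tests b) s : pevl tb (gen tests s) = b s.
Proof. exact: pev_gen. Qed.

Lemma pres_decomp (x : pres tests) : x = \sum_(p <- generic_quotient.repr x) p.1 *: gen tests p.2.
Proof.
apply: pev_inj => A b tb.
rewrite -[RHS](pevlE tb) linear_sum /pev /evl; apply: eq_bigr => p _.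
by rewrite linearZ pevl_gen.
Qed.

Lemma pres_gen_ext (A : lmodType k) (f g : pres tests -> A) : linear f -> linear g ->
  (forall s, f (gen tests s) = g (gen tests s)) -> forall x, f x = g x.
Proof.
move=> lf lg e x; rewrite -[f x]/(lin_of lf x) -[g x]/(lin_of lg x).
rewrite (pres_decomp x) !linear_sum; apply: eq_bigr => p _.
by rewrite !linearZ /= e.
Qed.
End PresentedModules.

Lemma pres_map_gen (k : comPzRingType) (S S' : choiceType)
    (tests : forall A : lmodType k, (S -> A) -> Prop)
    (tests' : forall A : lmodType k, (S' -> A) -> Prop) (f : S -> S')
    (cf : pres_compat tests tests' f) s :
  pres_map cf (gen tests s) = gen tests' (f s).
Proof.
apply: pev_inj => A b tb; rewrite pev_fun // !pev_gen //; exact: cf.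
Qed.

(** * Unit, projection and both adjunctions for induced modules *)

Section InducedModules.
Variables (k : comPzRingType) (gT : finGroupType) (K G : {group gT}).
Hypothesis sKG : K \subset G.

Definition ind_unit (M : gmod k K) (m : M) : gind G M := gen (@balanced _ _ K G M) (1%g, m).

Section OneModule.
Variable M : gmod k K.

(** Kills the components x (x) M with x outside K. Besides being a retraction of the unit, it is the
    counit that makes induction a right adjoint of restriction. *)
Definition ind_proj_fun (p : subg_of G * M) : M :=
  if val p.1 \in K then act M (val p.1) p.2 else 0.

Lemma ind_proj_balanced : balanced ind_proj_fun.
Proof.
split=> [x a m n|x y m yK]; rewrite /ind_proj_fun /=.
  by case: ifP; rewrite ?linearP // scaler0 addr0.
rewrite /ind_proj_fun /= groupMr //; case: ifP => // xK.
by rewrite actM.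
Qed.

Definition ind_proj (t : gind G M) : M := pevl ind_proj_balanced t.

Lemma gen_lin (x : subg_of G) : linear (fun m : M => gen (@balanced _ _ K G M) (x, m)).
Proof.
move=> a m n; apply: pev_inj => A b tb.
by rewrite (pev_linear tb) !pev_gen // tb.1.
Qed.

Lemma gen_mul (x y : subg_of G) (m : M) : val y \in K ->
  gen (@balanced _ _ K G M) ((x * y)%g, m) = gen (@balanced _ _ K G M) (x, act M (val y) m).
Proof.
by move=> yK; apply: pev_inj => A b tb; rewrite !pev_gen // tb.2.
Qed.

Lemma act_gen g (x : subg_of G) (m : M) :
  act (gind G M) g (gen (@balanced _ _ K G M) (x, m)) =
  gen (@balanced _ _ K G M) ((subg G g * x)%g, m).
Proof. by rewrite /= pres_map_gen. Qed.

Lemma gen_unit (x : subg_of G) (m : M) :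
  gen (@balanced _ _ K G M) (x, m) = act (gind G M) (val x) (ind_unit m).
Proof. by rewrite act_gen mulg1 /= sgvalK. Qed.

Lemma ind_unit_gmap : gmap K (@ind_unit M).
Proof.
split=> [|q qK m]; first exact: gen_lin.
rewrite /ind_unit act_gen mulg1 -[subg G q]mul1g gen_mul ?subgK //; exact: (subsetP sKG).
Qed.

Lemma proj_act_unit g m : g \in G ->
  ind_proj (act (gind G M) g (ind_unit m)) = if g \in K then act M g m else 0.
Proof.
by move=> gG; rewrite /ind_proj act_gen mulg1 pevl_gen /ind_proj_fun /= subgK.
Qed.

Lemma proj_unit m : ind_proj (ind_unit m) = m.
Proof. by rewrite -[ind_unit m](@act1 _ _ _ (gind G M)) proj_act_unit // group1 act1. Qed.

Lemma ind_proj_gmap : gmap K ind_proj.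
Proof.
split=> [|q qK]; first exact: linearP.
have qG := subsetP sKG _ qK.
apply: pres_gen_ext => [a x y|a x y|[x m]].
- by rewrite /ind_proj !linearP.
- by rewrite /ind_proj !linearP.
rewrite gen_unit -actM //; last exact: subgP.
rewrite !proj_act_unit //; [|exact: subgP|by rewrite groupM //; exact: subgP].
by rewrite groupMl //; case: ifP => xK; rewrite ?actM ?linear0.
Qed.

Lemma K_in_lcosets : (K : {set gT}) \in lcosets K G.
Proof. by apply/lcosetsP; exists 1%g; rewrite ?lcoset_id. Qed.

Lemma repr_notin C : C \in lcosets K G -> C != K -> repr C \notin K.
Proof.
move=> CK; apply: contra => rK; rewrite -(lcoset_repr sKG CK).
by rewrite lcoset_id.
Qed.

(** Only the coset K contributes, because [ind_proj] kills r^-1 (x) m for r outside K. Thus the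
    trace is the extension of the kK-map f to Ind M, as in the adjunction of induction with
    restriction. *)
Lemma tr_proj_unit (G' : {group gT}) (N : gmod k G') (f : M -> N) m :
  G \subset G' -> gmap K f -> tr K G (fun t => f (ind_proj t)) (ind_unit m) = f m.
Proof.
move=> sGG' hf; rewrite /tr (bigD1 (K : {set gT}) K_in_lcosets) /=.
rewrite big1 ?addr0 => [|C /andP[CK nC]].
  have rK : repr (K : {set gT}) \in K by exact: (mem_repr 1%g).
  have rV : (repr (K : {set gT}))^-1%g \in K by rewrite groupV.
  rewrite /conjf proj_act_unit ?(subsetP sKG _ rV) // rV (gmap_act hf _ rV).
  by rewrite gactKV //; apply/(subsetP sGG')/(subsetP sKG).
have [_ rG] := mem_repr_lcosets sKG CK.
rewrite /conjf proj_act_unit ?groupV // (negPf (repr_notin CK nC)).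
by rewrite (gmap0 hf) linear0.
Qed.

(** The dual computation: the translates by r outside K land in components that [ind_proj] kills. It
    gives the adjunction in which restriction is on the left. *)
Lemma proj_tr_unit (G' : {group gT}) (X : gmod k G') (f : X -> M) x :
  G \subset G' -> gmap K f -> ind_proj (tr K G (fun x => ind_unit (f x)) x) = f x.
Proof.
move=> sGG' hf; rewrite /tr (gmap_sum ind_proj_gmap) (bigD1 (K : {set gT}) K_in_lcosets) /=.
rewrite big1 ?addr0 => [|C /andP[CK nC]].
  have rK : repr (K : {set gT}) \in K by exact: (mem_repr 1%g).
  rewrite /conjf proj_act_unit ?(subsetP sKG _ rK) // rK -(gmap_act hf _ rK).
  by rewrite gactKV //; apply/(subsetP sGG')/(subsetP sKG).
have [_ rG] := mem_repr_lcosets sKG CK.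
by rewrite /conjf proj_act_unit // (negPf (repr_notin CK nC)).
Qed.

Lemma ind_ext (A : lmodType k) (f g : gind G M -> A) : linear f -> linear g ->
  (forall x m, x \in G -> f (act (gind G M) x (ind_unit m)) = g (act (gind G M) x (ind_unit m))) ->
  forall t, f t = g t.
Proof.
move=> lf lg e; apply: pres_gen_ext => // -[x m]; rewrite gen_unit e //; exact: subgP.
Qed.

(** The projections onto the components r (x) M are the conjugates of [ind_unit] after [ind_proj],
    and they add up to the identity. This is the easy half of Higman's criterion and replaces
    coordinates in all later arguments on induced modules. *)
Lemma ind_trK t : tr K G (fun t => ind_unit (ind_proj t)) t = t.
Proof.
have h : gmap K (fun t : gind G M => ind_unit (ind_proj t)).
  exact: gmap_comp ind_unit_gmap ind_proj_gmap.
have hG := tr_gmap (subxx G) (subxx G) sKG h.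
move: t; apply: ind_ext => //; first exact: hG.1.
by move=> x m xG; rewrite (gmap_act hG) // tr_proj_unit //; exact: ind_unit_gmap.
Qed.
End OneModule.

Lemma gind_map_unit (M N : gmod k K) (u : ghom M N) m :
  gind_map G u (ind_unit m) = ind_unit (u m).
Proof. by rewrite /= pres_map_gen. Qed.

Lemma proj_gind_map (M N : gmod k K) (u : ghom M N) t :
  ind_proj (gind_map G u t) = u (ind_proj t).
Proof.
move: t; apply: ind_ext => [a x y|a x y|x m xG].
- by rewrite /ind_proj !linearP.
- by rewrite /ind_proj !linearP.
rewrite ghom_act // gind_map_unit !proj_act_unit //.
by case: ifP => xK; rewrite ?ghom_act ?linear0.
Qed.
End InducedModules.

(** * Tensor products with a fixed module, and their interplay with induction *)

Section TensorMaps.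
Variables (k : comPzRingType) (gT : finGroupType).

Definition tgen (V M : lmodType k) (v : V) (m : M) : tens V M := gen (@bilin k V M) (v, m).

Lemma tens_ext (V M A : lmodType k) (f g : tens V M -> A) : linear f -> linear g ->
  (forall v m, f (tgen v m) = g (tgen v m)) -> forall t, f t = g t.
Proof. by move=> lf lg e; apply: pres_gen_ext => // -[v m]; apply: e. Qed.

Lemma tgen_lin (V M : lmodType k) (v : V) : linear (fun m : M => tgen v m).
Proof.
move=> a x y; apply: pev_inj => A b tb.
by rewrite (pev_linear tb) !pev_gen // tb.1.
Qed.

Lemma tens_map_gen (V V' M M' : lmodType k) (f : {linear V -> V'})
    (u : {linear M -> M'}) v m : tens_map f u (tgen v m) = tgen (f v) (u m).
Proof. exact: pres_map_gen. Qed.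

Definition idt (V : lmodType k) (M N : lmodType k) (u : {linear M -> N}) :
  {linear tens V M -> tens V N} := tens_map idfun u.

Lemma idt_ext (V M N : lmodType k) (u u' : {linear M -> N}) : u =1 u' ->
  idt V u =1 idt V u'.
Proof.
move=> e; apply: tens_ext => [a x y|a x y|v m]; rewrite ?linearP //.
by rewrite !tens_map_gen e.
Qed.

Lemma idt_comp (V M N L : lmodType k) (u : {linear N -> L}) (u' : {linear M -> N}) x :
  idt V u (idt V u' x) = idt V (u \o u' : {linear M -> L}) x.
Proof.
move: x; apply: tens_ext => [a x y|a x y|v m]; rewrite ?linearP //.
by rewrite !tens_map_gen.
Qed.

Lemma tens_gmap (Q : {set gT}) (G1 G2 : {group gT}) (V : gmod k G1) (V' : gmod k G2)
    (M : gmod k G1) (N : gmod k G2) (v : {linear V -> V'}) (u : {linear M -> N}) :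
  gmap Q v -> gmap Q u -> @gmap k gT Q G1 G2 (gtens V M) (gtens V' N) (tens_map v u).
Proof.
move=> hv hu; split=> [a x y|q qQ]; first by rewrite linearP.
apply: tens_ext => [a x y|a x y|w m]; rewrite ?linearP //.
change (tens_map v u (tens_map (act V q) (act M q) (tgen w m)) =
  tens_map (act V' q) (act N q) (tens_map v u (tgen w m))).
by rewrite !tens_map_gen (gmap_act hu) // (gmap_act hv).
Qed.
End TensorMaps.

Section TensorInduction.
Variables (k : comPzRingType) (gT : finGroupType) (K G : {group gT}).
Hypothesis sKG : K \subset G.
Variable V : gmod k G.
Let VK := gres sKG V.

Section OneModule.
Variable M : gmod k K.
Definition tens_unit : {linear gtens VK M -> gtens V (gind G M)} :=
  idt V (lin_of (ind_unit_gmap sKG M).1).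
Definition tens_proj : {linear gtens V (gind G M) -> gtens VK M} :=
  idt V (lin_of (@ind_proj_gmap _ _ _ _ sKG M).1).

Lemma tens_unit_gmap : gmap K tens_unit.
Proof.
apply: (@tens_gmap _ _ K K G VK V M (gind G M) idfun (lin_of (ind_unit_gmap sKG M).1)).
  by [].
exact: ind_unit_gmap.
Qed.
Lemma tens_proj_gmap : gmap K tens_proj.
Proof.
apply: (@tens_gmap _ _ K G K V VK (gind G M) M idfun (lin_of (@ind_proj_gmap _ _ _ _ sKG M).1)).
  by [].
exact: ind_proj_gmap.
Qed.

(** Under diagonal conjugation the action on V cancels, so the trace of id (x) (unit proj) is id (x)
    the trace computed in [ind_trK]. This plays the role of the projection formula V (x) Ind M = Ind
    (Res V (x) M). *)
Lemma tens_trK t : tr K G (fun t => tens_unit (tens_proj t)) t = t.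
Proof.
have h := tr_gmap (subxx G) (subxx G) sKG (gmap_comp tens_unit_gmap tens_proj_gmap).
move: t; apply: tens_ext => [||v m]; [exact: h.1|by []|].
have he : linear (fun m => tgen v m : gtens V (gind G M)) by exact: tgen_lin.
rewrite -[in RHS](ind_trK sKG m) /tr -[RHS]/(lin_of he _) linear_sum; apply: eq_bigr => C CK.
have [_ CG] := mem_repr_lcosets sKG CK.
rewrite /conjf.
change (tens_map (act V (repr C)) (act (gind G M) (repr C))
  (tens_map idfun (lin_of (ind_unit_gmap sKG M).1) (tens_map idfun (lin_of (@ind_proj_gmap _ _ _ _ sKG M).1)
    (tens_map (act V (repr C)^-1) (act (gind G M) (repr C)^-1) (tgen v m)))) =
   tgen v (act (gind G M) (repr C) (ind_unit G (ind_proj (act (gind G M) (repr C)^-1 m))))).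
by rewrite !tens_map_gen /= gactKV.
Qed.
End OneModule.

(** Ind u, read through the projection formula. The map u is not assumed to be of the form id (x) a,
    so that homotopies and sections that exist only after tensoring with V can be induced. *)
Definition tindf (M N : gmod k K) (u : gtens VK M -> gtens VK N) :
    gtens V (gind G M) -> gtens V (gind G N) :=
  tr K G (fun t => tens_unit N (u (tens_proj M t))).

Lemma tindf_gmap (M N : gmod k K) (u : gtens VK M -> gtens VK N) :
  gmap K u -> gmap G (tindf u).
Proof.
move=> hu; apply: tr_gmap => //.
exact: gmap_comp (tens_unit_gmap N) (gmap_comp hu (tens_proj_gmap M)).
Qed.

Lemma tindf_compl (M N N' : gmod k K) (u : gtens VK M -> gtens VK N) (a : ghom N N') t :
  gtens_map V (gind_map G a) (tindf u t) = tindf (fun t => gtens_map VK a (u t)) t.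
Proof.
rewrite /tindf (tr_compl sKG _ _ (gmap_ghom (gtens_map V (gind_map G a)))).
apply: tr_ext => s; move: (u _) => {}s.
rewrite -[LHS]/(idt V (gind_map G a) (idt V _ s)) -[RHS]/(idt V _ (idt V a s)) !idt_comp.
by apply: idt_ext => m; exact: gind_map_unit.
Qed.

Lemma tindf_compr (M M' N : gmod k K) (u : gtens VK M -> gtens VK N) (a : ghom M' M) t :
  tindf u (gtens_map V (gind_map G a) t) = tindf (fun t => u (gtens_map VK a t)) t.
Proof.
rewrite /tindf (tr_compr sKG _ _ (gmap_ghom (gtens_map V (gind_map G a)))).
apply: tr_ext => s; congr (tens_unit _ (u _)).
rewrite -[RHS]/(idt V a (idt V _ s)) -[LHS]/(idt V _ (idt V (gind_map G a) s)) !idt_comp.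
by apply: idt_ext => m; exact: proj_gind_map.
Qed.

Lemma tindf_id (M : gmod k K) (u : gtens VK M -> gtens VK M) :
  (forall t, u t = t) -> forall t, tindf u t = t.
Proof.
by move=> e t; rewrite -[RHS]tens_trK; apply: tr_ext => s; rewrite e.
Qed.

Lemma tindf_add (M N : gmod k K) (u u' : gtens VK M -> gtens VK N) t :
  tindf (fun t => u t + u' t) t = tindf u t + tindf u' t.
Proof.
by rewrite /tindf -tr_add; apply: tr_ext => s; rewrite linearD.
Qed.
Lemma tindf_ext (M N : gmod k K) (u u' : gtens VK M -> gtens VK N) t :
  (forall t, u t = u' t) -> tindf u t = tindf u' t.
Proof. by move=> e; apply: tr_ext => s; rewrite e. Qed.
End TensorInduction.

(** * Equivariant maps of complexes, and induced complexes *)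

Section ComplexMaps.
Variables (k : comPzRingType) (gT : finGroupType).

Definition cmap (Q : {set gT}) (G1 G2 : {group gT}) (X : cpx k G1) (Y : cpx k G2)
    (f : forall i, X i -> Y i) : Prop :=
  (forall i, gmap Q (f i)) /\ forall i x, f (i + 1) (cd X i x) = cd Y i (f i x).

Definition mkchmap (G : {group gT}) (X Y : cpx k G) (f : forall i, X i -> Y i)
    (h : cmap G f) : chmap X Y :=
  @Chmap _ _ _ X Y (fun i => mkhom (h.1 i)) h.2.

Lemma cmap_chmap (G : {group gT}) (X Y : cpx k G) (f : chmap X Y) :
  cmap G (fun i (x : X i) => f i x).
Proof. by split=> [i|i x]; [exact: gmap_ghom | exact: cmd]. Qed.

Lemma cmap_sub (Q Q' : {set gT}) (G1 G2 : {group gT}) (X : cpx k G1) (Y : cpx k G2)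
    (f : forall i, X i -> Y i) : Q' \subset Q -> cmap Q f -> cmap Q' f.
Proof. by move=> s [h1 h2]; split=> // i; apply: gmap_sub (h1 i). Qed.

Lemma cmap_comp (Q : {set gT}) (G1 G2 G3 : {group gT}) (X : cpx k G1) (Y : cpx k G2)
    (Z : cpx k G3) (f : forall i, Y i -> Z i) (g : forall i, X i -> Y i) :
  cmap Q f -> cmap Q g -> cmap Q (fun i x => f i (g i x)).
Proof.
move=> [f1 f2] [g1 g2]; split=> [i|i x]; first exact: gmap_comp.
by rewrite g2 f2.
Qed.

Definition ctr (Q L : {set gT}) (G1 G2 : {group gT}) (X : cpx k G1) (Y : cpx k G2)
    (f : forall i, X i -> Y i) : forall i, X i -> Y i := fun i => tr Q L (f i).
Arguments ctr Q L {G1 G2 X Y} f i x.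

Lemma ctr_cmap (Q L G1 G2 : {group gT}) (X : cpx k G1) (Y : cpx k G2)
    (f : forall i, X i -> Y i) : L \subset G1 -> L \subset G2 -> Q \subset L ->
  cmap Q f -> cmap L (ctr Q L f).
Proof.
move=> s1 s2 sQL [f1 f2]; split=> [i|i x]; first exact: tr_gmap.
rewrite /ctr (tr_compr sQL _ _ (gmap_sub s1 (gmap_ghom (cd X i)))).
rewrite (tr_compl sQL _ _ (gmap_sub s2 (gmap_ghom (cd Y i)))).
by apply: tr_ext => m; rewrite f2.
Qed.

Lemma cconj_cmap (Q L G1 G2 : {group gT}) (X : cpx k G1) (Y : cpx k G2)
    (f : forall i, X i -> Y i) g : L \subset G1 -> L \subset G2 -> Q \subset L ->
  g \in L -> cmap Q f -> cmap (Q :^ g^-1)%g (fun i => conjf g (f i)).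
Proof.
move=> s1 s2 sQL gL [f1 f2]; split=> [i|i x]; first exact: (conj_gmap s1 s2 sQL (f1 i) gL).
rewrite /conjf -(gmap_act (gmap_ghom (cd X i))) ?groupV ?(subsetP s1) // f2.
by rewrite (gmap_act (gmap_ghom (cd Y i))) // (subsetP s2).
Qed.
End ComplexMaps.
Arguments ctr {k gT} Q L {G1 G2 X Y} f i x.

Section InducedComplexes.
Variables (k : comPzRingType) (gT : finGroupType) (K G : {group gT}).
Hypothesis sKG : K \subset G.

Definition cind_unit (Z : cpx k K) i (z : Z i) : cind G Z i := ind_unit G z.
Definition cind_proj (Z : cpx k K) i (t : cind G Z i) : Z i := ind_proj t.

Lemma cind_unit_cmap (Z : cpx k K) : cmap K (@cind_unit Z).
Proof.
split=> [i|i x]; first exact: (ind_unit_gmap sKG).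
by rewrite /cind_unit -gind_map_unit.
Qed.
Lemma cind_proj_cmap (Z : cpx k K) : cmap K (@cind_proj Z).
Proof.
split=> [i|i x]; first exact: (ind_proj_gmap sKG).
exact: (proj_gind_map (cd Z i) x).
Qed.

(** By [ind_trK] a cycle is the sum of the translates of its components, and each component is a
    cycle of Z. One primitive per coset suffices, and no equivariance of the choice is required. *)
Lemma exact_cind (Z : cpx k K) : exact Z -> exact (cind G Z).
Proof.
move=> eZ i x dx.
have h C : exists z, C \in lcosets K G ->
    cd Z i z = cind_proj (act (cind G Z (i + 1)) (repr C)^-1%g x).
  case: (boolP (C \in lcosets K G)) => [CK|_]; last by exists 0.
  have [_ CG] := mem_repr_lcosets sKG CK.
  have [|z <-] := eZ i (cind_proj (act (cind G Z (i + 1)) (repr C)^-1%g x)).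
    rewrite -(cind_proj_cmap Z).2 (ghom_act (cd (cind G Z) (i + 1))) ?groupV //.
    by rewrite dx !linear0 (gmap0 ((cind_proj_cmap Z).1 _)).
  by exists z.
have {h} [z hz] := choice h.
exists (\sum_(C in lcosets K G) act (cind G Z i) (repr C) (cind_unit (z C))).
rewrite -[RHS](ind_trK sKG) /tr linear_sum; apply: eq_bigr => C CK.
have [_ CG] := mem_repr_lcosets sKG CK.
rewrite /conjf (ghom_act (cd (cind G Z) i)) // -(cind_unit_cmap Z).2 hz //.
Qed.

Lemma contractible_cind (V : gmod k G) (Z : cpx k K) :
  contractible (ctens (gres sKG V) Z) -> contractible (ctens V (cind G Z)).
Proof.
move=> [h hh]; exists (fun i => mkhom (tindf_gmap (gmap_ghom (h i)))) => i x.
rewrite -[cd (ctens V (cind G Z)) _]/(gtens_map V (gind_map G (cd Z i))).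
rewrite -[cd (ctens V (cind G Z)) _]/(gtens_map V (gind_map G (cd Z (i + 1)))).
rewrite -[mkhom _ _]/(tindf (h i) x) -[mkhom _ _]/(tindf (h (i + 1)) _).
rewrite tindf_compl tindf_compr -tindf_add tindf_id //.
by move=> t; rewrite [RHS]hh.
Qed.

Lemma contractible_cres (V : gmod k G) (X : cpx k G) :
  contractible (ctens V X) -> contractible (ctens (gres sKG V) (cres sKG X)).
Proof.
move=> [h hh].
have hK i : @gmap k gT K K K (ctens (gres sKG V) (cres sKG X) (i + 1))
   (ctens (gres sKG V) (cres sKG X) i) (h i).
  exact: (gmap_sub sKG (gmap_ghom (h i))).
by exists (fun i => mkhom (hK i)) => i x; exact: hh.
Qed.

Section Sequences.
Variables (X Y Z : cpx k K) (f : chmap X Y) (g : chmap Y Z).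

(** As in [exact_cind], preimages are chosen for the component at each coset and translated back. *)
Lemma short_exact_cind : short_exact f g ->
  short_exact (cind_map G f) (cind_map G g).
Proof.
move=> e i; have [fi fg gs] := e i.
have fi0 x : f i x = 0 -> x = 0 by move=> h; apply: fi; rewrite h linear0.
have gf0 x : g i (f i x) = 0 by apply/fg; exists x.
have c1f t : ind_proj (cind_map G f i t) = f i (ind_proj t) by exact: proj_gind_map.
have c1g t : ind_proj (cind_map G g i t) = g i (ind_proj t) by exact: proj_gind_map.
split.
- move=> s t /eqP; rewrite -subr_eq0 -linearB => /eqP h; apply/eqP; rewrite -subr_eq0.
  apply/eqP; move: {s t}(s - t) h => t h.
  rewrite -(ind_trK sKG t) /tr big1 // => C CK.
  have [_ CG] := mem_repr_lcosets sKG CK.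
  rewrite /conjf (fi0 (ind_proj _)) ?(gmap0 (ind_unit_gmap sKG _)) ?linear0 //.
  rewrite -c1f ghom_act ?groupV // h linear0.
  exact: (gmap0 (ind_proj_gmap sKG (Y i))).
- move=> t; split=> [h|[x <-]].
    have hC C : exists z, C \in lcosets K G ->
        f i z = ind_proj (act (cind G Y i) (repr C)^-1%g t).
      case: (boolP (C \in lcosets K G)) => [CK|_]; last by exists 0.
      have [_ CG] := mem_repr_lcosets sKG CK.
      have /fg[z hz] : g i (ind_proj (act (cind G Y i) (repr C)^-1%g t)) = 0.
        by rewrite -c1g ghom_act ?groupV // h linear0 (gmap0 (ind_proj_gmap sKG (Z i))).
      by exists z.
    have {hC} [z hz] := choice hC.
    exists (\sum_(C in lcosets K G) act (cind G X i) (repr C) (cind_unit (z C))).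
    rewrite -[RHS](ind_trK sKG) /tr linear_sum; apply: eq_bigr => C CK.
    have [_ CG] := mem_repr_lcosets sKG CK.
    rewrite /conjf ghom_act //; congr (act _ _ _); rewrite -hz //; exact: gind_map_unit.
  move: x; apply: (ind_ext (f := fun x => cind_map G g i (cind_map G f i x)) (g := fun=> 0)).
  - by move=> a u v; rewrite !linearP.
  - by move=> a u v; rewrite scaler0 addr0.
  move=> x m xG; rewrite !ghom_act //.
  have -> : cind_map G f i (ind_unit G m) = ind_unit G (f i m) by exact: gind_map_unit.
  have -> : cind_map G g i (ind_unit G (f i m)) = ind_unit G (g i (f i m)) by exact: gind_map_unit.
  by rewrite gf0 (gmap0 (ind_unit_gmap sKG _)) linear0.
- move=> t.
  have hC C : exists y, g i y = ind_proj (act (cind G Z i) (repr C)^-1%g t) by apply: gs.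
  have {hC} [y hy] := choice hC.
  exists (\sum_(C in lcosets K G) act (cind G Y i) (repr C) (cind_unit (y C))).
  rewrite -[RHS](ind_trK sKG) /tr linear_sum; apply: eq_bigr => C CK.
  have [_ CG] := mem_repr_lcosets sKG CK.
  rewrite /conjf ghom_act //; congr (act _ _ _); rewrite -hy //; exact: gind_map_unit.
Qed.
End Sequences.
End InducedComplexes.

Lemma pred_ext (T : Type) (A B : T -> Prop) :
  (forall x, A x -> B x) -> (forall x, B x -> A x) -> A = B.
Proof. by move=> AB BA; apply/funext => x; apply/propext; split; [exact: AB | exact: BA]. Qed.

(** * Chains of submodules and composition length *)

Section FiniteLength.
Variables (k : comPzRingType) (gT : finGroupType).

Section OneModule.
Variables (G : {group gT}) (M : gmod k G).
Implicit Types (K : {set gT}) (A B C U T : M -> Prop).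

(** With K empty these are the k-submodules, so length over kG and length over k are instances of
    one notion. *)
Definition subm K U : Prop :=
  [/\ U 0, forall x y, U x -> U y -> U (x + y), forall a x, U x -> U (a *: x)
    & forall g x, g \in K -> U x -> U (act M g x)].

Definition step K A B : Prop :=
  [/\ subm K A, subm K B, forall x, A x -> B x
    & forall U, subm K U -> (forall x, A x -> U x) -> (forall x, U x -> B x) ->
        (forall x, U x -> A x) \/ (forall x, B x -> U x)].

(* Steps are allowed to be equalities; [n] only bounds the length. *)
Inductive fl K : nat -> (M -> Prop) -> (M -> Prop) -> Prop :=
| fl0 A : subm K A -> fl K 0 A A
| flS n A B C : fl K n A B -> step K B C -> fl K n.+1 A C.

Lemma subm_sub K K' U : K' \subset K -> subm K U -> subm K' U.
Proof. by move=> /subsetP s [? ? ? h]; split=> // g x /s; apply: h. Qed.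

Lemma submB K U x y : subm K U -> U x -> U y -> U (x - y).
Proof.
by move=> [_ hD hZ _] ux uy; apply: hD => //; rewrite -scaleN1r; apply: hZ.
Qed.

Lemma submI K U T : subm K U -> subm K T -> subm K (fun x => U x /\ T x).
Proof.
move=> [u0 uD uZ ua] [t0 tD tZ ta]; split=> //.
- by move=> x y [? ?] [? ?]; split; [apply: uD | apply: tD].
- by move=> a x [? ?]; split; [apply: uZ | apply: tZ].
- by move=> g x gK [? ?]; split; [apply: ua | apply: ta].
Qed.

Lemma fl_subm K n A B : fl K n A B ->
  [/\ subm K A, subm K B & forall x, A x -> B x].
Proof.
elim=> {n A B} [A sA|n A B C _ [sA sB AB] [_ sC BC _]]; split=> //.
by move=> x /AB/BC.
Qed.

Lemma fl_cat K n m A B C : fl K n A B -> fl K m B C -> exists n', fl K n' A C.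
Proof.
move=> h h'; elim: h' h => {m B C} [B _ h|m B C D _ IH s /IH[n' h]]; first by exists n.
by exists n'.+1; apply: flS h s.
Qed.
End OneModule.

Section Image.
Variables (K : {set gT}) (G1 G2 : {group gT}) (M : gmod k G1) (N : gmod k G2).
Variables (j : M -> N) (hj : gmap K j).
Variables (U : N -> Prop) (sU : subm K U).
Implicit Types A B : M -> Prop.

Definition addim A : N -> Prop := fun y => exists u x, [/\ U u, A x & y = u + j x].

Lemma addim_subm A : subm K A -> subm K (addim A).
Proof.
move: sU => [u0 uD uZ ua] [a0 aD aZ aa]; split.
- by exists 0, 0; rewrite (gmap0 hj) addr0.
- move=> _ _ [u [x [Uu Ax ->]]] [v [y [Uv Ay ->]]].
  exists (u + v), (x + y); split; [exact: uD|exact: aD|].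
  by rewrite (gmapD hj) addrACA.
- move=> a _ [u [x [Uu Ax ->]]]; exists (a *: u), (a *: x).
  by split; [exact: uZ|exact: aZ|rewrite (gmapZ hj) scalerDr].
- move=> g _ gK [u [x [Uu Ax ->]]]; exists (act N g u), (act M g x).
  by split; [exact: ua|exact: aa|rewrite (gmap_act hj) // linearD].
Qed.

(** A submodule T between the two sums contains U, hence is U + j(B cap j^-1 T), and the step from A
    to B decides what B cap j^-1 T is. *)
Lemma addim_step A B : step K A B -> step K (addim A) (addim B).
Proof.
move=> [sA sB AB h]; split; [exact: addim_subm|exact: addim_subm| |].
  by move=> y [u [x [Uu /AB Bx e]]]; exists u, x.
move=> T sT AT TB.
have UT u : U u -> T u.
  by move=> Uu; apply: AT; exists u, 0; rewrite (gmap0 hj) addr0; split=> //; case: sA.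
have sjT : subm K (fun x => T (j x)).
  move: sT => [t0 tD tZ ta]; split; first by rewrite (gmap0 hj).
  - by move=> x y tx ty; rewrite (gmapD hj); apply: tD.
  - by move=> a x tx; rewrite (gmapZ hj); apply: tZ.
  - by move=> g x gK tx; rewrite (gmap_act hj) //; apply: ta.
have [||TA|BT] := h _ (submI sB sjT).
- move=> x Ax; split; first exact: AB.
  by apply: AT; exists 0, x; rewrite add0r; split=> //; case: sU.
- by move=> x [].
- left=> y Ty; have [u [x [Uu Bx e]]] := TB _ Ty; exists u, x; split=> //.
  apply: TA; split=> //; have -> : j x = y - u by rewrite e addrC addKr.
  by apply: submB sT Ty _; apply: UT.
- right=> _ [u [x [Uu Bx ->]]]; case: (sT) => [_ tD _ _]; apply: tD; first exact: UT.
  by have [] := BT _ Bx.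
Qed.

Lemma addim_fl n A B : fl K n A B -> fl K n (addim A) (addim B).
Proof.
elim=> {n A B} [A /addim_subm|n A B C _ IH /addim_step s]; first exact: fl0.
exact: flS IH s.
Qed.
End Image.

Section OneModuleAgain.
Variables (G : {group gT}) (M : gmod k G).
Implicit Types (K : {set gT}) (A B C U T : M -> Prop).

(** Let B < C be the last step. Then U + B is B or C: in the first case U lies in B and the step
    goes above U; in the second, the modular law turns it into the step from U cap B to U. No length
    is lost, which later inductions rely on. *)
Lemma fl_between K n A B U : fl K n A B -> subm K U ->
  (forall x, A x -> U x) -> (forall x, U x -> B x) ->
  exists n1 n2, [/\ fl K n1 A U, fl K n2 U B & (n1 + n2 = n)%N].
Proof.
move=> h; elim: h U => {n A B} [A sA|n A B C hAB IH [sB sC BC hBC]] U sU AU UC.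
  have -> : U = A by apply: pred_ext.
  by exists 0%N, 0%N; split=> //; apply: fl0.
have [sA _ AB] := fl_subm hAB.
have sUB := submI sU sB.
have [x Ax|x []//|n1 [n2 [h1 h2 e]]] := IH _ sUB; first by split; auto.
have hj : gmap K (fun x : M => x) by exact: gmap_id.
pose W := addim (fun x => x) U B.
have [uD bD] : (forall x y, U x -> U y -> U (x + y)) /\
    (forall x y, C x -> C y -> C (x + y)) by split; [case: sU | case: sC].
have BW x : B x -> W x by move=> Bx; exists 0, x; rewrite add0r; split=> //; case: sU.
have UW x : U x -> W x by move=> Ux; exists x, 0; rewrite addr0; split=> //; case: sB.
have [|WB|CW] := hBC W (addim_subm hj sU sB) BW.
- by move=> _ [u [x [/UC Uu /BC Bx ->]]]; apply: bD.
- have UB : (fun x => U x /\ B x) = U.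
    by apply: pred_ext => x; [case | move=> Ux; split=> //; apply/WB/UW].
  rewrite UB in h1 h2; exists n1, n2.+1; split=> //; last by rewrite addnS e.
  exact: flS h2 _.
have h2' : fl K n2 U C.
  have := addim_fl hj sU h2.
  have -> : addim (fun x => x) U (fun x => U x /\ B x) = U.
    apply: pred_ext => [_ [u [x [Uu [Ux _] ->]]]|x Ux]; first exact: uD.
    by exists x, 0; rewrite addr0; split=> //; case: sUB.
  have -> // : addim (fun x => x) U B = C.
  apply: pred_ext => [_ [u [x [/UC Uu /BC Bx ->]]]|x /CW//]; exact: bD.
exists n1.+1, n2; split=> //; last by rewrite addSn e.
apply: flS h1 _; split=> // [x []//|T sT T1 T2].
have [||hT|hT] := hBC (addim (fun x => x) B T) (addim_subm hj sB sT).
- by move=> x Bx; exists x, 0; rewrite addr0; split=> //; case: sT.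
- by move=> _ [u [x [/BC Uu /T2/UC Bx ->]]]; apply: bD.
- left=> x Tx; split; first exact: T2.
  by apply: hT; exists 0, x; rewrite add0r; split=> //; case: sB.
- right=> x Ux; have [b [t [Bb Tt ex]]] := hT _ (UC _ Ux).
  have [_ tD _ _] := sT; rewrite ex; apply: tD => //; apply: T1; split=> //.
  have -> : b = x - t by rewrite ex addrK.
  by apply: submB sU Ux _; apply: T2.
Qed.

(** Strong induction on the length over k: either nothing K-stable lies strictly between A and B,
    and they form one step over K, or some U does and cuts the chain into two shorter ones. *)
Lemma fl_coarse K n A B : fl set0 n A B -> subm K A -> subm K B -> exists n', fl K n' A B.
Proof.
elim: {n}(n.+1) {-2}n (ltnSn n) A B => // n IH m; rewrite ltnS => mn A B h sA sB.
have [_ _ AB] := fl_subm h.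
have [[U [sU AU UB nUA nBU]]|no] := pselect (exists U, [/\ subm K U, forall x, A x -> U x,
    forall x, U x -> B x, ~ (forall x, U x -> A x) & ~ (forall x, B x -> U x)]).
  have [n1 [n2 [h1 h2 e]]] := fl_between h (subm_sub (sub0set K) sU) AU UB.
  have n1P : (0 < n1)%N by case: n1 h1 {e} => // h1; inversion h1; subst; case: nUA.
  have n2P : (0 < n2)%N by case: n2 h2 {e} => // h2; inversion h2; subst; case: nBU.
  have [|m1 k1] := IH n1 _ A U h1 sA sU.
    by apply: leq_trans mn; rewrite -e -addn1 leq_add2l.
  have [|m2 k2] := IH n2 _ U B h2 sU sB.
    by apply: leq_trans mn; rewrite -e -add1n leq_add2r.
  exact: fl_cat k1 k2.
exists 1%N; apply: flS (fl0 sA) _; split=> // U sU AU UB.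
have [|nUA] := pselect (forall x, U x -> A x); first by left.
have [|nBU] := pselect (forall x, B x -> U x); first by right.
by case: no; exists U; split.
Qed.

Lemma finite_lengthP : finite_length M <->
  exists n, fl G n (fun x : M => x = 0) (fun=> True).
Proof.
split=> [[n [F [sF F0 Fn hF]]]|[n h]].
  have h i : (i <= n)%N -> fl G i (F 0%N) (F i).
    elim: i => [_|i IH ni]; first exact: (fl0 (sF 0%N)).
    apply: flS (IH (ltnW ni)) _; have [h1 _ h3] := hF _ ni.
    by split=> //; exact: sF.
  exists n; have := h n (leqnn n).
  rewrite (_ : F 0%N = fun x => x = 0); last by apply: pred_ext => x /F0.
  by rewrite (_ : F n = fun=> True) //; apply: pred_ext.
have [m [F [sF F0 Fm hF]]] : exists m (F : nat -> M -> Prop),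
    [/\ forall i, subm G (F i), F 0%N = (fun x => x = 0), F m = (fun=> True)
    & forall i, (i < m)%N -> step G (F i) (F i.+1) /\ exists x, F i.+1 x /\ ~ F i x].
  elim: h => {n} [A sA|n A B C _ [m [F [sF F0 Fm hF]]] hs].
    by exists 0%N, (fun=> A).
  (* An equality step is dropped, so that the surviving inclusions are strict as a composition
     series demands. *)
  have [CB|nCB] := pselect (forall x, C x -> B x).
    exists m, F; split=> //; rewrite Fm; apply: pred_ext => //.
    by case: hs.
  exists m.+1, (fun i => if (i <= m)%N then F i else C); split.
  - by move=> i; case: ifP => // _; case: hs.
  - by [].
  - by rewrite ltnn.
  move=> i; rewrite ltnS => im; rewrite im.
  case: ltnP => [/hF//|mi]; have {im mi} -> : i = m by apply/eqP; rewrite eqn_leq im.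
  rewrite Fm; split=> //; apply: contrapT => no; apply: nCB => x Cx.
  by apply: contrapT => nB; apply: no; exists x.
exists m, F; split=> //; first by rewrite F0.
  by rewrite Fm.
by move=> i /hF[[_ _ h1 h2] h3]; split.
Qed.

Lemma sub_zero K : subm K (fun x : M => x = 0).
Proof.
split=> // [x y -> ->|a x ->|g x _ ->]; rewrite ?addr0 ?scaler0 ?linear0 //.
Qed.
Lemma sub_true K : subm K (fun x : M => True).
Proof. by []. Qed.
End OneModuleAgain.
End FiniteLength.

(** * Finite length over kG is finite length over k *)

Section ForgetAction.
Variables (k : comPzRingType) (gT : finGroupType) (G : {group gT}) (M : gmod k G).
Implicit Types A B T U : M -> Prop.

Definition over A B T : Prop :=
  [/\ subm set0 T, forall x, A x -> T x, forall x, T x -> B x & ~ (forall x, B x -> T x)].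

(** A simple kG-module is generated over k by the finitely many translates of one element, so Zorn's
    lemma yields a maximal proper k-submodule. *)
Lemma exists_maximal_sub A B : step G A B -> ~ (forall x, B x -> A x) ->
  exists T, over A B T /\
    forall W, over A B W -> (forall x, T x -> W x) -> forall x, W x -> T x.
Proof.
move=> [sA sB AB hAB] nBA.
have [x [Bx nAx]] : exists x, B x /\ ~ A x.
  by apply: contrapT => no; apply: nBA => x Bx; apply: contrapT => nA; apply: no; exists x.
have oA : over A B A by split=> //; apply: subm_sub sA; apply: sub0set.
(* As B/A is simple over kG and x is not in A, the translates of x generate B over A as a
   k-module. *)
have cover U : subm set0 U -> (forall y, A y -> U y) ->
    (forall p, p \in G -> U (act M p x)) -> forall y, B y -> U y.
  move=> sU AU Up.
  pose W y := forall U, subm set0 U -> (forall y, A y -> U y) ->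
    (forall p, p \in G -> U (act M p x)) -> U y.
  have sW : subm G W.
    split.
    - by move=> T [].
    - move=> y z Wy Wz T sT AT Tp; case: (sT) => _ tD _ _.
      by apply: tD; [apply: Wy | apply: Wz].
    - by move=> a y Wy T sT AT Tp; case: (sT) => _ _ tZ _; apply: tZ; apply: Wy.
    - move=> g y gG Wy T sT AT Tp; apply: (Wy (fun y => T (act M g y))).
      + case: sT => t0 tD tZ _; split; rewrite ?linear0 //.
        * by move=> u v Tu Tv; rewrite linearD; apply: tD.
        * by move=> a u Tu; rewrite linearZ; apply: tZ.
        * by move=> h u; rewrite inE.
      + by move=> u Au; apply: AT; case: sA => _ _ _; apply.
      + by move=> p pG; rewrite -actM //; apply: Tp; rewrite groupM.
  have Wx : W x by move=> T sT AT Tp; rewrite -[x](@act1 _ _ _ M); apply: Tp.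
  have [||WA|BW] := hAB W sW.
  - by move=> y Ay T sT AT Tp; apply: AT.
  - move=> y; apply; [exact: subm_sub (sub0set _) sB|exact: AB|].
    by move=> p pG; case: sB => _ _ _; apply.
  - by case: nAx; apply: WA.
  - by move=> y /BW Wy; apply: Wy.
pose P : classical_sets.set (classical_sets.set M) :=
  fun T => T = (fun=> False) \/ over A B T.
have [|T [PT maxT]] := @classical_sets.Zorn_bigcup M P.
  move=> F FP tot.
  have [[T0 [FT0 oT0]]|none] := pselect (exists T, F T /\ over A B T); last first.
    left; apply: pred_ext => // y [T FT Ty]; have := FP _ FT; case=> [e|oT].
      by rewrite e in Ty.
    by case: none; exists T.
  right; have ov T y : F T -> T y -> over A B T.
    by move=> FT Ty; have := FP _ FT; case=> // e; rewrite e in Ty.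
  (* If finitely many translates of x lie in the union of the chain, one member contains them all;
     that member would be B, so the union is proper. *)
  have fin (s : seq gT) : (forall p, p \in s -> exists T, F T /\ T (act M p x)) ->
      exists T, [/\ F T, over A B T & forall p, p \in s -> T (act M p x)].
    elim: s => [|p s IH] hs; first by exists T0.
    have [|T1 [F1 o1 h1]] := IH; first by move=> q qs; apply: hs; rewrite inE qs orbT.
    have [|T2 [F2 h2]] := hs p; first by rewrite inE eqxx.
    have [T12|T21] := tot _ _ F1 F2.
      exists T2; split=> //; first exact: ov h2.
      by move=> q; rewrite inE => /orP[/eqP-> //|/h1 /T12].
    exists T1; split=> // q; rewrite inE => /orP[/eqP->|/h1 //]; exact: T21.
  split.
  - split.
    + by exists T0 => //; case: oT0 => [[]].
    + move=> y z [T1 F1 y1] [T2 F2 z2].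
      have [T12|T21] := tot _ _ F1 F2.
        exists T2 => //; have [[_ tD _ _] _ _ _] := ov _ _ F2 z2.
        by apply: tD => //; apply: T12.
      exists T1 => //; have [[_ tD _ _] _ _ _] := ov _ _ F1 y1.
      by apply: tD => //; apply: T21.
    + move=> a y [T1 F1 y1]; exists T1 => //; have [[_ _ tZ _] _ _ _] := ov _ _ F1 y1.
      exact: tZ.
    + by move=> g y; rewrite inE.
  - by move=> y Ay; exists T0 => //; case: oT0 => _ h _ _; apply: h.
  - by move=> y [T1 F1 y1]; have [_ _ h _] := ov _ _ F1 y1; apply: h.
  - move=> hB; have [p|T [FT [sT AT TB nT] hT]] := fin (enum G).
      rewrite mem_enum => pG; have [|T FT Tp] := hB (act M p x); last by exists T.
      by case: sB => _ _ _; apply.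
    by apply: nT; apply: cover => // p pG; apply: hT; rewrite mem_enum.
have oT : over A B T.
  case: PT => // e; case: (maxT A); last by right.
  split; first by rewrite e.
  by move=> h; have := h 0; rewrite e; apply; case: sA.
exists T; split=> // W oW TW y Wy; apply: contrapT => nT.
apply: (maxT W); last by right.
by split=> // h; apply/nT/h.
Qed.

(** For a maximal k-submodule T, the intersection of the translates of T is G-stable and proper,
    hence equal to A. Intersecting with one more translate costs at most one step, and G is
    finite. *)
Lemma fl_forget_step A B : step G A B -> exists n, fl set0 n A B.
Proof.
move=> hs; have [sA sB AB hAB] := hs.
have sA0 := subm_sub (sub0set G) sA; have sB0 := subm_sub (sub0set G) sB.
have [BA|nBA] := pselect (forall x, B x -> A x).
  by exists 0%N; have -> : B = A by [apply: pred_ext]; apply: fl0.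
have [T [[sT AT TB nT] maxT]] := exists_maximal_sub hs nBA.
have [t0 tD tZ _] := sT; have [b0 bD bZ ba] := sB; have [a0 aD aZ aa] := sA.
pose X (s : seq gT) y := B y /\ forall p, p \in s -> T (act M p y).
have sX s : subm set0 (X s).
  split.
  - by split=> // p _; rewrite linear0.
  - move=> y z [By Ty] [Bz Tz]; split; first exact: bD.
    by move=> p ps; rewrite linearD; apply: tD; auto.
  - move=> a y [By Ty]; split; first exact: bZ.
    by move=> p ps; rewrite linearZ; apply: tZ; apply: Ty.
  - by move=> g y; rewrite inE.
have flX (s : seq gT) : {subset s <= G} -> exists n, fl set0 n (X s) B.
  elim: s => [|p s IH] sG.
    exists 0%N; have -> : X [::] = B by apply: pred_ext => [y []|y By]//; split.
    exact: fl0.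
  have [q qs|n hn] := IH; first by apply: sG; rewrite inE qs orbT.
  have pG : p \in G by apply: sG; rewrite inE eqxx.
  have h1 : fl set0 1 (X (p :: s)) (X s).
    apply: flS (fl0 (sX _)) _; split=> //.
      by move=> y [By h]; split=> // q qs; apply: h; rewrite inE qs orbT.
    move=> U sU XU UX.
    have hj : gmap set0 (fun y : M => act M p y).
      by split=> [a u v|q]; [rewrite linearP | rewrite inE].
    (* W = T + pU lies between T and B, so by maximality it is T or B. *)
    pose W := addim (fun y => act M p y) T U.
    have sW : subm set0 W := addim_subm hj sT sU.
    have TW y : T y -> W y.
      by move=> Ty; exists y, 0; rewrite linear0 addr0; split=> //; case: sU.
    have WB y : W y -> B y.
      move=> [t [u [/TB Bt /UX[Bu _] ->]]]; apply: bD => //; exact: ba.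
    have [BW|nBW] := pselect (forall y, B y -> W y).
      right=> y [By Xy]; have [t [u [Tt Uu e]]] := BW _ (ba _ _ pG By).
      have [Bu Xu] := UX _ Uu.
      have -> : y = (y - u) + u by rewrite subrK.
      case: (sU) => _ uD _ _; apply: uD => //; apply: XU; split; first exact: (submB sB0).
      move=> q; rewrite inE => /orP[/eqP->|qs]; first by rewrite linearB e addrK.
      by rewrite linearB; apply: (submB sT); auto.
    left=> y Uy; have [By Xy] := UX _ Uy; split=> // q; rewrite inE => /orP[/eqP->|/Xy//].
    apply: (maxT W) => //; first by split=> // z /AT/TW.
    by exists 0, y; rewrite add0r.
  exact: fl_cat h1 hn.
have [|n hn] := flX (enum G); first by move=> p; rewrite mem_enum.
exists n; suff <- : X (enum G) = A by [].
have sXG : subm G (X (enum G)).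
  case: (sX (enum G)) => x0 xD xZ _; split=> // g y gG [By Xy]; split; first exact: ba.
  move=> p; rewrite mem_enum => pG; rewrite -actM //; apply: Xy.
  by rewrite mem_enum groupM.
have AX y : A y -> X (enum G) y.
  move=> Ay; split=> [|p]; first exact: AB.
  by rewrite mem_enum => pG; apply/AT/aa.
apply: pred_ext => // y; have [|XA|BX] := hAB _ sXG AX; first by move=> z [].
  exact: XA.
case: nT => z /BX[_ h]; rewrite -[z](@act1 _ _ _ M); apply: h.
by rewrite mem_enum group1.
Qed.

Lemma fl_forget n A B : fl G n A B -> exists m, fl set0 m A B.
Proof.
elim=> {n A B} [A sA|n A B C _ [m hm] /fl_forget_step[m' hm']].
  by exists 0%N; apply: fl0; apply: subm_sub (sub0set _) sA.
exact: fl_cat hm hm'.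
Qed.
End ForgetAction.

Section FiniteLengthTransfer.
Variables (k : comPzRingType) (gT : finGroupType).

Lemma finite_length_forget (G : {group gT}) (M : gmod k G) : finite_length M <->
  exists n, fl set0 n (fun x : M => x = 0) (fun=> True).
Proof.
split=> [/finite_lengthP[n /fl_forget[m h]]|[n /fl_coarse h]]; first by exists m.
by apply/finite_lengthP; apply: h; [exact: sub_zero | exact: sub_true].
Qed.

Lemma fl_surj (G1 G2 : {group gT}) (M : gmod k G1) (N : gmod k G2) (j : M -> N) :
  gmap set0 j -> (forall y, exists x, j x = y) -> finite_length M -> finite_length N.
Proof.
move=> hj sj /finite_length_forget[n h]; apply/finite_length_forget; exists n.
have := addim_fl hj (sub_zero N set0) h.
rewrite (_ : addim j _ (fun x => x = 0) = fun y => y = 0); last first.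
  apply: pred_ext => [_ [_ [_ [-> -> ->]]]|_ ->]; first by rewrite (gmap0 hj) addr0.
  by exists 0, 0; rewrite (gmap0 hj) addr0.
rewrite (_ : addim j _ (fun=> True) = fun=> True) //.
apply: pred_ext => // y _; have [x <-] := sj y.
by exists 0, x; rewrite add0r.
Qed.

Lemma finite_length_gres (G H : {group gT}) (sHG : H \subset G) (M : gmod k G) :
  finite_length M -> finite_length (gres sHG M).
Proof.
apply: (@fl_surj G H M (gres sHG M) (fun x => x)); last by move=> y; exists y.
by split=> // q; rewrite inE.
Qed.

(** Over k, Ind M is the sum of the images g (x) M, each of which adds at most the length of M.
    Taking all g in G instead of a transversal only adds equality steps. *)
Lemma finite_length_gind (K G : {group gT}) (sKG : K \subset G) (M : gmod k K) :
  finite_length M -> finite_length (gind G M).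
Proof.
move=> /finite_length_forget[n h]; apply/finite_length_forget.
have hs (s : seq gT) : {subset s <= G} -> exists n U,
    fl set0 n (fun x : gind G M => x = 0) U /\
    forall g m, g \in s -> U (act (gind G M) g (ind_unit G m)).
  elim: s => [|g s IH] sG.
    exists 0%N, (fun x => x = 0); split=> //; apply: fl0; exact: sub_zero.
  have [q qs|n1 [U [h1 hU]]] := IH; first by apply: sG; rewrite inE qs orbT.
  have hj : gmap set0 (fun m : M => act (gind G M) g (ind_unit G m)).
    by split=> [a x y|q]; rewrite ?inE // (gmapP (ind_unit_gmap sKG M)) linearP.
  have [_ sU _] := fl_subm h1.
  have h2 := addim_fl hj sU h.
  have e0 : addim (fun m : M => act (gind G M) g (ind_unit G m)) U (fun x => x = 0) = U.
    apply: pred_ext => [_ [u [_ [Uu -> ->]]]|u Uu].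
      by rewrite (gmap0 hj) addr0.
    by exists u, 0; rewrite (gmap0 hj) addr0.
  rewrite e0 in h2; have [m hm] := fl_cat h1 h2.
  exists m, (addim (fun m : M => act (gind G M) g (ind_unit G m)) U (fun=> True)); split=> //.
  move=> q x; rewrite inE => /orP[/eqP->|qs].
    by exists 0, x; rewrite add0r; split=> //; case: sU.
  exists (act (gind G M) q (ind_unit G x)), 0; rewrite (gmap0 hj) addr0; split=> //.
  exact: hU.
have [|m [U [hm hU]]] := hs (enum G); first by move=> g; rewrite mem_enum.
exists m; rewrite (_ : (fun=> True) = U) //; apply: pred_ext => // t _.
have [_ [u0 uD uZ ua] _] := fl_subm hm.
rewrite -(ind_trK sKG t) /tr; apply: big_ind => // C CK.
by apply: hU; rewrite mem_enum (mem_repr_lcosets sKG CK).2.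
Qed.
End FiniteLengthTransfer.

Local Open Scope pcat_scope.
Lemma dchoice (A : Type) (B : A -> Type) (R : forall x, B x -> Prop) :
  (forall x, exists y : B x, R x y) -> exists f : forall x, B x, forall x, R x (f x).
Proof. by move=> h; exists (fun x => projT1 (cid (h x))) => x; case: (cid (h x)). Qed.

(** * Factorizations in preadditive categories *)

Section PcatLemmas.
Variable C : pcat.

Lemma hcomp4 (X1 X2 X3 X4 X5 : C) (a : hom X1 X2) (i : hom X2 X3) (p : hom X3 X4)
    (b : hom X4 X5) : (b \oc p) \oc (i \oc a) =h (b \oc (p \oc i)) \oc a.
Proof. by rewrite !hcompA. Qed.

Lemma factors_single (N : C -> Prop) (Z : C) :
  N Z -> (forall X Y, N X -> N Y -> exists2 D, N D & is_biproduct X Y D) ->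
  forall (X Y : C) (f : hom X Y), factors N f ->
  exists W (a : hom X W) (b : hom W Y), N W /\ f =h b \oc a.
Proof.
move=> NZ NB X Y f; elim=> {f} [W a b NW||f g _ [W [a [b [NW e]]]] _ [W' [a' [b' [NW' e']]]]|f g e _ [W [a [b [NW e']]]]].
- by exists W, a, b.
- by exists Z, (hzero _ _), (hzero _ _); split=> //; rewrite hcomp0r.
- have [D ND [i [j [p [q [h1 h2 h3 h4 h5]]]]]] := NB _ _ NW NW'.
  exists D, ((i \oc a) +h (j \oc a')), ((b \oc p) +h (b' \oc q)); split=> //.
  rewrite !hcompDl !hcompDr !hcomp4 h1 h2 h3 h4 !hcomp0r !hcomp0l !hcomp1r.
  by rewrite hadd0 hadd0r e e'.
- by exists W, a, b; split=> //; rewrite -e.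
Qed.

(** Brings an element of the ideal into the shape that [rel_projective] expects, one factorization
    through a direct sum of objects of N. Sums of morphisms become biproducts, indexed by disjoint
    unions. *)
Lemma factors_direct_sum (N : C -> Prop) : additive C ->
  forall (X Y : C) (f : hom X Y), factors N f ->
  exists (I : Type) (W : I -> C) (D : C) (a : hom X D) (b : hom D Y),
    [/\ forall i, N (W i), is_direct_sum W D & f =h b \oc a].
Proof.
move=> [[Z Z0] bip] X Y f; elim=> {f} [W a b NW||f g _ [I [W [D [a [b [NW hD e]]]]]] _ [I' [W' [D' [a' [b' [NW' hD' e']]]]]]|f g e _ [I [W [D [a [b [NW hD e']]]]]]].
- exists unit, (fun=> W), W, a, b; split=> //.
  exists (fun=> hid W) => Y' u; exists (u tt); split=> [[]|h' hh']; rewrite ?hcomp1r //.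
  by rewrite -(hh' tt) hcomp1r.
- exists void, (of_void C), Z, (hzero _ _), (hzero _ _); split=> //; last by rewrite hcomp0r.
  exists (fun i : void => match i with end) => Y' u; exists (hzero _ _); split=> // h' _.
  by rewrite -(hcomp1r h') Z0 hcomp0r.
- have [B [i [j [p [q [h1 h2 h3 h4 h5]]]]]] := bip D D'.
  exists (I + I')%type, (fun s => match s with inl x => W x | inr x => W' x end), B.
  exists ((i \oc a) +h (j \oc a')), ((b \oc p) +h (b' \oc q)); split.
  + by case.
  + have [inj hi] := hD; have [inj' hi'] := hD'.
    exists (fun s => match s return hom (match s with inl x => W x | inr x => W' x end) B with
       inl x => i \oc inj x | inr x => j \oc inj' x end) => Y' u.
    have [v [hv uv]] := hi _ (fun x => u (inl x)).
    have [v' [hv' uv']] := hi' _ (fun x => u (inr x)).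
    exists ((v \oc p) +h (v' \oc q)); split.
      case=> x; rewrite hcompDl !hcomp4.
        by rewrite h1 h4 hcomp0r hcomp0l hadd0r hcomp1r.
      by rewrite h2 h3 hcomp0r hcomp0l hadd0 hcomp1r.
    move=> h hh; rewrite -(hcomp1r h) - h5 hcompDr !hcompA.
    have -> : h \oc i =h v.
      by apply: uv => x; rewrite -hcompA; apply: (hh (inl x)).
    have -> : h \oc j =h v'.
      by apply: uv' => x; rewrite -hcompA; apply: (hh (inr x)).
    reflexivity.
  rewrite !hcompDl !hcompDr !hcomp4 h1 h2 h3 h4 !hcomp0r !hcomp0l !hcomp1r.
  by rewrite hadd0 hadd0r e e'.
- by exists I, W, D, a, b; split=> //; rewrite -e.
Qed.
End PcatLemmas.

(* The universal property is only used componentwise, one map for each a : A, so that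
   no direct sum of the K a is needed. *)
Lemma direct_sum_factors (C : pcat) (A : finType) (D : C) (K : A -> C)
    (e : forall a, hom (K a) D) (I : Type) (W : I -> C) (inj : forall i, hom (W i) D) :
  (forall Y (f : forall i, hom (W i) Y), exists h : hom D Y,
     (forall i, h \oc inj i =h f i) /\
     (forall h' : hom D Y, (forall i, h' \oc inj i =h f i) -> h' =h h)) ->
  (forall i, exists a (m : hom (W i) (K a)), e a \oc m =h inj i) ->
  factors (fun X => exists a, X = K a) (hid D).
Proof.
move=> univ /dchoice[a0 h0].
pose good a i (m : hom (W i) (K a)) : Prop :=
  (a0 i = a -> e a \oc m =h inj i) /\ (a0 i <> a -> e a \oc m =h hzero _ _).
have fac a i : exists m, good a i m.
  have [<-|ne] := eqVneq (a0 i) a; last first.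
    exists (hzero _ _); split=> [ea|_]; last by rewrite hcomp0r.
    by case/eqP: ne.
  by have [m hm] := h0 i; exists m; split.
(* For each finite s, an endomorphism in the ideal that is the identity on the summands labelled in
   s and zero on the others. *)
have part (s : seq A) : uniq s -> exists g : hom D D,
    factors (fun X => exists a, X = K a) g /\
    forall i, (a0 i \in s -> g \oc inj i =h inj i) /\
              (a0 i \notin s -> g \oc inj i =h hzero _ _).
  elim: s => [_|a s IH /andP[nas us]].
    exists (hzero _ _); split; first exact: factors_zero.
    by move=> i; split=> // _; rewrite hcomp0l.
  have [g [Jg hg]] := IH us.
  have [m hm] := dchoice (fac a).
  have [h [hh _]] := univ _ m.
  exists (g +h (e a \oc h)); split.
    by apply: factors_add => //; apply: factors_through; exists a.
  have ee i : (g +h (e a \oc h)) \oc inj i =h (g \oc inj i) +h (e a \oc m i).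
    by rewrite hcompDl -hcompA hh.
  move=> i; rewrite inE negb_or; split=> [/orP[/eqP ea|ai]|/andP[/eqP na nai]]; rewrite ee.
  - by rewrite (hg i).2 ?ea // (hm i).1 // hadd0.
  - rewrite (hg i).1 // (hm i).2 ?hadd0r // => ea.
    by rewrite -ea ai in nas.
  - by rewrite (hg i).2 // (hm i).2 // hadd0.
have [g [Jg hg]] := part (enum A) (enum_uniq _).
have [h [hh uh]] := univ _ inj.
apply: factors_heq Jg; rewrite (uh g); last by move=> i; apply: (hg i).1; rewrite mem_enum.
by symmetry; apply: uh => i; rewrite hcomp1l.
Qed.

Section FullFactors.
Variables (C : pcat) (P Q : C -> Prop).

(** Describes factorizations inside [full P] by objects and morphisms of C, so that arguments about
    ideals avoid subset types. *)
Inductive factors_in (X Y : C) : hom X Y -> Prop :=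
| factors_in_through W (a : hom X W) (b : hom W Y) : P W -> Q W -> factors_in (b \oc a)
| factors_in_zero : factors_in (hzero X Y)
| factors_in_add f g : factors_in f -> factors_in g -> factors_in (f +h g)
| factors_in_heq f g : f =h g -> factors_in f -> factors_in g.

Lemma full_factors (X Y : full P) (f : @hom C (sval X) (sval Y)) :
  @factors (full P) (fun W => Q (sval W)) X Y f <-> factors_in f.
Proof.
split.
  elim=> {f} [W a b QW||f g _ If _ Ig|f g e _ If].
  - exact: factors_in_through (svalP W) QW.
  - exact: factors_in_zero.
  - exact: factors_in_add.
  - exact: factors_in_heq If.
case: X Y f => [X PX] [Y PY] /= f h; elim: h PX PY => {f} [W a b PW QW||f g _ If _ Ig|f g e _ If] PX PY.
- exact: (@factors_through (full P) (fun W => Q (sval W)) (exist _ X PX) (exist _ Y PY) (exist _ W PW)).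
- exact: factors_zero.
- exact: factors_add (If _ _) (Ig _ _).
- exact: (@factors_heq (full P) _ (exist _ X PX) (exist _ Y PY) f g e (If _ _)).
Qed.

Lemma factors_sub (N : C -> Prop) (X Y : C) (f : hom X Y) :
  (forall W, N W -> P W /\ Q W) -> factors N f -> factors_in f.
Proof.
move=> NPQ; elim=> {f} [W a b /NPQ[PW QW]||f g _ If _ Ig|f g e _ If].
- exact: factors_in_through PW QW.
- exact: factors_in_zero.
- exact: factors_in_add.
- exact: factors_in_heq If.
Qed.
End FullFactors.

Section FullQuotient.
Variables (C : pcat) (P Q : C -> Prop).
Notation QF := (quot (fun W : full P => Q (sval W))).

Definition qfo (X : QF) : C := sval X.
Definition qfh (X Y : QF) (f : hom X Y) : hom (qfo X) (qfo Y) := f.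
Definition hqf (X Y : QF) (f : hom (qfo X) (qfo Y)) : hom X Y := f.

Lemma hqfK (X Y : QF) (f : hom (qfo X) (qfo Y)) : qfh (hqf f) = f. Proof. by []. Qed.
Lemma qfo_prop X : P (qfo X). Proof. exact: svalP X. Qed.
Lemma qfh_id X : qfh (hid X) = hid (qfo X). Proof. by []. Qed.
Lemma qfh_comp X Y Z (f : hom Y Z) (g : hom X Y) : qfh (f \oc g) = qfh f \oc qfh g.
Proof. by []. Qed.
Lemma qfh_heq X Y (f g : hom X Y) :
  f =h g <-> factors_in P Q (qfh f -h qfh g).
Proof. exact: full_factors. Qed.
End FullQuotient.

(** * Split monomorphisms and thick subcategories in triangulated categories *)

Section Triangles.
Variables (C : pcat) (T : triangulation C).
Let S := shift T.

Lemma dist_comp (X Y Z : C) (f : hom X Y) (g : hom Y Z) (h : hom Z (S X)) :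
  dist f g h -> g \oc f =h hzero _ _.
Proof.
move=> d; have [[Z0 hZ0] _] := tri_additive T.
have [|c [h1 _]] := tri_fill (tri_id T X hZ0) d (a := hid X) (b := f).
  by rewrite !hcomp1r.
by rewrite - h1 hcomp0r.
Qed.

Lemma zero_shift (Z : C) : is_zero Z -> is_zero (S Z).
Proof.
move=> Z0; rewrite /is_zero -(fmap_id S Z) -(fmap_zero S Z Z).
by apply: fmap_heq.
Qed.

Lemma dist_zero (W Z : C) : is_zero Z -> dist (t := T) (hzero Z W) (hid W) (hzero W (S Z)).
Proof.
move=> Z0; apply/tri_rot.
apply: tri_closed_iso (tri_id T W (zero_shift Z0)).
exists (hid _), (hid _), (hid _); split.
  by split; (eexists; split; [exact: hcomp1l | exact: hcomp1r]).
split; first by rewrite !hcomp1l.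
  by rewrite hcomp1l hcomp1r.
by rewrite fmap_id fmap_zero hcomp1l hcomp1r hopp0.
Qed.

Lemma weak_cokernel (X Y Z W : C) (f : hom X Y) (g : hom Y Z) (h : hom Z (S X)) (u : hom Y W) :
  dist f g h -> u \oc f =h hzero _ _ -> exists u', u =h u' \oc g.
Proof.
move=> d uf; have [[Z0 hZ0] _] := tri_additive T.
have [|c [h1 _]] := tri_fill d (dist_zero W hZ0) (a := hzero _ _) (b := u).
  by rewrite uf hcomp0r.
by exists c; rewrite h1 hcomp1l.
Qed.

(** The connecting map h satisfies S(i) h = 0 and S(i) is split mono, so h = 0. Hence q can be
    cancelled on the right, and 1 - ip factors through q, which provides the section j. *)
Lemma split_mono_cone (X D : C) (i : hom X D) (p : hom D X) : p \oc i =h hid X ->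
  exists Z (j : hom Z D) (q : hom D Z) (h : hom Z (S X)),
    dist i q h /\ [/\ q \oc j =h hid Z, p \oc j =h hzero _ _, q \oc i =h hzero _ _
       & (i \oc p) +h (j \oc q) =h hid D].
Proof.
move=> pi; have [Z [q [h d]]] := tri_cone T i.
have d1 := (tri_rot _ _ _).1 d; have d2 := (tri_rot _ _ _).1 d1.
have qi := dist_comp d; have hq := dist_comp d1.
have h0 : h =h hzero _ _.
  have := dist_comp d2; rewrite hcompNl => e.
  have {}e : fmap S i \oc h =h hzero _ _ by rewrite -(hoppK (_ \oc _)) e hopp0.
  by rewrite -(hcomp1l h) -(fmap_id S X) -pi fmap_comp -hcompA e hcomp0r.
have epi W (u : hom Z W) : u \oc q =h hzero _ _ -> u =h hzero _ _.
  by move=> uq; have [u' ->] := weak_cokernel d1 uq; rewrite h0 hcomp0r.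
have [|j ej] := weak_cokernel (u := hid D -h (i \oc p)) d.
  by rewrite hcompDl hcomp1l hcompNl -hcompA pi hcomp1r haddNr.
have sum : (i \oc p) +h (j \oc q) =h hid D.
  by rewrite -ej haddC -haddA haddN hadd0r.
have cancel_ (W : C) (u v : hom Z W) : u \oc q =h v \oc q -> u =h v.
  move=> e; have : u -h v =h hzero _ _.
    by apply: epi; rewrite hcompDl hcompNl e haddNr.
  by move=> e'; rewrite -(hadd0r u) -(haddN v) haddA e' hadd0.
exists Z, j, q, h; split=> //; split=> //.
- apply: cancel_; rewrite hcomp1l -hcompA -ej hcompDr hcomp1r hcompNr hcompA qi.
  by rewrite hcomp0l hopp0 hadd0r.
- apply: cancel_; rewrite hcomp0l -hcompA -ej hcompDr hcomp1r hcompNr hcompA pi.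
  by rewrite hcomp1l haddNr.
Qed.

Lemma retract_summand (X D : C) (i : hom X D) (p : hom D X) : p \oc i =h hid X ->
  direct_summand X D.
Proof.
move=> pi; have [Z [j [q [_ [_ [h1 h2 h3 h4]]]]]] := split_mono_cone pi.
by exists Z, i, j, p, q.
Qed.

Variable A : C -> Prop.
Hypothesis thA : thick T A.

Lemma thick_retract (X D : C) (i : hom X D) (p : hom D X) : p \oc i =h hid X -> A D -> A X.
Proof. by move=> /retract_summand h; case: thA => _ _ s; apply: s h. Qed.

(** The cone of the inclusion of X is a retract of Y, hence lies in A, and two terms of the triangle
    give the third. *)
Lemma thick_biproduct (X Y D : C) : is_biproduct X Y D -> A X -> A Y -> A D.
Proof.
move=> [i [j [p [q [h1 h2 h3 h4 h5]]]]] AX AY.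
have [Z [j' [q' [h [d [e1 e2 e3 e4]]]]]] := split_mono_cone h1.
have AZ : A Z.
  apply: (@thick_retract Z Y (q \oc j') (q' \oc j)) => //.
  have e : (q' \oc j) \oc q =h q'.
    have := hcomp_heq (heq_refl q') h5; rewrite hcompDr hcompA e3 hcomp0l hadd0 hcomp1r.
    by rewrite hcompA.
  by rewrite hcompA e.
have [_ tri _] := thA; have [_ + _] := tri _ _ _ _ _ _ d; exact.
Qed.
End Triangles.

(** * Equivalences of categories *)

Section Equivalences.
Variables C D : pcat.

Lemma nat_iso_sym (F F' : functor C D) : nat_iso F F' -> nat_iso F' F.
Proof.
move=> [e [t [h1 h2 h3]]]; exists t, e; split=> // X Y f.
by rewrite -(hcomp1r (t Y \oc _)) -(h2 X) hcompA -(hcompA (t Y)) - h3 !hcompA h1 hcomp1l.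
Qed.

Lemma nat_iso_trans (F F' F'' : functor C D) : nat_iso F F' -> nat_iso F' F'' -> nat_iso F F''.
Proof.
move=> [e [t [h1 h2 h3]]] [e' [t' [h1' h2' h3']]].
exists (fun X => e' X \oc e X), (fun X => t X \oc t' X); split.
- by move=> X; rewrite hcompA -(hcompA (t X)) h1' hcomp1r h1.
- by move=> X; rewrite hcompA -(hcompA (e' X)) h2 hcomp1r h2'.
- by move=> X Y f; rewrite -hcompA h3 !hcompA h3'.
Qed.

Definition fully_faithful (F : functor C D) : Prop :=
  (forall X Y (f g : hom X Y), fmap F f =h fmap F g -> f =h g) /\
  (forall X Y (g : hom (F X) (F Y)), exists f, fmap F f =h g).

Lemma ff_equivalence (F : functor C D) : fully_faithful F ->
  (forall Y, exists X, exists u : hom (F X) Y, is_iso u) -> is_equivalence F.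
Proof.
move=> [faith full] es.
have {es} [g hg] := choice es; have {hg} [u hu] := dchoice hg.
have [v hv] := dchoice hu.
have vu Y := (hv Y).1; have uv Y := (hv Y).2.
have [m hm] : exists m : forall X Y, hom X Y -> hom (g X) (g Y),
    forall X Y f, fmap F (m X Y f) =h (v Y \oc f) \oc u X.
  apply: (dchoice (R := fun X (m : forall Y, hom X Y -> hom (g X) (g Y)) =>
    forall Y f, fmap F (m Y f) =h (v Y \oc f) \oc u X)) => X.
  apply: (dchoice (R := fun Y (m : hom X Y -> hom (g X) (g Y)) =>
    forall f, fmap F (m f) =h (v Y \oc f) \oc u X)) => Y.
  exact: (dchoice (fun f => full _ _ ((v Y \oc f) \oc u X))).
have mh X Y (f f' : hom X Y) : f =h f' -> m X Y f =h m X Y f'.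
  by move=> e; apply: faith; rewrite !hm e.
have mid X : m X X (hid X) =h hid (g X).
  by apply: faith; rewrite hm hcomp1r vu fmap_id.
have mc X Y Z (f : hom Y Z) (f' : hom X Y) : m X Z (f \oc f') =h m Y Z f \oc m X Y f'.
  apply: faith; rewrite fmap_comp !hm !hcompA -(hcompA _ (u Y) (v Y)) uv.
  by rewrite hcomp1r.
have ma X Y (f f' : hom X Y) : m X Y (f +h f') =h m X Y f +h m X Y f'.
  by apply: faith; rewrite fmap_add !hm hcompDr hcompDl.
pose G := @Functor D C g m mh mid mc ma.
exists G; split; last first.
  exists u, v; split=> // X Y f /=.
  by rewrite hm !hcompA uv hcomp1l.
have [e he] := dchoice (fun X => full _ _ (u (F X))).
have [t ht] := dchoice (fun X => full _ _ (v (F X))).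
exists e, t; split=> [X|X|X Y f]; apply: faith; rewrite !fmap_comp he ?ht.
- by rewrite vu fmap_id.
- by rewrite uv fmap_id.
- by rewrite /= hm he !hcompA uv hcomp1l.
Qed.
End Equivalences.

Lemma nat_iso_whisker_l (C D E : pcat) (G : functor D E) (F F' : functor C D) :
  nat_iso F F' -> nat_iso (fcomp G F) (fcomp G F').
Proof.
move=> [e [t [h1 h2 h3]]]; exists (fun X => fmap G (e X)), (fun X => fmap G (t X)).
by split=> [X|X|X Y f] /=; rewrite -!fmap_comp ?h1 ?h2 ?h3 ?fmap_id.
Qed.

Lemma nat_iso_whisker_r (C D E : pcat) (G G' : functor D E) (F : functor C D) :
  nat_iso G G' -> nat_iso (fcomp G F) (fcomp G' F).
Proof.
by move=> [e [t [h1 h2 h3]]]; exists (fun X => e (F X)), (fun X => t (F X)); split=> [X|X|X Y f] /=.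
Qed.

(** L Rs I is isomorphic to L J, hence to the identity, and a one-sided inverse of an equivalence is
    isomorphic to its quasi-inverse. *)
Lemma inverse_from_triangle (C D E : pcat) (I : functor C D) (Rs : functor D E)
    (J : functor C E) (L : functor E C) :
  is_equivalence I -> inverse_equivalences J L -> nat_iso (fcomp Rs I) J ->
  inverse_equivalences I (fcomp L Rs).
Proof.
move=> [I' [i1 i2]] [j1 j2] n.
have ri : nat_iso (fcomp (fcomp L Rs) I) (fid C).
  exact: nat_iso_trans (nat_iso_whisker_l L n) j1.
split=> //.
have h : nat_iso (fcomp L Rs) I'.
  apply: (@nat_iso_trans _ _ _ (fcomp (fcomp L Rs) (fcomp I I'))).
    exact: nat_iso_sym (nat_iso_whisker_l (fcomp L Rs) i2).
  exact: (nat_iso_whisker_r I' ri).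
exact: nat_iso_trans (nat_iso_whisker_l I h) i2.
Qed.

(** * Admissible complexes under induction and restriction *)

Section Admissible.
Variables (k : comPzRingType) (gT : finGroupType) (c : choices).

Lemma cind_zero (K G : {group gT}) (sKG : K \subset G) (Z : cpx k K) i :
  (forall x : Z i, x = 0) -> forall t : cind G Z i, t = 0.
Proof.
move=> Z0 t; rewrite -(ind_trK sKG t) /tr big1 // => C _.
by rewrite /conjf (Z0 (ind_proj _)) (gmap0 (ind_unit_gmap sKG _)) linear0.
Qed.

Lemma admissible_cind (K G : {group gT}) (sKG : K \subset G) (Z : cpx k K) :
  admissible c Z -> admissible c (cind G Z).
Proof.
move=> [fl bd]; split=> [ft i|]; first exact/finite_length_gind/fl.
case: (boundedness c) bd => //.
- by move=> [n h]; exists n => i ni; apply: (cind_zero sKG); apply: h.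
- by move=> [n h]; exists n => i ni; apply: (cind_zero sKG); apply: h.
- by move=> [[n h] [n' h']]; split; [exists n | exists n'] => i ni;
    apply: (cind_zero sKG); [apply: h | apply: h'].
Qed.

Lemma admissible_cres (K G : {group gT}) (sKG : K \subset G) (X : cpx k G) :
  admissible c X -> admissible c (cres sKG X).
Proof. by move=> [fl bd]; split=> // ft i; apply/finite_length_gres/fl. Qed.
End Admissible.

(* CC is a quotient of a full subcategory of complexes, so its objects and morphisms are
   complexes and chain maps; these identities make the change of view explicit, which keeps
   conversion from unfolding the categories. *)
Section ObjectsAndMorphisms.
Variables (k : comPzRingType) (gT : finGroupType) (c : choices).
Variables (L : {group gT}) (V : gmod k L).
Notation CCL := (CC c V).

Definition cob (X : CCL) : cpx k L := sval X.
Definition mkob (X : cpx k L) (aX : admissible c X) : CCL := exist _ X aX.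
Definition toc (X Y : CCL) (f : hom X Y) : chmap (cob X) (cob Y) := f.
Definition ofc (X Y : CCL) (f : chmap (cob X) (cob Y)) : hom X Y := f.

Lemma cob_admissible X : admissible c (cob X). Proof. exact: svalP X. Qed.
Lemma ofcE X Y (f : chmap (cob X) (cob Y)) : toc (ofc f) = f. Proof. by []. Qed.
Lemma toc_id X i x : toc (hid X) i x = x. Proof. by []. Qed.
Lemma toc_comp X Y Z (f : hom Y Z) (g : hom X Y) i x :
  toc (f \oc g) i x = toc f i (toc g i x).
Proof. by []. Qed.
Lemma toc_add X Y (f g : hom X Y) i x : toc (f +h g) i x = toc f i x + toc g i x.
Proof. by []. Qed.
Lemma toc_opp X Y (f : hom X Y) i x : toc (hopp f) i x = - toc f i x.
Proof. by []. Qed.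
Lemma CC_ext X Y (f g : hom X Y) : (forall i x, toc f i x = toc g i x) -> f =h g.
Proof. by move=> e; apply: quot_eq_heq. Qed.
End ObjectsAndMorphisms.

(** * Trace ideals and Higman's criterion *)

Section TraceIdeal.
Variables (k : comPzRingType) (gT : finGroupType) (c : choices).
Variables (L : {group gT}) (V : gmod k L).
Notation CCL := (CC c V).

(* By [J_heq] the ideal also contains every morphism through a null object.  Higman's
   criterion: X is U-projective iff [J U (hid X)]. *)
Inductive J (U : {set {group gT}}) (X Y : CCL) : hom X Y -> Prop :=
| J_tr (P : {group gT}) th (f : hom X Y) : P \in U ->
    @cmap k gT P L L (cob X) (cob Y) th ->
    (forall i x, toc f i x = ctr P L th i x) -> J U f
| J_zero : J U (hzero X Y)
| J_add (f g : hom X Y) : J U f -> J U g -> J U (f +h g)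
| J_heq (f g : hom X Y) : f =h g -> J U f -> J U g.

Implicit Types (U : {set {group gT}}) (X Y : CCL).

Lemma J_compl U X Y Z (f : hom X Y) (g : hom Y Z) : (forall P, P \in U -> P \subset L) ->
  J U f -> J U (g \oc f).
Proof.
move=> sU; elim=> {f} [P th f PU ct e||f f' _ I1 _ I2|f f' e _ I1].
- apply: (J_tr PU (cmap_comp (cmap_sub (sU _ PU) (cmap_chmap (toc g))) ct)) => i x.
  by rewrite toc_comp e /ctr (tr_compl (sU _ PU) _ _ (gmap_ghom (toc g i))).
- by apply: J_heq (J_zero _ _ _); rewrite hcomp0r.
- by apply: J_heq (J_add I1 I2); rewrite hcompDr.
- by apply: J_heq I1; rewrite e.
Qed.

Lemma J_compr U X Y Z (f : hom Y Z) (g : hom X Y) : (forall P, P \in U -> P \subset L) ->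
  J U f -> J U (f \oc g).
Proof.
move=> sU; elim=> {f} [P th f PU ct e||f f' _ I1 _ I2|f f' e _ I1].
- apply: (J_tr PU (cmap_comp ct (cmap_sub (sU _ PU) (cmap_chmap (toc g))))) => i x.
  by rewrite toc_comp e /ctr (tr_compr (sU _ PU) _ _ (gmap_ghom (toc g i))).
- by apply: J_heq (J_zero _ _ _); rewrite hcomp0l.
- by apply: J_heq (J_add I1 I2); rewrite hcompDl.
- by apply: J_heq I1; rewrite e.
Qed.

Lemma J_opp U X Y (f : hom X Y) : (forall P, P \in U -> P \subset L) ->
  J U f -> J U (hopp f).
Proof.
move=> sU Jf; apply: (J_heq _ (J_compl (hopp (hid Y)) sU Jf)).
by rewrite hcompNl hcomp1l.
Qed.

Lemma J_through U X Y Z (f : hom X Y) (g : hom Y Z) : (forall P, P \in U -> P \subset L) ->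
  J U (hid Y) -> J U (g \oc f).
Proof.
move=> sU JY; apply: (J_heq _ (J_compl g sU (J_compr f sU JY))).
by rewrite hcomp1l.
Qed.

Lemma J_mono U U' X Y (f : hom X Y) : (forall P, P \in U' -> P \subset L) ->
  (forall Q, Q \in U -> exists2 P : {group gT}, P \in U' & Q \subset P) -> J U f -> J U' f.
Proof.
move=> sU' UU'; elim=> {f} [Q th f QU ct e||f f' _ I1 _ I2|f f' e _ I1].
- have [P PU' sQP] := UU' _ QU; have sPL := sU' _ PU'.
  apply: (J_tr PU' (ctr_cmap sPL sPL sQP ct)) => i x.
  by rewrite e /ctr (tr_trans (subxx L) (subxx L) _ sQP) //; apply: ct.1.
- exact: J_zero.
- exact: J_add I1 I2.
- exact: J_heq I1.
Qed.

Section Factorization.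
Variables (P : {group gT}) (sPL : P \subset L).

(** Y restricted to P and induced back. Every trace from P into Y factors through this one object,
    whatever the source, and it is acyclic when Y is. *)
Definition IR (Y : CCL) : CCL :=
  mkob V (admissible_cind sPL (admissible_cres sPL (cob_admissible Y))).

Lemma counit_cmap (Y : CCL) : cmap L (ctr P L (@cind_proj k gT P L (cres sPL (cob Y)))
    : forall i, cob (IR Y) i -> cob Y i).
Proof.
apply: ctr_cmap => //; have [h1 h2] := cind_proj_cmap sPL (cres sPL (cob Y)).
by split=> // i; have [g1 g2] := h1 i.
Qed.
Definition ind_counit (Y : CCL) : hom (IR Y) Y :=
  @ofc k gT c L V (IR Y) Y (mkchmap (counit_cmap Y)).

Section Lift.
Variables (X Y : CCL) (th : forall i, cob X i -> cob Y i).
Hypothesis cth : @cmap k gT P L L (cob X) (cob Y) th.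

Lemma lift_cmap : cmap L (ctr P L (fun i (x : cob X i) =>
    @cind_unit k gT P L (cres sPL (cob Y)) i (th x) : cob (IR Y) i)
    : forall i, cob X i -> cob (IR Y) i).
Proof.
apply: ctr_cmap => //.
apply: (@cmap_comp k gT P L P L (cob X) (cres sPL (cob Y)) (cob (IR Y))).
  exact: cind_unit_cmap.
by case: cth => h1 h2; split=> // i; have [g1 g2] := h1 i.
Qed.
Definition ind_lift : hom X (IR Y) := @ofc k gT c L V X (IR Y) (mkchmap lift_cmap).

Lemma counit_lift i x : toc (ind_counit Y \oc ind_lift) i x = ctr P L th i x.
Proof.
rewrite toc_comp.
rewrite -[LHS]/(tr P L (@cind_proj k gT P L (cres sPL (cob Y)) i) (toc ind_lift i x)).
rewrite (tr_compr sPL _ _ (gmap_ghom (toc ind_lift i))).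
apply: tr_ext => {}x.
apply: (@proj_tr_unit k gT P L sPL (cres sPL (cob Y) i) L (cob X i) (th (i := i))) => //.
by have [h1 h2] := cth.1 i.
Qed.
End Lift.
End Factorization.

Lemma acyclic_IR (P : {group gT}) (sPL : P \subset L) (Y : CCL) :
  acyclic Y -> acyclic (IR sPL Y).
Proof.
move=> [ex ctr_]; split=> [|/ctr_ h]; first exact: exact_cind.
exact/contractible_cind/contractible_cres.
Qed.

Lemma induced_trace U (W : CCL) : induced_from U W -> (forall P, P \in U -> P \subset L) ->
  exists (P : {group gT}) th, [/\ P \in U, @cmap k gT P L L (cob W) (cob W) th
     & forall i x, x = ctr P L th i x].
Proof.
move=> [P [Z [PU aZ]]]; case: W => W aW /= e sU; subst W; have sPL := sU _ PU.
exists P, (fun i (x : cind L Z i) => cind_unit L (cind_proj x)); split=> //.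
  by apply: cmap_comp; [exact: cind_unit_cmap | exact: cind_proj_cmap].
by move=> i x; exact: (esym (ind_trK sPL x)).
Qed.

Lemma induced_IR U (P : {group gT}) (sPL : P \subset L) (Y : CCL) : P \in U ->
  induced_from U (IR sPL Y).
Proof.
move=> PU; exists P, (cres sPL (cob Y)); split=> //.
exact: admissible_cres (cob_admissible Y).
Qed.

Lemma J_induced U (W : CCL) : induced_from U W -> (forall P, P \in U -> P \subset L) ->
  J U (hid W).
Proof.
move=> iW sU; have [P [th [PU ct e]]] := induced_trace iW sU.
by apply: (J_tr PU ct) => i x; rewrite toc_id -e.
Qed.

Lemma J_factors U X Y (f : hom X Y) : (forall P, P \in U -> P \subset L) ->
  J U f -> factors (fun W => exists (P : {group gT}) (sPL : P \subset L),
                      P \in U /\ W = IR sPL Y) f.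
Proof.
move=> sU; elim=> {f} [P th f PU ct e||f g _ I1 _ I2|f g e _ I1].
- have sPL := sU _ PU; apply: (factors_heq (f := ind_counit sPL Y \oc ind_lift sPL ct)).
    by apply: CC_ext => i x; rewrite e; exact: counit_lift.
  by apply: factors_through; exists P, sPL.
- exact: factors_zero.
- exact: factors_add.
- exact: factors_heq I1.
Qed.
End TraceIdeal.

Section RelativeProjectivity.
Variables (k : comPzRingType) (gT : finGroupType) (c : choices).
Variables (L : {group gT}) (V : gmod k L).
Notation CCL := (CC c V).
Notation AP := (@AProj k gT c L V).
Implicit Types (U : {set {group gT}}) (X Y : CCL).

Lemma J_retract U X Y (f : hom X Y) (g : hom Y X) : (forall P, P \in U -> P \subset L) ->
  g \oc f =h hid X -> J U (hid Y) -> J U (hid X).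
Proof. by move=> sU e JY; apply: J_heq e (J_through _ _ sU JY). Qed.

(** The direct sum D may be infinite, but U is finite: the identity of W i is a trace from some P in
    U, so its injection into D factors through [IR] of D for that P, and [direct_sum_factors]
    collects the injections by subgroup. *)
Lemma rel_projective_J U X : (forall P, P \in U -> P \subset L) ->
  rel_projective U X -> J U (hid X).
Proof.
move=> sU [I [W [D [hW hD [X' [ix [_ [px [_ [pi _ _ _ _]]]]]]]]]].
apply: (J_retract sU pi) => {X X' ix px pi}.
have [inj hinj] := hD.
pose sA (a : {P : {group gT} | P \in U}) : val a \subset L := sU _ (valP a).
have fac i : exists a (m : hom (W i) (IR (sA a) D)), ind_counit (sA a) D \oc m =h inj i.
  have [P [th [PU ct hth]]] := induced_trace (hW i) sU.
  have sPL := sU _ PU; exists (exist _ P PU).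
  have ct' := cmap_comp (cmap_sub sPL (cmap_chmap (toc (inj i)))) ct.
  exists (ind_lift (sA (exist _ P PU)) ct'); apply: CC_ext => j x.
  rewrite counit_lift [in RHS](hth j x).
  by rewrite /ctr (tr_compl sPL _ _ (gmap_ghom (toc (inj i) j))).
have := direct_sum_factors hinj fac; elim=> [W0 a b [[P PU] e]||f g _ If _ Ig|f g e _ If].
- rewrite /= in e; move: a b; rewrite e => a b.
  by apply: J_through => //; apply: J_induced (induced_IR _ _ PU) sU.
- exact: J_zero.
- exact: J_add.
- exact: J_heq If.
Qed.

Variable T : triangulation CCL.

(** The identity factors through a finite direct sum of objects [IR], so X is a retract of it; the
    triangulation supplies that sum and completes the retract to a direct summand. *)
Lemma J_rel_projective U X : (forall P, P \in U -> P \subset L) ->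
  J U (hid X) -> rel_projective U X.
Proof.
move=> sU /(J_factors sU) h.
have [I [W [D [a [b [hW hD e]]]]]] := factors_direct_sum (tri_additive T) h.
exists I, W, D; split=> // [i|].
  by have [P [sPL [PU ->]]] := hW i; apply: induced_IR.
by apply: (retract_summand T (p := b) (i := a)); symmetry.
Qed.

Variable thA : thick T (@acyclic k gT c L V).

Lemma AProj_retract U X D (i : hom X D) (p : hom D X) :
  (forall P, P \in U -> P \subset L) -> p \oc i =h hid X -> AP U D -> AP U X.
Proof.
move=> sU pi [aD rD]; split; first exact: (thick_retract thA pi aD).
by apply: J_rel_projective => //; apply: (J_retract sU pi); apply: rel_projective_J.
Qed.

Lemma AProj_biproduct U X Y D : (forall P, P \in U -> P \subset L) ->
  is_biproduct X Y D -> AP U X -> AP U Y -> AP U D.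
Proof.
move=> sU b [aX rX] [aY rY]; split; first exact: (thick_biproduct thA b).
apply: J_rel_projective => //.
have [i [j [p [q [_ _ _ _ e]]]]] := b.
by apply: (J_heq e); apply: J_add; apply: J_through => //; apply: rel_projective_J.
Qed.

Lemma AProj_IR U (P : {group gT}) (sPL : P \subset L) Y :
  (forall P, P \in U -> P \subset L) -> P \in U -> acyclic Y -> AP U (IR sPL Y).
Proof.
move=> sU PU aY; split; first exact: acyclic_IR.
by apply: J_rel_projective => //; apply: J_induced => //; apply: induced_IR.
Qed.

Section StableCategory.
Variables U U' : {set {group gT}}.
Hypothesis sU : forall P, P \in U -> P \subset L.
Hypothesis UU' : forall Q, Q \in U' -> exists2 P : {group gT}, P \in U & Q \subset P.

Lemma sub_below Q : Q \in U' -> Q \subset L.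
Proof. by move=> /UU'[P /sU sPL sQP]; apply: subset_trans sPL. Qed.

Lemma AProj_mono X : AP U' X -> AP U X.
Proof.
move=> [aX rX]; split=> //; apply: J_rel_projective => //.
by apply: (J_mono sU UU'); apply: rel_projective_J => // Q; apply: sub_below.
Qed.

(** A trace into Y factors through [IR] of Y, which is acyclic and U'-projective, so the
    factorization never leaves the full subcategory. Only the target has to be in it. *)
Lemma stable_J (X Y : CCL) (f : hom X Y) : AP U Y ->
  factors_in (AP U) (AP U') f <-> J U' f.
Proof.
have sU' Q : Q \in U' -> Q \subset L by apply: sub_below.
move=> [aY rY]; split.
  elim=> {f} [W a b _ [aW rW]||f g _ If _ Ig|f g e _ If].
  - by apply: J_through => //; apply: rel_projective_J.
  - exact: J_zero.
  - exact: J_add.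
  - exact: J_heq If.
move=> Jf; apply: factors_sub (J_factors sU' Jf) => W [P [sPL [PU ->]]].
have h : AP U' (IR sPL Y) by apply: AProj_IR.
by split=> //; apply: AProj_mono.
Qed.

Definition aob (X : AStab c V U U') : CCL := qfo X.
Definition toa (X Y : AStab c V U U') (f : hom X Y) : hom (aob X) (aob Y) := qfh f.
Definition ofa (X Y : AStab c V U U') (f : hom (aob X) (aob Y)) : hom X Y := hqf f.
Definition mka (X : CCL) (aX : AP U X) : AStab c V U U' := exist _ X aX.

Lemma aob_AProj (X : AStab c V U U') : AP U (aob X). Proof. exact: qfo_prop X. Qed.

Lemma toa_id (X : AStab c V U U') : toa (hid X) = hid (aob X).
Proof. exact: qfh_id. Qed.
Lemma toa_comp (X Y Z : AStab c V U U') (f : hom Y Z) (g : hom X Y) :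
  toa (f \oc g) = toa f \oc toa g.
Proof. exact: qfh_comp. Qed.
Lemma ofaK (X Y : AStab c V U U') (f : hom (aob X) (aob Y)) : toa (ofa f) = f.
Proof. exact: hqfK. Qed.

Lemma AStab_heqP (X Y : AStab c V U U') (f g : hom X Y) :
  f =h g <-> J U' (toa f -h toa g).
Proof.
apply: (iff_trans (qfh_heq (f : @hom (AStab c V U U') X Y) g)).
exact: stable_J (aob_AProj Y).
Qed.
End StableCategory.
End RelativeProjectivity.

(** * Induction and restriction preserve null objects *)

Section NullObjects.
Variables (k : comPzRingType) (gT : finGroupType) (c : choices).

Section OneGroup.
Variables (L : {group gT}) (V : gmod k L).

Definition cseq (X Y Z : cpx k L) (f : chmap X Y) (g : chmap Y Z) : Prop :=
  short_exact f g /\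
  match homotopy c with
  | Plain => False
  | TermSplit => term_splits g
  | VSplit => splits (ctens_map V g)
  | VTermSplit => term_splits (ctens_map V g)
  | TermVSplit => term_splits g /\ splits (ctens_map V g)
  end.

Definition lifts (P X Y Z : cpx k L) (f : chmap X Y) (g : chmap Y Z) : Prop :=
  (forall v : chmap P Y, (forall i x, g i (v i x) = 0) ->
     exists u : chmap P X, forall i x, v i x = f i (u i x)) /\
  (forall w : chmap P Z, exists v : chmap P Y, forall i x, w i x = g i (v i x)).

(** Left exactness of Hom is partly automatic for short exact sequences; what remains is lifting
    maps into the kernel and lifting maps along g. *)
Lemma null_objectsP (P : BC k c L) : null_objects V P <->
  homotopy c <> Plain /\ forall (X Y Z : cpx k L) (f : chmap X Y) (g : chmap Y Z),
    admissible c X -> admissible c Y -> admissible c Z -> cseq f g -> lifts (sval P) f g.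
Proof.
split=> -[nP h]; split=> //.
  move=> X Y Z f g aX aY aZ s.
  have [_ h2 h3] := h (exist _ X aX) (exist _ Y aY) (exist _ Z aZ) f g s.
  split=> [v /h2[u e]|w]; first by exists u.
  by have [v e] := h3 w; exists v.
move=> [X aX] [Y aY] [Z aZ] /= f g s; have [h2 h3] := h X Y Z f g aX aY aZ s.
have [se _] := s; split.
- move=> u fu i x; have [fi _ _] := se i; apply: fi; rewrite linear0; exact: fu.
- move=> v; split=> [/h2[u e]|[u e] i x]; first by exists u.
  have [_ fg _] := se i; apply/fg; exists (u i x); symmetry; exact: e.
- by move=> w; have [v e] := h3 w; exists v.
Qed.
End OneGroup.

Section TwoGroups.
Variables (K L : {group gT}) (sKL : K \subset L) (V : gmod k L).
Let VK := gres sKL V.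

Lemma cseq_cres (X Y Z : cpx k L) (f : chmap X Y) (g : chmap Y Z) :
  cseq V f g -> cseq VK (cres_map sKL f) (cres_map sKL g).
Proof.
have ts : term_splits g -> term_splits (cres_map sKL g).
  by move=> h i; have [s hs] := h i; exists (gres_map sKL s).
have vts : term_splits (ctens_map V g) -> term_splits (ctens_map VK (cres_map sKL g)).
  move=> h i; have [s hs] := h i.
  have sK : @gmap k gT K K K (ctens VK (cres sKL Z) i) (ctens VK (cres sKL Y) i) s.
    exact: (gmap_sub sKL (gmap_ghom s)).
  by exists (mkhom sK).
have vs : splits (ctens_map V g) -> splits (ctens_map VK (cres_map sKL g)).
  move=> [s hs].
  have sK : @cmap k gT K K K (ctens VK (cres sKL Z)) (ctens VK (cres sKL Y)) (fun i x => s i x).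
    by split=> [i|i x]; [exact: (gmap_sub sKL (gmap_ghom (s i))) | exact: (cmd s x)].
  by exists (mkchmap sK).
move=> [se h]; split=> //; move: h; case: (homotopy c) => // -[h1 h2]; split; auto.
Qed.

Lemma tens_splits_cind (X Y : cpx k K) (g : chmap X Y) i
    (s : ghom (ctens VK Y i) (ctens VK X i)) :
  (forall z, ctens_map VK g i (s z) = z) ->
  forall t, gtens_map V (gind_map L (g i)) (tindf s t) = t.
Proof. by move=> hs t; rewrite tindf_compl tindf_id. Qed.

Lemma cseq_cind (X Y Z : cpx k K) (f : chmap X Y) (g : chmap Y Z) :
  cseq VK f g -> cseq V (cind_map L f) (cind_map L g).
Proof.
have ts : term_splits g -> term_splits (cind_map L g).
  move=> h i; have [s hs] := h i; exists (gind_map L s); apply: ind_ext.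
  - by move=> a x y; rewrite !linearP.
  - by [].
  move=> x m xL; rewrite !ghom_act //; congr (act _ _ _).
  by rewrite -[LHS]/(gind_map L (g i) (gind_map L s (ind_unit L m))) !gind_map_unit hs.
have vts : term_splits (ctens_map VK g) -> term_splits (ctens_map V (cind_map L g)).
  move=> h i; have [s hs] := h i.
  exists (mkhom (tindf_gmap (gmap_ghom s))); exact: tens_splits_cind.
have vs : splits (ctens_map VK g) -> splits (ctens_map V (cind_map L g)).
  move=> [s hs].
  have sL : @cmap k gT L L L (ctens V (cind L Z)) (ctens V (cind L Y))
      (fun i => @tindf k gT K L sKL V (Z i) (Y i) (s i)).
    split=> [i|i x]; first exact: tindf_gmap (gmap_ghom (s i)).
    change (tindf (s (i + 1)) (gtens_map V (gind_map L (cd Z i)) x) =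
      gtens_map V (gind_map L (cd Y i)) (tindf (s i) x)).
    rewrite tindf_compl tindf_compr; apply: tindf_ext => t; exact: (cmd s t).
  exists (mkchmap sL) => i z; exact: tens_splits_cind.
move=> [se h]; split; first exact: short_exact_cind.
move: h; case: (homotopy c) => // -[h1 h2]; split; auto.
Qed.

(** Induction is left adjoint to restriction: lifts of the adjoint maps are carried back by taking
    traces. *)
Lemma lifts_cind (P : cpx k K) (X Y Z : cpx k L) (f : chmap X Y) (g : chmap Y Z) :
  lifts P (cres_map sKL f) (cres_map sKL g) -> lifts (cind L P) f g.
Proof.
have adj (W : cpx k L) (v : chmap (cind L P) W) : exists v' : chmap P (cres sKL W),
    forall i x, v' i x = v i (ind_unit L x).
  have h : @cmap k gT K K K P (cres sKL W) (fun i x => v i (ind_unit L x)).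
    have := cmap_comp (cmap_sub sKL (cmap_chmap v)) (cind_unit_cmap sKL P).
    by move=> [h1 h2]; split=> // i; have [g1 g2] := h1 i.
  by exists (mkchmap h).
have adj' (W : cpx k L) (v : chmap P (cres sKL W)) : exists v' : chmap (cind L P) W,
    forall i t, v' i t = tr K L (fun t => v i (ind_proj t) : W i) t.
  have h : @cmap k gT K L L (cind L P) W (fun i t => v i (ind_proj t)).
    have := cmap_comp (cmap_chmap v) (cind_proj_cmap sKL P).
    by move=> [h1 h2]; split=> // i; have [g1 g2] := h1 i.
  by exists (mkchmap (ctr_cmap (subxx L) (subxx L) sKL h)).
have tr_adj (W : cpx k L) (v : chmap (cind L P) W) i t :
    v i t = tr K L (fun t => v i (ind_unit L (ind_proj t))) t.
  by rewrite -(tr_compl sKL _ _ (gmap_ghom (v i))) (ind_trK sKL).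
move=> [h1 h2]; split=> [v gv|w].
  have [v' ev] := adj _ v; have [|u eu] := h1 v'.
    by move=> i x; rewrite /= ev gv.
  have [u' eu'] := adj' _ u; exists u' => i x; rewrite eu' tr_adj.
  rewrite (tr_compl sKL _ _ (gmap_ghom (f i))).
  by apply: tr_ext => t; rewrite -ev eu.
have [w' ew] := adj _ w; have [v ev] := h2 w'.
have [v' ev'] := adj' _ v; exists v' => i x; rewrite ev' tr_adj.
rewrite (tr_compl sKL _ _ (gmap_ghom (g i))).
by apply: tr_ext => t; rewrite -ew ev.
Qed.

(** The other adjunction: maps out of Res P correspond to maps from P into an induced complex, by a
    trace in one direction and by [ind_proj] in the other. *)
Lemma lifts_cres (P : cpx k L) (X Y Z : cpx k K) (f : chmap X Y) (g : chmap Y Z) :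
  lifts P (cind_map L f) (cind_map L g) -> lifts (cres sKL P) f g.
Proof.
have adj (W : cpx k K) (v : chmap (cres sKL P) W) : exists v' : chmap P (cind L W),
    forall i x, v' i x = tr K L (fun x : P i => ind_unit L (v i x)) x.
  have h : @cmap k gT K L L P (cind L W) (fun i x => ind_unit L (v i x)).
    have := cmap_comp (cind_unit_cmap sKL W) (cmap_chmap v).
    by move=> [h1 h2]; split=> // i; have [g1 g2] := h1 i.
  by exists (mkchmap (ctr_cmap (subxx L) (subxx L) sKL h)).
have adj' (W : cpx k K) (v : chmap P (cind L W)) : exists v' : chmap (cres sKL P) W,
    forall i x, v' i x = ind_proj (v i x).
  have h : @cmap k gT K K K (cres sKL P) W (fun i x => ind_proj (v i x)).
    have := cmap_comp (cind_proj_cmap sKL W) (cmap_sub sKL (cmap_chmap v)).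
    by move=> [h1 h2]; split=> // i; have [g1 g2] := h1 i.
  by exists (mkchmap h).
have gres_gmap (W : cpx k K) (v : chmap (cres sKL P) W) i :
    @gmap k gT K L K (P i) (W i) (v i).
  by have [g1 g2] := gmap_ghom (v i).
have proj_tr (W : cpx k K) (v : chmap (cres sKL P) W) i x :
    ind_proj (tr K L (fun x : P i => ind_unit L (v i x)) x) = v i x.
  exact: (@proj_tr_unit k gT K L sKL (W i) L (P i) (v i) x (subxx L) (gres_gmap W v i)).
have nat (W W' : cpx k K) (u : chmap W W') (v : chmap (cres sKL P) W) i x :
    cind_map L u i (tr K L (fun x : P i => ind_unit L (v i x)) x) =
    tr K L (fun x : P i => ind_unit L (u i (v i x))) x.
  rewrite (tr_compl sKL _ _ (gmap_ghom (cind_map L u i))).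
  by apply: tr_ext => y; exact: gind_map_unit.
have projn (W W' : cpx k K) (u : chmap W W') i t :
    ind_proj (cind_map L u i t) = u i (ind_proj t) by exact: proj_gind_map.
move=> [h1 h2]; split=> [v gv|w].
  have [v' ev] := adj _ v; have [|u eu] := h1 v'.
    move=> i x; rewrite ev nat /tr big1 // => C _.
    by rewrite /conjf gv (gmap0 (ind_unit_gmap sKL _)) linear0.
  have [u' eu'] := adj' _ u; exists u' => i x.
  by rewrite eu' -projn -eu ev proj_tr.
have [w' ew] := adj _ w; have [v ev] := h2 w'.
have [v' ev'] := adj' _ v; exists v' => i x.
by rewrite ev' -projn -ev ew proj_tr.
Qed.
End TwoGroups.
End NullObjects.

(** * Induction and restriction on the homotopy categories *)

Section Functors.
Variables (k : comPzRingType) (gT : finGroupType) (c : choices).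
Variables (G H : {group gT}) (sHG : H \subset G) (V : gmod k G).
Let VH := gres sHG V.

Lemma Ind_adm : carries (Ind k H G) (fun X => admissible c X) (fun X => admissible c X).
Proof. by move=> X; apply: admissible_cind. Qed.
Lemma Res_adm : carries (Res k sHG) (fun X => admissible c X) (fun X => admissible c X).
Proof. by move=> X; apply: admissible_cres. Qed.

Definition IndB : functor (BC k c H) (BC k c G) := full_functor Ind_adm.
Definition ResB : functor (BC k c G) (BC k c H) := full_functor Res_adm.

Lemma Ind_null : carries IndB (null_objects (c := c) VH) (null_objects (c := c) V).
Proof.
move=> P /null_objectsP[nP h]; apply/null_objectsP; split=> // X Y Z f g aX aY aZ s.
by apply: lifts_cind; apply: h; [exact: admissible_cres..|exact: cseq_cres].
Qed.
Lemma Res_null : carries ResB (null_objects (c := c) V) (null_objects (c := c) VH).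
Proof.
move=> P /null_objectsP[nP h]; apply/null_objectsP; split=> // X Y Z f g aX aY aZ s.
by apply: (@lifts_cres k gT H G sHG); apply: h; [exact: admissible_cind..|exact: cseq_cind].
Qed.

Definition IndC : functor (CC c VH) (CC c V) := quot_functor Ind_null.
Definition ResC : functor (CC c V) (CC c VH) := quot_functor Res_null.
End Functors.

(** * Products of trace ideals *)

Section IdealProducts.
Variables (k : comPzRingType) (gT : finGroupType) (c : choices).
Variables (L : {group gT}) (V : gmod k L).
Notation CCL := (CC c V).
Implicit Types (U : {set {group gT}}) (X Y : CCL).

Lemma tr_sum (Q : {set gT}) (G1 G2 : {group gT}) (M : gmod k G1) (N : gmod k G2)
    (I : Type) (s : seq I) (P : pred I) (f : I -> M -> N) m :
  tr Q L (fun x => \sum_(D <- s | P D) f D x) m = \sum_(D <- s | P D) tr Q L (f D) m.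
Proof.
rewrite /tr exchange_big; apply: eq_bigr => C _.
by rewrite /conjf linear_sum.
Qed.

Lemma J_below U X Y (R P : {group gT}) th (f : hom X Y) : P \in U -> R \subset P ->
  P \subset L -> @cmap k gT R L L (cob X) (cob Y) th ->
  (forall i x, toc f i x = ctr R L th i x) -> J U f.
Proof.
move=> PU sRP sPL ct e; apply: (J_tr PU (ctr_cmap sPL sPL sRP ct)) => i x.
by rewrite e /ctr (tr_trans (subxx L) (subxx L) _ sRP) //; apply: ct.1.
Qed.

Lemma J_big U X Y (I : eqType) (s : seq I) (P : pred I) (phi : I -> forall i, cob X i -> cob Y i) :
  (forall D, D \in s -> P D ->
    exists F : hom X Y, J U F /\ forall i x, toc F i x = phi D i x) ->
  exists F : hom X Y, J U F /\ forall i x, toc F i x = \sum_(D <- s | P D) phi D i x.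
Proof.
elim: s => [|D s IH] h.
  exists (hzero _ _); split; first exact: J_zero.
  by move=> i x; rewrite big_nil.
have [E Es|F [JF eF]] := IH; first by apply: h; rewrite inE Es orbT.
have [PD|nPD] := boolP (P D); last first.
  by exists F; split=> // i x; rewrite big_cons (negPf nPD).
have [|//|F' [JF' eF']] := h D; first by rewrite inE eqxx.
exists (F' +h F); split; first exact: J_add.
by move=> i x; rewrite big_cons PD toc_add eF eF'.
Qed.

(** The product of tr_Q(al) and tr_P(th) is tr_P(tr_Q(al) th). Mackey's formula then splits tr_Q(al)
    over the double cosets PgQ into traces to P from the intersection of gQg^-1 with P. *)
Lemma J_mul U1 U2 U3 X Y Z (f : hom Y Z) (g : hom X Y) :
  (forall P, P \in U1 -> P \subset L) -> (forall P, P \in U2 -> P \subset L) ->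
  (forall P, P \in U3 -> P \subset L) ->
  (forall (Q P : {group gT}) h, Q \in U1 -> P \in U2 -> h \in L ->
     exists2 R : {group gT}, R \in U3 & (Q :^ h^-1)%g :&: P \subset R) ->
  J U1 f -> J U2 g -> J U3 (f \oc g).
Proof.
move=> s1 s2 s3 h; elim=> {f} [Q al f QU cal ef||f f' _ I1 _ I2|f f' e _ I1] Jg; last 3 first.
- by apply: J_heq (J_zero _ _ _); rewrite hcomp0l.
- by apply: J_heq (J_add (I1 Jg) (I2 Jg)); rewrite hcompDl.
- by apply: J_heq (I1 Jg); rewrite e.
elim: Jg => {g} [P th g PU cth eg||g g' _ I1 _ I2|g g' e _ I1]; last 3 first.
- by apply: J_heq (J_zero _ _ _); rewrite hcomp0r.
- by apply: J_heq (J_add I1 I2); rewrite hcompDr.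
- by apply: J_heq I1; rewrite e.
have sQL := s1 _ QU; have sPL := s2 _ PU.
pose R (D : {set gT}) : {group gT} := ((Q :^ (repr D)^-1) :&: P)%G.
have sRP D : R D \subset P by exact: subsetIr.
pose ph (D : {set gT}) i (x : cob X i) : cob Z i := conjf (repr D) (al i) (th i x).
have cph D : D \in dcosets P Q L -> cmap (R D) (ph D).
  move=> DD; have [DL _] := dcosets_repr sPL sQL DD.
  have c1 := cconj_cmap (subxx L) (subxx L) sQL DL cal.
  exact: cmap_comp (cmap_sub (subsetIl _ _) c1) (cmap_sub (sRP D) cth).
have [|F [JF eF]] := @J_big U3 X Z _ (enum (dcosets P Q L)) xpredT
    (fun D => ctr (R D) L (ph D)).
  move=> D; rewrite mem_enum => DD _; have [DL _] := dcosets_repr sPL sQL DD.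
  have [P3 PU3 sR] := h _ _ _ QU PU DL.
  have sRL : R D \subset L := subset_trans (sRP D) sPL.
  exists (@ofc k gT c L V X Z (mkchmap (ctr_cmap (subxx L) (subxx L) sRL (cph D DD)))).
  by split=> //; apply: (J_below PU3 sR (s3 _ PU3) (cph D DD)).
apply: J_heq JF; apply: CC_ext => i x.
rewrite eF big_enum toc_comp ef eg.
have hal := tr_gmap (subxx L) (subxx L) sQL (cal.1 i).
rewrite [in RHS]/ctr (tr_compl sPL _ _ hal).
transitivity (tr P L (fun x : cob X i => \sum_(D in dcosets P Q L) tr (R D) P (ph D i) x) x).
  rewrite tr_sum; apply: eq_bigr => D DD.
  by rewrite (tr_trans (subxx L) (subxx L) _ (sRP D) sPL) //; exact: (cph D DD).1.
apply: tr_ext => {}x.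
rewrite (tr_mackey (subxx L) (subxx L) _ sPL sQL (cal.1 i)).
apply: eq_bigr => D DD.
by rewrite (tr_compr (sRP D) _ _ (cth.1 i)).
Qed.
End IdealProducts.

(** * Trace ideals under induction and restriction *)

Section Transfer.
Variables (k : comPzRingType) (gT : finGroupType) (c : choices).
Variables (G H : {group gT}) (sHG : H \subset G) (V : gmod k G).
Let VH := gres sHG V.
Notation CG := (CC c V).
Implicit Types (U W : {set {group gT}}).
Notation CH := (CC c VH).
Notation IndC := (IndC c sHG V).
Notation ResC := (ResC c sHG V).

Lemma toc_Ind (A B : CH) (f : hom A B) i t :
  toc (fmap IndC f) i t = cind_map G (toc f) i t.
Proof. by []. Qed.
Lemma toc_Res (X Y : CG) (f : hom X Y) i x : toc (fmap ResC f) i x = toc f i x.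
Proof. by []. Qed.

Lemma Ind_tr (A B : CH) (f : hom A B) i (t : cob (IndC A) i) :
  toc (fmap IndC f) i t =
  tr H G (fun t : cob (IndC A) i => ind_unit G (toc f i (ind_proj t)) : cob (IndC B) i) t.
Proof.
rewrite toc_Ind -[LHS](ind_trK sHG).
rewrite (tr_compr sHG _ _ (gmap_ghom (cind_map G (toc f) i))).
by apply: tr_ext => s; congr (ind_unit _ _); exact: proj_gind_map.
Qed.

Lemma unit_cmap (A : CH) : @cmap k gT H H H (cob A) (cob (ResC (IndC A)))
  (fun i x => ind_unit G x).
Proof.
by have [h1 h2] := cind_unit_cmap sHG (cob A); split.
Qed.
Definition unitC (A : CH) : hom A (ResC (IndC A)) :=
  @ofc k gT c H VH A (ResC (IndC A)) (mkchmap (unit_cmap A)).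

Lemma proj_cmap (A : CH) : @cmap k gT H H H (cob (ResC (IndC A))) (cob A)
  (fun i x => ind_proj (x : gind G (cob A i))).
Proof.
by have [h1 h2] := cind_proj_cmap sHG (cob A); split.
Qed.
Definition projC (A : CH) : hom (ResC (IndC A)) A :=
  @ofc k gT c H VH (ResC (IndC A)) A (mkchmap (proj_cmap A)).

Lemma toc_unitC A i x : toc (unitC A) i x = ind_unit G x. Proof. by []. Qed.
Lemma toc_projC A i x : toc (projC A) i x = ind_proj (x : gind G (cob A i)).
Proof. by []. Qed.

Lemma projC_unitC A : projC A \oc unitC A =h hid A.
Proof.
by apply: CC_ext => i x; rewrite toc_comp toc_projC toc_unitC toc_id; exact: proj_unit.
Qed.

Lemma unitC_nat (A B : CH) (f : hom A B) :
  fmap ResC (fmap IndC f) \oc unitC A =h unitC B \oc f.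
Proof.
apply: CC_ext => i x; rewrite !toc_comp toc_Res toc_Ind !toc_unitC.
exact: gind_map_unit.
Qed.

Lemma projC_nat (A B : CH) (f : hom A B) :
  projC B \oc fmap ResC (fmap IndC f) =h f \oc projC A.
Proof.
apply: CC_ext => i x; rewrite !toc_comp toc_Res toc_Ind !toc_projC.
exact: proj_gind_map.
Qed.

Lemma tcounit_cmap (X : CG) : @cmap k gT G G G (cob (IndC (ResC X))) (cob X)
  (ctr H G (fun i (t : cob (IndC (ResC X)) i) =>
     ind_proj (t : gind G (cob (ResC X) i)) : cob X i)).
Proof.
apply: ctr_cmap => //; have [h1 h2] := cind_proj_cmap sHG (cob (ResC X)).
by split=> // i; have [g1 g2] := h1 i.
Qed.
Definition counitC (X : CG) : hom (IndC (ResC X)) X :=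
  @ofc k gT c G V (IndC (ResC X)) X (mkchmap (tcounit_cmap X)).

(** The factorization of f through its adjoint. It lets membership in an ideal over G be tested over
    H. *)
Lemma adjoint_factor (A : CH) (X : CG) (f : hom (IndC A) X) :
  f =h counitC X \oc fmap IndC (fmap ResC f \oc unitC A).
Proof.
apply: CC_ext => i t; rewrite toc_comp.
rewrite -[RHS]/(tr H G (fun t => ind_proj (t : gind G (cob (ResC X) i)) : cob X i) _).
rewrite (tr_compr sHG _ _ (gmap_ghom (toc (fmap IndC (fmap ResC f \oc unitC A)) i))).
rewrite -[in LHS](ind_trK sHG (t : gind G (cob A i))).
rewrite (tr_compl sHG _ _ (gmap_ghom (toc f i))).
by apply: tr_ext => s; symmetry; exact: (proj_gind_map (toc (fmap ResC f \oc unitC A) i) s).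
Qed.

Lemma cmap_unit_proj (P : {group gT}) (A B : CH) th : P \subset H ->
  @cmap k gT P H H (cob A) (cob B) th ->
  @cmap k gT P G G (cob (IndC A)) (cob (IndC B))
    (fun i (t : cob (IndC A) i) =>
       ind_unit G (th i (ind_proj (t : gind G (cob A i)))) : cob (IndC B) i).
Proof.
move=> sPH ct.
have := cmap_comp (cmap_sub sPH (cind_unit_cmap sHG (cob B)))
  (cmap_comp ct (cmap_sub sPH (cind_proj_cmap sHG (cob A)))).
by [].
Qed.

(** Ind f is the trace from H to G of unit f proj, so transitivity of traces shows that it is a
    trace from the same subgroup P as f. *)
Lemma Ind_trace (P : {group gT}) (A B : CH) th (f : hom A B) : P \subset H ->
  @cmap k gT P H H (cob A) (cob B) th -> (forall i x, toc f i x = ctr P H th i x) ->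
  forall i t, toc (fmap IndC f) i t =
    ctr P G (fun i (t : cob (IndC A) i) =>
      ind_unit G (th i (ind_proj (t : gind G (cob A i)))) : cob (IndC B) i) i t.
Proof.
move=> sPH ct e i t; rewrite Ind_tr /ctr.
rewrite -(tr_trans (subxx G) (subxx G) _ sPH sHG ((cmap_unit_proj sPH ct).1 i)).
apply: tr_ext => s; rewrite e /ctr (tr_compr sPH _ _ (ind_proj_gmap sHG (cob A i))).
by rewrite (tr_compl sPH _ _ (ind_unit_gmap sHG (cob B i))).
Qed.

Lemma J_Ind U (A B : CH) (f : hom A B) : (forall P, P \in U -> P \subset H) ->
  J U f -> J U (fmap IndC f).
Proof.
move=> sU; elim=> {f} [P th f PU ct e||f g _ I1 _ I2|f g e _ I1].
- exact: J_tr PU (cmap_unit_proj (sU _ PU) ct) (Ind_trace (sU _ PU) ct e).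
- by apply: J_heq (J_zero _ _ _); rewrite fmap_zero.
- by apply: J_heq (J_add I1 I2); rewrite fmap_add.
- by apply: J_heq I1; apply: fmap_heq.
Qed.

(** The predicate S selects double cosets in Mackey's formula: all of them for [J_Res], all but the
    trivial one for [unit_proj_J]. *)
Lemma Res_trace U (Q : {group gT}) (X Y : CG) th (S : pred {set gT}) :
  Q \subset G -> (forall P, P \in U -> P \subset H) ->
  (forall D, D \in dcosets H Q G -> S D ->
     exists2 P : {group gT}, P \in U & (Q :^ (repr D)^-1)%g :&: H \subset P) ->
  @cmap k gT Q G G (cob X) (cob Y) th ->
  exists F : hom (ResC X) (ResC Y), J U F /\ forall i x, toc F i x =
    \sum_(D in dcosets H Q G | S D) tr ((Q :^ (repr D)^-1)%g :&: H) H (conjf (repr D) (th i)) x.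
Proof.
move=> sQG sU h ct.
have [|F [JF eF]] := @J_big k gT c H VH U (ResC X) (ResC Y) _ (enum (dcosets H Q G)) S
    (fun D => ctr ((Q :^ (repr D)^-1)%g :&: H) H (fun i => conjf (repr D) (th i))).
  move=> D; rewrite mem_enum => DD SD; have [DG _] := dcosets_repr sHG sQG DD.
  have [P PU sP] := h _ DD SD.
  pose R : {group gT} := ((Q :^ (repr D)^-1) :&: H)%G.
  have sRH : R \subset H by exact: subsetIr.
  have c1 : @cmap k gT R H H (cob (ResC X)) (cob (ResC Y)) (fun i => conjf (repr D) (th i)).
    have [h1 h2] := cmap_sub (subsetIl _ H) (cconj_cmap (subxx G) (subxx G) sQG DG ct).
    by split=> // i; have [g1 g2] := h1 i.
  exists (@ofc k gT c H VH (ResC X) (ResC Y)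
    (mkchmap (ctr_cmap (subxx H) (subxx H) sRH c1))).
  by split=> //; apply: (J_below PU sP (sU _ PU) c1).
by exists F; split=> // i x; rewrite eF big_enum_cond.
Qed.

Lemma J_Res U W (X Y : CG) (f : hom X Y) : (forall P, P \in U -> P \subset G) ->
  (forall P, P \in W -> P \subset H) ->
  (forall (Q : {group gT}) D, Q \in U -> D \in dcosets H Q G ->
     exists2 P : {group gT}, P \in W & (Q :^ (repr D)^-1)%g :&: H \subset P) ->
  J U f -> J W (fmap ResC f).
Proof.
move=> sU sW h; elim=> {f} [Q th f QU ct e||f g _ I1 _ I2|f g e _ I1].
- have [D DD _|F [JF eF]] := Res_trace (S := xpredT) (sU _ QU) sW _ ct; first exact: h.
  apply: J_heq JF; apply: CC_ext => i x; rewrite eF toc_Res e.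
  rewrite /ctr (tr_mackey (subxx G) (subxx G) _ sHG (sU _ QU) (ct.1 i)).
  by apply: eq_bigl => D; rewrite andbT.
- by apply: J_heq (J_zero _ _ _); rewrite fmap_zero.
- by apply: J_heq (J_add I1 I2); rewrite fmap_add.
- by apply: J_heq I1; apply: fmap_heq.
Qed.

(* Only the trivial double coset contributes to the summand A of Ind A. *)
Lemma unit_proj_J U W (A B : CH) (f : hom A B) : (forall P, P \in U -> P \subset H) ->
  (forall P, P \in W -> P \subset H) ->
  (forall (Q : {group gT}) D, Q \in U -> D \in dcosets H Q G -> D != H ->
     exists2 P : {group gT}, P \in W & (Q :^ (repr D)^-1)%g :&: H \subset P) ->
  J U f -> J W (fmap ResC (fmap IndC f) -h (unitC B \oc (f \oc projC A))).
Proof.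
move=> sU sW h; elim=> {f} [Q th f QU ct e||f g _ I1 _ I2|f g e _ I1]; last 3 first.
- apply: J_heq (J_zero _ _ _); rewrite hcomp0l hcomp0r hopp0 hadd0r.
  by rewrite !fmap_zero.
- apply: J_heq (J_add I1 I2); rewrite !fmap_add hcompDl hcompDr hoppD haddACA.
  reflexivity.
- by apply: J_heq I1; rewrite e.
have sQH := sU _ QU; have sQG := subset_trans sQH sHG.
have cG := cmap_unit_proj sQH ct.
have [D DD DH|F [JF eF]] := Res_trace (S := fun D => D != H) sQG sW _ cG; first exact: h.
apply: J_heq JF; apply: CC_ext => i x.
rewrite eF toc_add toc_opp toc_Res (Ind_trace sQH ct e).
rewrite [in RHS]/ctr (tr_mackey (subxx G) (subxx G) _ sHG sQG (cG.1 i)).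
have HD : (H : {set gT}) \in dcosets H Q G.
  apply/imsetP; exists (Q : {set gT}); last by rewrite mulGSid.
  by apply/lcosetsP; exists 1%g; rewrite ?lcoset_id.
rewrite [in RHS](bigD1 _ HD) /=.
(* The chosen representative of the trivial double coset is 1, so its Mackey term is the component
   unit f proj without any conjugation. *)
have r1 : repr (H : {set gT}) = 1%g by exact: repr_group.
have -> : tr ((Q :^ (repr (H : {set gT}))^-1)%g :&: H) H
   (conjf (repr (H : {set gT})) (fun t : gind G (cob A i) => ind_unit G (th i (ind_proj t)))) x =
   toc (unitC B \oc (f \oc projC A)) i x.
  rewrite r1 invg1 conjsg1 (setIidPl sQH) !toc_comp toc_unitC toc_projC e /ctr.
  rewrite (tr_compr sQH _ _ (ind_proj_gmap sHG (cob A i))).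
  rewrite (tr_compl sQH _ _ (ind_unit_gmap sHG (cob B i))).
  by apply: tr_ext => s; rewrite /conjf invg1 !act1.
by rewrite addrAC subrr add0r.
Qed.
End Transfer.

(** * Splitting idempotents by a telescope *)

Definition idempotents_split (C : pcat) : Prop :=
  forall (A : C) (e : hom A A), e \oc e =h e ->
  exists B (r : hom A B) (s : hom B A), r \oc s =h hid B /\ s \oc r =h e.

(** A retract Y of F X is the image of an idempotent of F X. Full faithfulness lifts it to an
    idempotent of X, and F maps the image of the latter to Y. *)
Lemma ff_retract_equivalence (C D : pcat) (F : functor C D) : fully_faithful F ->
  idempotents_split C ->
  (forall Y, exists X (a : hom Y (F X)) (b : hom (F X) Y), b \oc a =h hid Y) ->
  is_equivalence F.
Proof.
move=> [faith full] idem retr; apply: ff_equivalence => // Y.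
have [X [a [b ba]]] := retr Y.
have [e Fe] := full _ _ (a \oc b).
have ee : e \oc e =h e.
  apply: faith; rewrite fmap_comp Fe hcompA -(hcompA a) ba hcomp1r.
  reflexivity.
have [B [r [s [rs sr]]]] := idem _ _ ee.
exists B, (b \oc fmap F s), (fmap F r \oc a); split.
  rewrite hcompA -(hcompA _ a) -Fe -!fmap_comp -fmap_id; apply: fmap_heq.
  by rewrite -sr !hcompA rs hcomp1l rs.
rewrite hcompA -(hcompA b) -fmap_comp sr Fe !hcompA ba hcomp1l ba.
reflexivity.
Qed.

(* Think of S as the sum of countably many copies of A, of io and pr as the 0-th injection
   and projection, of sg and sg' as the shifts, and of E as e on each copy.  The morphism (1 - E) + sg E moves
   the e-part of each copy to the next one: it is split mono and misses only the e-part of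
   the 0-th copy, so its cone is the image of e. *)
Section Telescope.
Variables (C : pcat) (A S : C) (e : hom A A) (E sg sg' : hom S S) (io : hom A S) (pr : hom S A).

Definition telescope_data : Prop :=
  [/\ pr \oc io =h hid A, sg' \oc sg =h hid S & (sg \oc sg') +h (io \oc pr) =h hid S] /\
  [/\ E \oc sg =h sg \oc E, E \oc sg' =h sg' \oc E, E \oc io =h io \oc e, e \oc e =h e
    & E \oc E =h E].

Hypothesis td : telescope_data.
Lemma telescope_maps : exists f g : hom S S,
  g \oc f =h hid S /\ (f \oc g) +h ((io \oc pr) \oc E) =h hid S.
Proof.
have [[pi ss sum] [Es Es' Ei ee EE]] := td.
have [n [nE En nn npE n_comm]] : exists n : hom S S, [/\ n \oc E =h hzero S S,
    E \oc n =h hzero S S, n \oc n =h n, n +h E =h hid S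
    & forall u : hom S S, E \oc u =h u \oc E -> n \oc u =h u \oc n].
  pose n := hid S -h E.
  have En : E \oc n =h hzero S S by rewrite hcompDr hcompNr EE hcomp1r haddNr.
  have nE : n \oc E =h hzero S S by rewrite hcompDl hcompNl EE hcomp1l haddNr.
  exists n; split=> // [||u h].
  - by rewrite {1}/n hcompDl hcompNl En hopp0 hcomp1l hadd0r.
  - by rewrite /n -haddA haddN hadd0r.
  - by rewrite /n hcompDl hcompDr hcompNl hcompNr h hcomp1l hcomp1r.
(* The second map shifts the E-part back. It undoes the first, and on the other side the defect is
   that of [sg \oc sg'], cut down by E. *)
exists (n +h (sg \oc E)), (n +h (sg' \oc E)); split.
  rewrite !hcompDl !hcompDr nn (hcompA n) (n_comm _ Es) -(hcompA sg n) nE hcomp0r hadd0r.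
  rewrite -(hcompA sg' E n) En hcomp0r hadd0.
  by rewrite -(hcompA sg' E) (hcompA E sg) Es -(hcompA sg E) EE (hcompA sg') ss hcomp1l npE.
rewrite !hcompDl !hcompDr nn (hcompA n) (n_comm _ Es') -(hcompA sg' n) nE hcomp0r hadd0r.
rewrite -(hcompA sg E n) En hcomp0r hadd0.
rewrite -(hcompA sg E) (hcompA E sg') Es' -(hcompA sg' E) EE (hcompA sg).
by rewrite -haddA -hcompDl sum hcomp1l npE.
Qed.

(** Both complements of f g agree, so j q = io e pr. The 0-th projector io pr equals 1 - sg sg' and
    therefore commutes with E. *)
Lemma telescope_image (f g : hom S S) (Z : C) (j : hom Z S) (q : hom S Z) :
  (f \oc g) +h ((io \oc pr) \oc E) =h hid S -> q \oc j =h hid Z ->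
  (f \oc g) +h (j \oc q) =h hid S ->
  exists (r : hom A Z) (s : hom Z A), r \oc s =h hid Z /\ s \oc r =h e.
Proof.
have [[pi ss sum] [Es Es' Ei ee EE]] := td.
move=> h1 qj h2.
have jq : j \oc q =h (io \oc pr) \oc E.
  by apply: (@hadd_cancel _ _ _ (f \oc g)); rewrite h1 h2.
have comm : (io \oc pr) \oc E =h E \oc (io \oc pr).
  have e1 : io \oc pr =h hid S -h (sg \oc sg').
    by rewrite -sum (haddC (sg \oc sg')) -haddA haddNr hadd0r.
  rewrite e1 hcompDl hcompDr hcompNl hcompNr hcomp1l hcomp1r.
  by rewrite (hcompA E) Es -(hcompA sg E) Es' hcompA.
have jq' : j \oc q =h (io \oc e) \oc pr by rewrite jq comm hcompA Ei.
exists (q \oc (io \oc e)), ((e \oc pr) \oc j); split.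
  have -> : (q \oc (io \oc e)) \oc ((e \oc pr) \oc j) =h q \oc ((io \oc e) \oc pr) \oc j.
    by rewrite !hcompA -(hcompA _ e e) ee.
  by rewrite -jq' !hcompA qj hcomp1l qj.
have -> : ((e \oc pr) \oc j) \oc (q \oc (io \oc e)) =h (e \oc pr) \oc (j \oc q) \oc (io \oc e).
  by rewrite !hcompA.
rewrite jq' !hcompA -!(hcompA _ pr io) !pi !hcomp1r !ee.
reflexivity.
Qed.
End Telescope.

Section Complement.
Variables (C : pcat) (T : triangulation C) (P Q : C -> Prop).
Hypothesis P_retract : forall (X D : C) (i : hom X D) (p : hom D X),
  p \oc i =h hid X -> P D -> P X.
Hypothesis P_bip : forall X Y D : C, is_biproduct X Y D -> P X -> P Y -> P D.
Hypothesis Q_bip : forall X Y D : C, is_biproduct X Y D -> Q X -> Q Y -> Q D.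
Hypothesis QP : forall X, Q X -> P X.
Hypothesis Q_zero : forall Z : C, is_zero Z -> Q Z.

Lemma factors_one (X Y : C) (f : hom X Y) : factors Q f ->
  exists W (a : hom X W) (b : hom W Y), Q W /\ f =h b \oc a.
Proof.
have [[Z Z0] bip] := tri_additive T.
apply: (factors_single (Q_zero Z0)) => X' Y' QX QY; have [D hD] := bip X' Y'.
by exists D => //; apply: Q_bip hD _ _.
Qed.

Lemma quot_null (X Y W : C) (a : hom X W) (b : hom W Y) : Q W ->
  @heq (quot Q) X Y (b \oc a) (hzero X Y).
Proof.
move=> QW; apply: (@factors_heq C Q X Y (b \oc a)); last exact: factors_through.
by rewrite hopp0 hadd0r.
Qed.

(** The defect 1 - gf factors as dc through some W in Q. Then (f, c) into the sum of Y and W is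
    split by (g, d) in C itself, and [split_mono_cone] gives a complement, which is carried back to
    Y modulo Q. *)
Lemma quot_complement (X Y : C) (f : hom X Y) (g : hom Y X) : P X -> P Y ->
  @heq (quot Q) X X (g \oc f) (hid X) ->
  exists Z (j : hom Z Y) (q : hom Y Z), [/\ P Z, @heq (quot Q) Z Z (q \oc j) (hid Z)
    & @heq (quot Q) Y Y ((f \oc g) +h (j \oc q)) (hid Y)].
Proof.
move=> PX PY gf; have [W [c [d [QW e]]]] := factors_one (heq_sym gf).
have [_ bip] := tri_additive T.
have [D hD] := bip Y W; have PD := P_bip hD PY (QP QW).
have [i [k [p [l [pi lk pk li sum]]]]] := hD.
have gf1 : ((g \oc p) +h (d \oc l)) \oc ((i \oc f) +h (k \oc c)) =h hid X.
  rewrite !hcompDl !hcompDr !hcomp4 pi lk pk li !hcomp0r !hcomp0l !hcomp1r hadd0 hadd0r.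
  by rewrite -e haddC -haddA haddN hadd0r.
have [Z [j [q [_ [_ [qj _ _ fgjq]]]]]] := split_mono_cone T gf1.
have PZ : P Z by apply: P_retract qj PD.
have ip1 : @heq (quot Q) D D (i \oc p) (hid D).
  have s1 : @heq (quot Q) D D ((i \oc p) +h (k \oc l)) (hid D) by apply: quot_eq_heq.
  have s2 := quot_null l k QW.
  have s3 : @heq (quot Q) D D ((i \oc p) +h (k \oc l)) (i \oc p).
    have := @hadd_heq (quot Q) D D _ _ _ _ (heq_refl (i \oc p : @hom (quot Q) D D)) s2.
    move=> h; apply: (heq_trans h); exact: (@hadd0r (quot Q) D D).
  exact: heq_trans (heq_sym s3) s1.
exists Z, (p \oc j), (q \oc i); split=> //.
  have h := @hcomp_heq (quot Q) Z D Z q q _ _ (heq_refl _)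
    (@hcomp_heq (quot Q) Z D D _ _ j j ip1 (heq_refl _)).
  have e1 : (q \oc i) \oc (p \oc j) =h q \oc ((i \oc p) \oc j) by rewrite !hcompA.
  have e2 : q \oc (hid D \oc j) =h hid Z by rewrite hcomp1l qj.
  exact: quot_eq_trans (quot_eq_heq Q e1) (quot_eq_trans h (quot_eq_heq Q e2)).
apply: quot_eq_heq.
have pf : p \oc ((i \oc f) +h (k \oc c)) =h f.
  by rewrite hcompDr !hcompA pi pk hcomp1l hcomp0l hadd0r.
have gi : ((g \oc p) +h (d \oc l)) \oc i =h g.
  by rewrite hcompDl -!hcompA pi li hcomp1r hcomp0r hadd0r.
have fg : (f \oc g) +h (p \oc j \oc (q \oc i)) =h
    p \oc (((i \oc f) +h (k \oc c)) \oc ((g \oc p) +h (d \oc l)) +h (j \oc q)) \oc i.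
  move: (_ +h (k \oc c)) pf (_ +h (d \oc l)) gi => u pu v vi.
  by rewrite -pu -vi hcompDr hcompDl !hcompA.
by rewrite fg fgjq hcomp1r pi.
Qed.

Lemma telescope_split (A S : C) (e : hom A A) (E sg sg' : hom S S) (io : hom A S) (pr : hom S A) :
  P A -> P S ->
  [/\ pr \oc io =h hid A, sg' \oc sg =h hid S & (sg \oc sg') +h (io \oc pr) =h hid S] ->
  [/\ E \oc sg =h sg \oc E, E \oc sg' =h sg' \oc E & E \oc io =h io \oc e] ->
  factors Q ((e \oc e) -h e) -> factors Q ((E \oc E) -h E) ->
  exists B (r : hom A B) (s : hom B A),
    [/\ P B, factors Q ((r \oc s) -h hid B) & factors Q ((s \oc r) -h e)].
Proof.
move=> PA PS [t1 t2 t3] [t4 t5 t6] ee EE.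
have td : telescope_data (C := quot Q) e E sg sg' io pr.
  by split; split=> //; apply: quot_eq_heq.
have [f [g [gf fg]]] := telescope_maps td.
have [Z [j [q [PZ qj fgjq]]]] := quot_complement PS PS gf.
have [r [s [rs sr]]] := telescope_image td fg qj fgjq.
by exists Z, r, s.
Qed.
End Complement.

(** * Fitting's lemma for chain maps *)

Section Fitting.
Variables (k : comPzRingType) (gT : finGroupType) (G : {group gT}).

Lemma fl0_eq (M : gmod k G) K (A B : M -> Prop) : fl K 0 A B -> A = B.
Proof. by move E: 0%N => n h; case: h E. Qed.

Lemma fl_chain (M : gmod k G) n m (F : nat -> M -> Prop) :
  fl G n (F 0%N) (F m) -> (forall i, subm G (F i)) ->
  (forall i x, F i x -> F i.+1 x) -> (forall i, (i < m)%N -> exists x, F i.+1 x /\ ~ F i x) ->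
  (m <= n)%N.
Proof.
elim: m n => [//|m IH] n h sF mono strict.
have mono' i j x : (i <= j)%N -> F i x -> F j x.
  by move=> /subnK<-; elim: (j - i)%N => // d IHd /IHd; apply: mono.
have [n1 [n2 [h1 h2 <-]]] := fl_between h (sF m) (fun x => mono' 0%N m x (leq0n m)) (mono m).
have n2P : (0 < n2)%N.
  case: n2 h2 => // /fl0_eq e; have [x [Fx nFx]] := strict m (ltnSn m).
  by case: nFx; rewrite e.
rewrite -addn1 leq_add // (IH n1) // => i im; apply: strict; exact: ltnW.
Qed.

Section Powers.
Variables (M : gmod k G) (phi : M -> M) (hphi : gmap G phi).
Notation pw n x := (iter n phi x).

Lemma iter_gmap n : gmap G (fun x => pw n x).
Proof. by elim: n => [|n IH]; [exact: gmap_id | exact: gmap_comp hphi IH]. Qed.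

Lemma iterDl n m x : pw (n + m) x = pw n (pw m x).
Proof. exact: iterD. Qed.

Lemma ker_sub n : subm G (fun x : M => pw n x = 0).
Proof.
have h := iter_gmap n; split=> [|x y hx hy|a x hx|g x gG hx].
- exact: gmap0 h.
- by rewrite (gmapD h) hx hy addr0.
- by rewrite (gmapZ h) hx scaler0.
- by rewrite (gmap_act h) // hx linear0.
Qed.

Lemma im_sub n : subm G (fun x : M => exists y, x = pw n y).
Proof.
have h := iter_gmap n; split=> [|x y [u ->] [v ->]|a x [u ->]|g x gG [u ->]].
- by exists 0; rewrite (gmap0 h).
- by exists (u + v); rewrite (gmapD h).
- by exists (a *: u); rewrite (gmapZ h).
- by exists (act M g u); rewrite (gmap_act h).
Qed.

(** Once two consecutive kernels agree, all later ones do. Otherwise l + 1 strict inclusions would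
    occur in a module of length at most l, against [fl_chain]. *)
Lemma ker_stable : finite_length M ->
  exists N, forall n x, (N <= n)%N -> pw n.+1 x = 0 -> pw n x = 0.
Proof.
move=> /finite_lengthP[l hl].
have [[j hj]|no] := pselect (exists j, forall x, pw j.+1 x = 0 -> pw j x = 0).
  exists j => n x /subnK <-; elim: (n - j)%N x => [|d IH] x; first exact: hj.
  by rewrite addSn !(iterSr _ phi x); apply: IH.
have strict j : exists x, pw j.+1 x = 0 /\ pw j x <> 0.
  apply: contrapT => nj; apply: no; exists j => x e.
  by apply: contrapT => ne; apply: nj; exists x.
have [sK0 _ _] := fl_subm hl.
have sK := ker_sub l.+1; have s1 : forall x : M, x = 0 -> pw l.+1 x = 0.
  by move=> x ->; rewrite (gmap0 (iter_gmap _)).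
have [n1 [n2 [h1 _ e]]] := fl_between hl sK s1 (fun x _ => I).
have := @fl_chain M n1 l.+1 (fun j x => pw j x = 0) h1 ker_sub _ (fun j _ => strict j).
move=> h; have : (l.+1 <= n1)%N.
  by apply: h => i x /= ->; rewrite (gmap0 hphi).
by rewrite -e leqNgt ltnS leq_addr.
Qed.

Lemma im_stable : finite_length M ->
  exists N, forall n x, (N <= n)%N -> exists y, pw n x = pw n.+1 y.
Proof.
move=> /finite_lengthP[l hl].
have [[j hj]|no] := pselect (exists j, forall x, exists y, pw j x = pw j.+1 y).
  exists j => n x /subnK <-; rewrite iterDl; have [y ->] := hj x.
  by exists y; rewrite -iterDl addnS.
have strict j : exists x, (exists y, x = pw j y) /\ ~ (exists y, x = pw j.+1 y).
  apply: contrapT => nj; apply: no; exists j => x; apply: contrapT => ne.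
  by apply: nj; exists (pw j x); split=> //; exists x.
(* Images decrease with the exponent, so the index is reversed to obtain an increasing chain with l
   + 1 strict inclusions. *)
pose F j (x : M) := exists y, x = pw (l.+1 - j) y.
have e0 : F l.+1 = (fun=> True).
  by apply: pred_ext => // x _; exists x; rewrite subnn.
have sF0 := im_sub (l.+1 - 0).
have z0 : forall x : M, x = 0 -> F 0%N x.
  by move=> x ->; exists 0; rewrite (gmap0 (iter_gmap _)).
have [n1 [n2 [_ h2 e]]] := fl_between hl sF0 z0 (fun x _ => I).
rewrite -/(F 0%N) -e0 in h2.
have : (l.+1 <= n2)%N.
  apply: (fl_chain h2) => [i|i x [y ->]|i il]; first exact: im_sub.
  - have [il|li] := ltnP i l.+1.
      by exists (phi y); rewrite -iterSr -subSn // subSS.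
    have e1 : (l.+1 - i = 0)%N by apply/eqP.
    by exists y; rewrite subnS e1.
  - have [x [hx nx]] := strict (l.+1 - i.+1)%N; exists x; split=> //.
    by move=> [y ey]; apply: nx; exists y; rewrite ey subnSK.
by rewrite -e leqNgt ltnS leq_addl.
Qed.

Lemma ker_stableD : finite_length M ->
  exists N, forall n m x, (N <= n)%N -> pw (m + n) x = 0 -> pw n x = 0.
Proof.
move=> /ker_stable[N hN]; exists N => n m x Nn; elim: m => // m IH h.
by apply/IH/hN => //; apply: leq_trans Nn (leq_addl _ _).
Qed.

Lemma im_stableD : finite_length M ->
  exists N, forall n m x, (N <= n)%N -> exists y, pw n x = pw (m + n) y.
Proof.
move=> /im_stable[N hN]; exists N => n m x Nn; elim: m => [|m [y ->]]; first by exists x.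
by have [z ->] := hN (m + n)%N y (leq_trans Nn (leq_addl _ _)); exists z.
Qed.

(* The inverse of phi on the part where it is bijective, extended by 0. *)
Definition fit_inv x z : Prop := exists N, forall n, (N <= n)%N ->
  (exists y, z = pw n y) /\ pw n.+1 z = pw n x.

Hypothesis flM : finite_length M.

Lemma fit_inv_total x : exists z, fit_inv x z.
Proof.
have [N1 h1] := ker_stableD flM; have [N2 h2] := im_stableD flM.
pose N := maxn N1 N2.
(* With phi^N x = phi^(2N+1) y, the element z = phi^N y lies in the stable image and phi^(N+1) z =
   phi^N x. *)
have [y ey] := h2 N N.+1 x (leq_maxr _ _).
exists (pw N y); exists N => n Nn; split.
  have [z ->] := h2 N (n - N)%N y (leq_maxr _ _); exists z.
  by rewrite subnK.
by rewrite -(subnK Nn) -addnS !iterDl ey !iterDl.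
Qed.

Lemma fit_inv_uniq z : fit_inv 0 z -> z = 0.
Proof.
move=> [N h]; have [N1 h1] := ker_stableD flM.
have [[y ->] e] := h (maxn N N1) (leq_maxl _ _).
apply: (h1 _ (maxn N N1).+1 _ (leq_maxr _ _)).
by rewrite iterDl e (gmap0 (iter_gmap _)).
Qed.

Lemma fit_inv_lin a x y z w : fit_inv x z -> fit_inv y w -> fit_inv (a *: x + y) (a *: z + w).
Proof.
move=> [N h] [N' h']; exists (maxn N N') => n; rewrite geq_max => /andP[Nn N'n].
have [[u eu] e] := h n Nn; have [[v ev] e'] := h' n N'n.
by split; [exists (a *: u + v)|]; rewrite (gmapP (iter_gmap _)) ?eu ?ev // -eu -ev e e'
  (gmapP (iter_gmap _)).
Qed.

Lemma fit_inv_act g x z : g \in G -> fit_inv x z -> fit_inv (act M g x) (act M g z).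
Proof.
move=> gG [N h]; exists N => n Nn; have [[u eu] e] := h n Nn.
split; first by exists (act M g u); rewrite (gmap_act (iter_gmap _)) // -eu.
by rewrite !(gmap_act (iter_gmap _)) // e.
Qed.

Lemma fit_inv_step x z : fit_inv x z -> fit_inv (phi x) (phi z).
Proof.
move=> [N h]; exists N => n Nn; have [[u eu] e] := h n Nn.
by split; [exists (phi u); rewrite -iterSr eu | rewrite -!iterSr iterS e].
Qed.

Lemma fit_inv_proj x z : fit_inv x z -> fit_inv (phi z) z.
Proof.
move=> [N h]; exists N => n Nn; have [hu e] := h n Nn.
by split=> //; rewrite iterSr.
Qed.

Lemma fit_inv_nil x z : fit_inv x z -> exists n, pw n (x - phi z) = 0.
Proof.
move=> [N h]; exists N; have [_ e] := h N (leqnn N).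
by rewrite (gmapB (iter_gmap _)) -e iterSr subrr.
Qed.

(* The inverse of 1 - phi on the part where phi is nilpotent. *)
Definition nil_inv u z : Prop := (exists n, pw n z = 0) /\ z - phi z = u.

Lemma nil_inv_total u : (exists n, pw n u = 0) -> exists z, nil_inv u z.
Proof.
move=> [n u0]; exists (\sum_(j < n) pw j u); split.
  exists n; rewrite (gmap_sum (iter_gmap n)) big1 // => j _.
  by rewrite -iterDl addnC iterDl u0 (gmap0 (iter_gmap _)).
rewrite (gmap_sum hphi) -sumrB.
have -> : \sum_(j < n) (pw j u - phi (pw j u)) = u - pw n u.
  elim: n {u0} => [|n IH]; first by rewrite big_ord0 subrr.
  by rewrite big_ord_recr /= IH addrA subrK.
by rewrite u0 subr0.
Qed.

Lemma nil_inv_uniq z : nil_inv 0 z -> z = 0.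
Proof.
move=> [[n zn] /eqP]; rewrite subr_eq0 => /eqP e; rewrite -zn.
by elim: {zn} n => //= n <-.
Qed.

Lemma nil_inv_lin a u v z w : nil_inv u z -> nil_inv v w ->
  nil_inv (a *: u + v) (a *: z + w).
Proof.
move=> [[n zn] ez] [[m wm] ew]; split.
  have e1 : pw (n + m) z = 0 by rewrite addnC iterDl zn (gmap0 (iter_gmap _)).
  have e2 : pw (n + m) w = 0 by rewrite iterDl wm (gmap0 (iter_gmap _)).
  by exists (n + m)%N; rewrite (gmapP (iter_gmap _)) e1 e2 scaler0 addr0.
by rewrite (gmapP hphi) opprD addrACA -scalerBr ez ew.
Qed.

Lemma nil_inv_act g u z : g \in G -> nil_inv u z -> nil_inv (act M g u) (act M g z).
Proof.
move=> gG [[n zn] ez]; split; last by rewrite (gmap_act hphi) // -linearB ez.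
by exists n; rewrite (gmap_act (iter_gmap _)) // zn linear0.
Qed.
End Powers.

(** The exponent at which kernels and images stabilize depends on the degree, with no bound over all
    degrees. Defining maps by relations hides it, and uniqueness turns compatibility of the relation
    into linearity, equivariance and commutation with differentials. *)
Lemma rel_chmap (X Y : cpx k G) (R : forall i, X i -> Y i -> Prop) :
  (forall i x, exists z, R i x z) -> (forall i z, R i 0 z -> z = 0) ->
  (forall i a x y z w, R i x z -> R i y w -> R i (a *: x + y) (a *: z + w)) ->
  (forall i g x z, g \in G -> R i x z -> R i (act (X i) g x) (act (Y i) g z)) ->
  (forall i x z, R i x z -> R (i + 1) (cd X i x) (cd Y i z)) ->
  exists f : chmap X Y, forall i x, R i x (f i x).
Proof.
move=> tot un lin ac dd.
have fn i x z w : R i x z -> R i x w -> z = w.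
  move=> h h'; have := un i (w - z).
  have := lin i (-1) _ _ _ _ h h'; rewrite !scaleN1r addNr addrC => e /(_ e)/eqP.
  by rewrite subr_eq0 => /eqP.
have [f hf] := dchoice (fun i => dchoice (tot i)).
have cf : cmap G f.
  split=> [i|i x]; first split=> [a x y|q qG m].
  - by apply: fn (hf _ _) _; apply: lin.
  - by apply: fn (hf _ _) _; apply: ac.
  - by apply: fn (hf _ _) _; apply: dd.
by exists (mkchmap cf).
Qed.

(* Fitting's lemma in each degree; pi is the projection to the part where phi is bijective,
   and theta inverts phi there and phi - 1 on the other part. *)
Lemma fitting (X : cpx k G) (phi : chmap X X) : (forall i, finite_length (X i)) ->
  exists pi theta : chmap X X, (forall i x, pi i (pi i x) = pi i x) /\
    forall i x, phi i x - pi i x = theta i (phi i (phi i x) - phi i x).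
Proof.
move=> flX; have hp i := gmap_ghom (phi i).
have itd n i x : iter n (phi (i + 1)) (cd X i x) = cd X i (iter n (phi i) x).
  by elim: n => //= n ->; rewrite cmd.
pose R i : X i -> X i -> Prop := fit_inv (phi i).
have Rd i x z : R i x z -> R (i + 1) (cd X i x) (cd X i z).
  move=> [N h]; exists N => n Nn; have [[y ey] e] := h n Nn.
  by rewrite !itd e; split=> //; exists (cd X i y); rewrite itd -ey.
have [ups hu] := rel_chmap (fun i => fit_inv_total (hp i) (flX i))
  (fun i => fit_inv_uniq (hp i) (flX i)) (fun i => fit_inv_lin (hp i))
  (fun i => fit_inv_act (hp i)) Rd.
(* x - phi (ups x) is the component of x on which phi is nilpotent; W inverts 1 - phi there and
   kills the other component. *)
pose W i (x z : X i) := exists y, fit_inv (phi i) x y /\ nil_inv (phi i) (x - phi i y) z.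
have Wuniq i z : W i 0 z -> z = 0.
  move=> [y [/(fit_inv_uniq (hp i) (flX i)) ->]].
  rewrite linear0 subr0; exact: nil_inv_uniq.
have Wlin i a x x' z z' : W i x z -> W i x' z' -> W i (a *: x + x') (a *: z + z').
  move=> [y [h1 h2]] [y' [h1' h2']].
  exists (a *: y + y'); split; first exact: (fit_inv_lin (hp i) a h1 h1').
  have := nil_inv_lin (hp i) a h2 h2'.
  by rewrite scalerBr addrACA -opprD -linearP.
have [w hw] : exists w : chmap X X, forall i x, W i x (w i x).
  apply: rel_chmap => // [i x|i g x z gG [y [h1 h2]]|i x z [y [h1 [[n zn] ez]]]].
  - have [z hz] := nil_inv_total (hp i) (fit_inv_nil (hp i) (hu i x)).
    by exists z, (ups i x).
  - exists (act (X i) g y); split; first exact: (fit_inv_act (hp i) gG h1).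
    by have := nil_inv_act (hp i) gG h2; rewrite linearB ghom_act.
  - exists (cd X i y); split; first exact: Rd.
    split; first by exists n; rewrite itd zn linear0.
    by rewrite !cmd -!linearB ez.
have uphi i x : ups i (phi i x) = phi i (ups i x).
  have := fit_inv_lin (hp i) (-1) (fit_inv_step (hu i x)) (hu i (phi i x)).
  rewrite scaleN1r addNr => /(fit_inv_uniq (hp i) (flX i)) /eqP.
  by rewrite scaleN1r addrC subr_eq0 => /eqP.
have upi i x : ups i (phi i (ups i x)) = ups i x.
  have := fit_inv_lin (hp i) (-1) (fit_inv_proj (hu i x)) (hu i (phi i (ups i x))).
  rewrite scaleN1r addNr => /(fit_inv_uniq (hp i) (flX i)) /eqP.
  by rewrite scaleN1r addrC subr_eq0 => /eqP.
(* The sign of w is reversed because w inverts 1 - phi, while theta has to invert phi - 1 on the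
   nilpotent part. *)
exists (cm_comp phi ups), (cm_add ups (cm_opp w)); split=> i x /=; first by rewrite upi.
suff -> : w i (phi i (phi i x) - phi i x) = phi i (phi i (ups i x)) - phi i x.
  by rewrite linearB /= !uphi opprB [in RHS]addrC addrA subrK.
have [n hn] := fit_inv_nil (hp i) (hu i x).
have hW : W i (phi i (phi i x) - phi i x) (phi i (phi i (ups i x)) - phi i x).
  exists (phi i (phi i (ups i x)) - phi i (ups i x)); split.
    have h1 := fit_inv_step (hu i x); have h2 := fit_inv_step h1.
    have := fit_inv_lin (hp i) (-1) h1 h2.
    by rewrite !scaleN1r addrC [X in fit_inv _ _ X]addrC.
  split.
    exists n; have -> : phi i (phi i (ups i x)) - phi i x = phi i (- (x - phi i (ups i x))).
      by rewrite opprB linearB.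
    by rewrite -iterSr iterS (gmapN (iter_gmap (hp i) n)) hn oppr0 linear0.
  by rewrite !linearB /= !opprK [LHS]addrC [LHS]addrACA [LHS]addrC.
have := Wlin i (-1) _ _ _ _ hW (hw i (phi i (phi i x) - phi i x)).
rewrite scaleN1r addNr => /Wuniq/eqP.
by rewrite scaleN1r addrC subr_eq0 => /eqP.
Qed.
End Fitting.

(** * Images of idempotent chain maps *)

Section IdempotentImage.
Variables (k : comPzRingType) (gT : finGroupType) (G : {group gT}).

Section OneModule.
Variables (M : gmod k G) (p : ghom M M).

Definition ret_test (A : lmodType k) (b : M -> A) : Prop :=
  linear b /\ forall x, b (p x) = b x.

(* The universal quotient of M on which p is the identity; it is the image of p. *)
Definition ret_mod : lmodType k := pres ret_test.
Definition ret_proj (x : M) : ret_mod := gen ret_test x.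

Lemma ret_proj_linear : linear ret_proj.
Proof.
move=> a x y; apply: pev_inj => A b tb.
by rewrite (pev_linear tb) !pev_gen // tb.1.
Qed.

Lemma ret_projK x : ret_proj (p x) = ret_proj x.
Proof. by apply: pev_inj => A b tb; rewrite !pev_gen // tb.2. Qed.

Lemma ret_surj t : exists x, ret_proj x = t.
Proof.
pose j : {linear M -> ret_mod} := lin_of ret_proj_linear.
rewrite (pres_decomp t); eexists (\sum_(q <- generic_quotient.repr t) q.1 *: q.2).
rewrite -[LHS]/(j _) linear_sum; apply: eq_bigr => q _.
by rewrite linearZ.
Qed.

(* [p] commutes with the action of the elements of G only. *)
Let inG (g : gT) := if g \in G then g else 1%g.
Let inGG g : inG g \in G. Proof. by rewrite /inG; case: ifP. Qed.

Lemma ret_act_compat g : pres_compat ret_test ret_test (act M (inG g)).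
Proof.
move=> A b [b1 b2]; split=> [a x y|x] /=; first by rewrite linearP b1.
by rewrite -ghom_act // b2.
Qed.
Definition ret_act g : {linear ret_mod -> ret_mod} := pres_map (ret_act_compat g).

Lemma ret_act_proj g x : g \in G -> ret_act g (ret_proj x) = ret_proj (act M g x).
Proof. by move=> gG; rewrite /ret_act pres_map_gen /inG gG. Qed.
Lemma ret_act1 t : ret_act 1%g t = t.
Proof. by have [x <-] := ret_surj t; rewrite ret_act_proj // act1. Qed.
Lemma ret_actM g h : g \in G -> h \in G ->
  forall t, ret_act (g * h)%g t = ret_act g (ret_act h t).
Proof.
move=> gG hG t; have [x <-] := ret_surj t.
by rewrite !ret_act_proj ?groupM // actM.
Qed.
Definition ret_gmod : gmod k G := Gmod ret_act1 ret_actM.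

Lemma ret_proj_gmap : gmap G (ret_proj : M -> ret_gmod).
Proof. by split=> [|q qG m]; [exact: ret_proj_linear | rewrite -ret_act_proj]. Qed.

Hypothesis pK : forall x, p (p x) = p x.
Lemma ret_incl_test : ret_test p.
Proof. by split=> // a x y; rewrite linearP. Qed.
Definition ret_incl (t : ret_gmod) : M := pevl ret_incl_test t.
Lemma ret_incl_proj x : ret_incl (ret_proj x) = p x.
Proof. exact: pevl_gen. Qed.
Lemma ret_incl_gmap : gmap G ret_incl.
Proof.
split=> [|q qG t]; first exact: linearP.
have [x <-] := ret_surj t; rewrite /= ret_act_proj // !ret_incl_proj.
exact: ghom_act.
Qed.
Lemma ret_proj_incl t : ret_proj (ret_incl t) = t.
Proof. by have [x <-] := ret_surj t; rewrite ret_incl_proj ret_projK. Qed.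
End OneModule.

Lemma split_chain_idempotent (c : choices) (X : cpx k G) (p : chmap X X) :
  (forall i x, p i (p i x) = p i x) -> admissible c X ->
  exists B (r : chmap X B) (s : chmap B X), [/\ admissible c B,
    forall i x, r i (s i x) = x & forall i x, s i (r i x) = p i x].
Proof.
move=> pK [flX bX].
have hd i : gmap G (fun t : ret_gmod (p i) =>
      ret_proj (p (i + 1)) (cd X i (ret_incl (pK i) t)) : ret_gmod (p (i + 1))).
  apply: gmap_comp (ret_proj_gmap (p (i + 1))) _.
  exact: gmap_comp (gmap_ghom (cd X i)) (ret_incl_gmap (pK i)).
pose d i : ghom (ret_gmod (p i)) (ret_gmod (p (i + 1))) := mkhom (hd i).
have dE i x : d i (ret_proj (p i) x) = ret_proj (p (i + 1)) (cd X i x).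
  by rewrite /= ret_incl_proj -cmd ret_projK.
have dd i t : d (i + 1) (d i t) = 0.
  have [x <-] := ret_surj t; rewrite !dE cdd.
  exact: gmap0 (ret_proj_gmap _).
pose B : cpx k G := Cpx dd.
have cr : @cmap k gT G G G X B (fun i x => ret_proj (p i) x : B i).
  by split=> [i|i x]; [exact: ret_proj_gmap | rewrite -dE].
have cs : @cmap k gT G G G B X (fun i (t : B i) => ret_incl (pK i) t).
  split=> [i|i t]; first exact: ret_incl_gmap.
  have [x <-] := ret_surj t.
  by rewrite -[cd B i]/(d i) dE !ret_incl_proj cmd.
exists B, (mkchmap cr), (mkchmap cs); split.
- split=> [ft i|].
    apply: (fl_surj (gmap_sub (sub0set _) (ret_proj_gmap (p i)))); last exact: flX.
    exact: ret_surj.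
  have zero i : (forall x : X i, x = 0) -> forall t : B i, t = 0.
    move=> h t; have [x <-] := ret_surj t; rewrite (h x).
    exact: gmap0 (ret_proj_gmap _).
  case: (boundedness c) bX => //.
  + by move=> [n h]; exists n => i ni; apply: zero; apply: h.
  + by move=> [n h]; exists n => i ni; apply: zero; apply: h.
  + by move=> [[n h] [n' h']]; split; [exists n | exists n'] => i ni; apply: zero;
      [apply: h | apply: h'].
- by move=> i t; exact: ret_proj_incl.
- by move=> i x; exact: ret_incl_proj.
Qed.
End IdempotentImage.

(** * Countable direct sums of modules *)

Section CountableSums.
Variables (k : comPzRingType) (gT : finGroupType).

Section OneModule.
Variable M : lmodType k.

Definition inf_test (A : lmodType k) (b : nat * M -> A) : Prop :=
  forall n, linear (fun m => b (n, m)).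
Definition inf_mod : lmodType k := pres inf_test.
Definition inj n (m : M) : inf_mod := gen inf_test (n, m).

Lemma inj_linear n : linear (inj n).
Proof.
move=> a x y; apply: pev_inj => A b tb.
by rewrite (pev_linear tb) !pev_gen // tb.
Qed.

Lemma inf_ext (A : lmodType k) (f g : inf_mod -> A) : linear f -> linear g ->
  (forall n x, f (inj n x) = g (inj n x)) -> forall t, f t = g t.
Proof. by move=> lf lg e; apply: pres_gen_ext => // -[n x]; apply: e. Qed.

Section Univ.
Variables (A : lmodType k) (u : nat -> M -> A).
Hypothesis hu : forall n, linear (u n).
Lemma univ_test : inf_test (fun p => u p.1 p.2).
Proof. by move=> n; exact: hu. Qed.
Definition univ : {linear inf_mod -> A} := pevl univ_test.
Lemma univ_inj n x : univ (inj n x) = u n x.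
Proof. exact: pevl_gen. Qed.
End Univ.

Lemma prj_linear (n j : nat) : linear (fun m : M => if j == n then m else 0).
Proof. by case: eqP => _ a x y //; rewrite scaler0 addr0. Qed.
Definition prj n : {linear inf_mod -> M} := univ (prj_linear n).
Lemma prj_inj n j x : prj n (inj j x) = if j == n then x else 0.
Proof. exact: univ_inj. Qed.

Lemma inj0 n : inj n 0 = 0.
Proof. by rewrite -[LHS]/(lin_of (inj_linear n) 0) linear0. Qed.

Lemma inf_finite t : exists N, t = \sum_(n < N) inj n (prj n t).
Proof.
(* The bound is strengthened to all larger m, so that the supports of two summands can be merged by
   taking a maximum. *)
suff [N h] : exists N, forall m, (N <= m)%N -> t = \sum_(n < m) inj n (prj n t).
  by exists N; apply: h.
rewrite (pres_decomp t); elim: (generic_quotient.repr t) => [|[a [j x]] s [N IH]].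
  exists 0%N => m _; rewrite big_nil big1 // => n _; rewrite linear0.
  exact: inj0.
exists (maxn N j.+1) => m; rewrite geq_max => /andP[/IH {}IH jm].
rewrite big_cons; set y := \sum_(q <- s) _ in IH *.
rewrite [LHS]addrC.
transitivity (\sum_(n < m) (inj n (prj n y) + inj n (prj n (a *: inj j x)))).
  rewrite big_split -IH; congr (_ + _).
  have pz n : prj n (a *: inj j x) = if j == n then a *: x else 0.
    by rewrite linearZ_LR prj_inj; case: ifP => // _; rewrite scaler0.
  rewrite (bigD1 (Ordinal jm)) // pz eqxx big1 => [|n].
    by rewrite Monoid.mulm1 -[RHS]/(lin_of (inj_linear j) _) linearZ_LR.
  by rewrite -val_eqE pz eq_sym => /negPf /= ->; rewrite inj0.
apply: eq_bigr => n _; rewrite linearD addrC.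
by rewrite -![inj n _]/(lin_of (inj_linear n) _) linearD.
Qed.
End OneModule.

Section Maps.
Variables (M N : lmodType k) (u : M -> N).
Hypothesis hu : linear u.
Lemma minf_linear n : linear (fun m => inj n (u m)).
Proof. by move=> a x y; rewrite hu inj_linear. Qed.
Definition minf : {linear inf_mod M -> inf_mod N} := univ minf_linear.
Lemma minf_inj n x : minf (inj n x) = inj n (u x).
Proof. exact: univ_inj. Qed.
End Maps.

Section InfGmod.
Variables (G : {group gT}) (M : gmod k G).
Definition inf_act (g : gT) : {linear inf_mod M -> inf_mod M} := minf (linearP (act M g)).
Lemma inf_act_inj g n x : inf_act g (inj n x) = inj n (act M g x).
Proof. exact: minf_inj. Qed.
Lemma inf_act1 t : inf_act 1%g t = t.
Proof.
move: t; apply: inf_ext => [a x y|//|n x]; first by rewrite linearP.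
by rewrite inf_act_inj act1.
Qed.
Lemma inf_actM g h : g \in G -> h \in G ->
  forall t, inf_act (g * h)%g t = inf_act g (inf_act h t).
Proof.
move=> gG hG; apply: inf_ext => [a x y|a x y|n x]; rewrite ?linearP //.
by rewrite !inf_act_inj actM.
Qed.
Definition ginf : gmod k G := Gmod inf_act1 inf_actM.
Lemma ginf_act g n x : act ginf g (inj n x) = inj n (act M g x).
Proof. exact: inf_act_inj. Qed.
Lemma inj_gmap n : gmap G (inj n : M -> ginf).
Proof. by split=> [|q qG m]; [exact: inj_linear | rewrite -inf_act_inj]. Qed.
Lemma prj_gmap n : gmap G (prj M n : ginf -> M).
Proof.
split=> [|q qG]; first exact: linearP.
apply: inf_ext => [a x y|a x y|j x]; rewrite ?linearP //.
by rewrite ginf_act !prj_inj; case: ifP; rewrite ?linear0.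
Qed.
End InfGmod.

Lemma univ_gmap (Q : {set gT}) (G1 G2 : {group gT}) (M : gmod k G1) (A : gmod k G2)
    (u : nat -> M -> A) (hu : forall n, gmap Q (u n)) :
  gmap Q (univ (fun n => (hu n).1) : ginf M -> A).
Proof.
split=> [|q qG]; first exact: linearP.
apply: inf_ext => [a x y|a x y|n x]; rewrite ?linearP //.
by rewrite ginf_act !univ_inj (gmap_act (hu n)).
Qed.

Lemma minf_gmap (Q : {set gT}) (G1 G2 : {group gT}) (M : gmod k G1) (N : gmod k G2)
    (u : M -> N) (hu : gmap Q u) : gmap Q (minf hu.1 : ginf M -> ginf N).
Proof.
split=> [|q qG]; first exact: linearP.
apply: inf_ext => [a x y|a x y|n x]; rewrite ?linearP //.
by rewrite ginf_act !minf_inj (gmap_act hu).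
Qed.

Section TensorInf.
Variables (V M N : lmodType k) (u : {linear tens V M -> tens V N}).
Definition injl (L : lmodType k) n : {linear L -> inf_mod L} := lin_of (@inj_linear L n).

Lemma tinf_lin v n : linear (fun m : M => idt V (injl N n) (u (tgen v m))).
Proof. by move=> a x y; rewrite (tgen_lin v) !linearP. Qed.
Lemma tinf_bilin : bilin (fun p : V * inf_mod M => univ (tinf_lin p.1) p.2).
Proof.
split=> [v|t]; first exact: (linearP (univ (tinf_lin v))).
move=> a v w; change (univ (tinf_lin (a *: v + w)) t =
  a *: univ (tinf_lin v) t + univ (tinf_lin w) t); move: t; apply: inf_ext => [b x y|b x y|n x]; first by rewrite linearP.
  move: (univ (tinf_lin v)) (univ (tinf_lin w)) => f g.
  by rewrite !linearP /= !scalerA (mulrC b a) addrACA.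
rewrite !univ_inj.
have -> : tgen (a *: v + w) x = a *: tgen v x + tgen w x :> tens V M.
  by apply: pev_inj => A b tb; rewrite (pev_linear tb) !pev_gen // tb.2.
by rewrite !linearP.
Qed.
(** The sum of countably many copies of u, under V (x) M^oo = (V (x) M)^oo. As for [tindf], u is
    arbitrary, since contracting homotopies of V (x) X need not come from X. *)
Definition tinf : {linear tens V (inf_mod M) -> tens V (inf_mod N)} := pevl tinf_bilin.
Lemma tinf_inj n t : tinf (idt V (injl M n) t) = idt V (injl N n) (u t).
Proof.
move: t; apply: tens_ext => [a x y|a x y|v x]; rewrite ?linearP //.
rewrite /idt tens_map_gen /tinf /tgen pevl_gen; exact: (univ_inj (tinf_lin v)).
Qed.
End TensorInf.

Lemma tinf_ext (V M A : lmodType k) (f g : tens V (inf_mod M) -> A) : linear f -> linear g ->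
  (forall n t, f (idt V (injl M n) t) = g (idt V (injl M n) t)) -> forall t, f t = g t.
Proof.
move=> lf lg e; apply: tens_ext => // v; apply: inf_ext => [a x y|a x y|n x].
- by rewrite (tgen_lin v) lf.
- by rewrite (tgen_lin v) lg.
by have := e n (tgen v x); rewrite /idt tens_map_gen.
Qed.
End CountableSums.

(** * Countable direct sums of complexes *)

Section InfiniteComplexes.
Variables (k : comPzRingType) (gT : finGroupType) (G : {group gT}).
Implicit Types X Y : cpx k G.

Definition cinf_d X i : ghom (ginf (X i)) (ginf (X (i + 1))) :=
  mkhom (minf_gmap (gmap_ghom (cd X i))).

Lemma cinf_d_inj X i n x : cinf_d X i (inj n x) = inj n (cd X i x).
Proof. exact: minf_inj. Qed.

Lemma cinf_dd X i t : cinf_d X (i + 1) (cinf_d X i t) = 0.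
Proof.
move: t; apply: inf_ext => [a x y|a x y|n x]; first by rewrite !linearP.
  by rewrite scaler0 addr0.
by rewrite !cinf_d_inj cdd inj0.
Qed.
Definition cinf X : cpx k G := Cpx (@cinf_dd X).

Definition cinj X n i (x : X i) : cinf X i := inj n x.

Lemma cinj_cmap X n : cmap G (@cinj X n).
Proof. by split=> [i|i x]; [exact: inj_gmap | symmetry; exact: cinf_d_inj]. Qed.

Lemma cprj_cmap X n : @cmap k gT G G G (cinf X) X (fun i t => prj (X i) n t).
Proof.
split=> [i|i]; first exact: prj_gmap.
apply: inf_ext => [a x y|a x y|j x]; rewrite ?linearP //.
by rewrite -[cd (cinf X) i]/(cinf_d X i) cinf_d_inj !prj_inj; case: ifP; rewrite ?linear0.
Qed.

Definition cuniv_fun (Q : {set gT}) (G1 G2 : {group gT}) (X : cpx k G1) (Y : cpx k G2)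
  (u : nat -> forall i, X i -> Y i) (hu : forall n, cmap Q (u n)) i : ginf (X i) -> Y i :=
  univ (fun n => ((hu n).1 i).1).

Lemma cuniv_cmap (Q : {set gT}) X (G2 : {group gT}) (Y : cpx k G2)
    (u : nat -> forall i, X i -> Y i) (hu : forall n, cmap Q (u n)) :
  cmap Q (cuniv_fun hu : forall i, cinf X i -> Y i).
Proof.
split=> [i|i]; first exact: (univ_gmap (fun n => (hu n).1 i)).
apply: inf_ext => [a x y|a x y|j x].
- by rewrite /cuniv_fun !linearP.
- by rewrite /cuniv_fun !linearP.
rewrite -[cd (cinf X) i]/(cinf_d X i) cinf_d_inj /cuniv_fun !univ_inj.
exact: (hu j).2.
Qed.

Lemma cuniv_inj (Q : {set gT}) X (G2 : {group gT}) (Y : cpx k G2)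
    (u : nat -> forall i, X i -> Y i) (hu : forall n, cmap Q (u n)) i n x :
  cuniv_fun hu (inj n x) = u n i x.
Proof. exact: univ_inj. Qed.

Definition minfc (Q : {set gT}) X Y (u : forall i, X i -> Y i) (hu : cmap Q u) i :
  cinf X i -> cinf Y i := minf (hu.1 i).1.

Lemma minfc_cmap (Q : {set gT}) X Y (u : forall i, X i -> Y i) (hu : cmap Q u) :
  cmap Q (minfc hu).
Proof.
split=> [i|i]; first exact: minf_gmap.
apply: inf_ext => [a x y|a x y|j x].
- by rewrite /minfc !linearP.
- by rewrite /minfc !linearP.
rewrite -[cd (cinf X) i]/(cinf_d X i) -[cd (cinf Y) i]/(cinf_d Y i).
by rewrite cinf_d_inj /minfc !minf_inj hu.2.
Qed.

Lemma minfc_inj (Q : {set gT}) X Y (u : forall i, X i -> Y i) (hu : cmap Q u) i n x :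
  minfc hu (inj n x : cinf X i) = inj n (u i x).
Proof. exact: minf_inj. Qed.

Definition cinf_map X Y (f : chmap X Y) : chmap (cinf X) (cinf Y) :=
  mkchmap (minfc_cmap (cmap_chmap f)).

Lemma cinf_map_inj X Y (f : chmap X Y) i n x : cinf_map f i (inj n x) = inj n (f i x).
Proof. exact: minfc_inj. Qed.

Lemma cinf_ext X (A : lmodType k) i (f g : cinf X i -> A) : linear f -> linear g ->
  (forall n x, f (inj n x) = g (inj n x)) -> forall t, f t = g t.
Proof. exact: inf_ext. Qed.

Definition Inf : functor (CpxCat k G) (CpxCat k G).
Proof.
refine (@Functor (CpxCat k G) (CpxCat k G) cinf cinf_map _ _ _ _).
- move=> X Y f g e i; apply: cinf_ext => [a x y|a x y|n x]; rewrite ?linearP //.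
  by rewrite !cinf_map_inj e.
- move=> X i; apply: cinf_ext => [a x y|//|n x]; first by rewrite linearP.
  by rewrite cinf_map_inj.
- move=> X Y Z f g i; apply: cinf_ext => [a x y|a x y|n x]; rewrite ?linearP //.
  by rewrite cinf_map_inj -[RHS]/(cinf_map f i (cinf_map g i (inj n x))) !cinf_map_inj.
- move=> X Y f g i; apply: cinf_ext => [a x y|a x y|n x]; rewrite ?linearP //.
  rewrite cinf_map_inj -[RHS]/(cinf_map f i (inj n x) + cinf_map g i (inj n x)).
  by rewrite !cinf_map_inj -![inj n _]/(lin_of (@inj_linear k _ n) _) -linearD.
Defined.

Lemma cinf_zero X i : (forall x : X i, x = 0) -> forall t : cinf X i, t = 0.
Proof.
move=> h t; have [N ->] := inf_finite t; rewrite big1 // => n _.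
by rewrite (h (prj _ n t)) inj0.
Qed.

Lemma cinf_admissible c X : ~~ finite_terms c -> admissible c X -> admissible c (cinf X).
Proof.
move=> nf [fl bd]; split=> [ft|]; first by rewrite ft in nf.
case: (boundedness c) bd => //.
- by move=> [n h]; exists n => i ni; apply: cinf_zero; apply: h.
- by move=> [n h]; exists n => i ni; apply: cinf_zero; apply: h.
- by move=> [[n h] [n' h']]; split; [exists n | exists n'] => i ni;
    apply: cinf_zero; [apply: h | apply: h'].
Qed.

Lemma cinf_exact X : exact X -> exact (cinf X).
Proof.
move=> ex i t dt.
have [N et] := inf_finite t.
have h n : exists y, cd X i y = prj (X (i + 1)) n t.
  apply: ex; rewrite -(cprj_cmap X n).2 dt linear0 //.
have [y hy] := dchoice h.
exists (\sum_(n < N) inj n (y n)); rewrite linear_sum et.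
by apply: eq_bigr => n _; rewrite -[LHS]/(cinf_d X i _) cinf_d_inj hy.
Qed.

Lemma tinf_gmap (V M N : gmod k G) (u : ghom (gtens V M) (gtens V N)) :
  @gmap k gT G G G (gtens V (ginf M)) (gtens V (ginf N)) (tinf u).
Proof.
have inj_act L n g t : tens_map (act V g) (act (ginf L) g) (idt V (injl L n) t) =
    idt V (injl L n) (tens_map (act V g) (act L g) t).
  move: t; apply: tens_ext => [a x y|a x y|v x]; rewrite ?linearP //.
  by rewrite /idt !tens_map_gen; congr (tgen _ _); exact: ginf_act.
split=> [|q qG]; first exact: linearP.
apply: tinf_ext => [a x y|a x y|n t]; rewrite ?linearP //.
rewrite -[act (gtens V (ginf M)) q]/(tens_map (act V q) (act (ginf M) q)).
rewrite -[act (gtens V (ginf N)) q]/(tens_map (act V q) (act (ginf N) q)).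
rewrite inj_act !tinf_inj inj_act; congr (idt V _ _).
exact: (ghom_act u qG t).
Qed.

Lemma cinf_contractible (V : gmod k G) X :
  contractible (ctens V X) -> contractible (ctens V (cinf X)).
Proof.
move=> [h hh]; exists (fun i => mkhom (tinf_gmap (h i))) => i.
have di j n t : gtens_map V (cinf_d X j) (idt V (injl (X j) n) t) =
    idt V (injl (X (j + 1)) n) (gtens_map V (cd X j) t).
  change (idt V (cinf_d X j) (idt V (injl (X j) n) t) =
    idt V (injl (X (j + 1)) n) (idt V (cd X j) t)); rewrite !idt_comp.
  by apply: idt_ext => x; exact: cinf_d_inj.
apply: tinf_ext => [//|a x y|n t].
  by rewrite !linearP scalerDr addrACA.
rewrite -[cd (ctens V (cinf X)) _]/(gtens_map V (cinf_d X i)).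
rewrite -[cd (ctens V (cinf X)) _]/(gtens_map V (cinf_d X (i + 1))).
rewrite di -![mkhom _ _]/(tinf _ _) !tinf_inj di -linearD.
by congr (idt V _ _); exact: hh.
Qed.

(** Lifts are chosen on each copy and assembled by the universal property: a direct sum of
    relatively projective complexes is relatively projective. *)
Lemma cinf_lifts (P X Y Z : cpx k G) (f : chmap X Y) (g : chmap Y Z) :
  lifts P f g -> lifts (cinf P) f g.
Proof.
move=> [h1 h2]; have cp := cinj_cmap P.
pose rs W (v : chmap (cinf P) W) n : chmap P W :=
  mkchmap (cmap_comp (cmap_chmap v) (cp n)).
split=> [v gv|w].
  have hv n : exists u : chmap P X, forall i x, rs Y v n i x = f i (u i x).
    by apply: h1 => i x; apply: gv.
  have [u hu] := dchoice hv.
  exists (mkchmap (cuniv_cmap (fun n => cmap_chmap (u n)))) => i.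
  apply: cinf_ext => [a x y|a x y|n x]; rewrite ?linearP //.
  rewrite -[mkchmap _ _ _]/(cuniv_fun (fun n => cmap_chmap (u n)) (inj n x)) cuniv_inj.
  exact: hu.
have hw n : exists v : chmap P Y, forall i x, rs Z w n i x = g i (v i x) by apply: h2.
have [v hv] := dchoice hw.
exists (mkchmap (cuniv_cmap (fun n => cmap_chmap (v n)))) => i.
apply: cinf_ext => [a x y|a x y|n x]; rewrite ?linearP //.
rewrite -[mkchmap _ _ _]/(cuniv_fun (fun n => cmap_chmap (v n)) (inj n x)) cuniv_inj.
exact: hv.
Qed.

(** A trace is a finite sum of conjugates and so commutes with countable sums: infinitely many
    traces from P combine into a single trace from P. *)
Lemma cinf_trace (P : {group gT}) X Y (th : forall i, X i -> Y i) (ct : cmap P th) :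
  P \subset G -> forall i (f : X i -> Y i), linear f -> (forall x, f x = ctr P G th i x) ->
  forall (hf : linear f) t, (minf hf : ginf (X i) -> ginf (Y i)) t = ctr P G (minfc ct) i t.
Proof.
move=> sPG i f _ e hf; apply: cinf_ext => [a x y|a x y|n x]; first by rewrite linearP.
  have h := ctr_cmap (subxx G) (subxx G) sPG (minfc_cmap ct).
  by rewrite (gmapP (h.1 i)).
rewrite minf_inj e /ctr /tr -[inj n _]/(lin_of (@inj_linear k _ n) _) linear_sum.
apply: eq_bigr => C _.
rewrite /conjf -[act (cinf X i)]/(act (ginf (X i))) ginf_act minfc_inj; symmetry; exact: ginf_act.
Qed.
End InfiniteComplexes.

(** * Shifts on a countable sum in the homotopy categories *)

Section InfiniteSums.
Variables (k : comPzRingType) (gT : finGroupType) (c : choices).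
Variables (L : {group gT}) (V : gmod k L).
Hypothesis nf : ~~ finite_terms c.
Notation CCL := (CC c V).

Lemma Inf_adm : carries (Inf k L) (fun X => admissible c X) (fun X => admissible c X).
Proof. by move=> X; apply: cinf_admissible. Qed.
Definition InfB : functor (BC k c L) (BC k c L) := full_functor Inf_adm.
Lemma Inf_null : carries InfB (null_objects (c := c) V) (null_objects (c := c) V).
Proof.
move=> P /null_objectsP[nP h]; apply/null_objectsP; split=> // X Y Z f g aX aY aZ s.
by apply: cinf_lifts; apply: h.
Qed.
Definition InfC : functor CCL CCL := quot_functor Inf_null.

Lemma toc_Inf (X Y : CCL) (f : hom X Y) i t :
  toc (fmap InfC f) i t = cinf_map (toc f) i t.
Proof. by []. Qed.

Lemma Inf_J (U : {set {group gT}}) (X Y : CCL) (f : hom X Y) : (forall P, P \in U -> P \subset L) ->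
  J U f -> J U (fmap InfC f).
Proof.
move=> sU; elim=> {f} [P th f PU ct e||f g _ I1 _ I2|f g e _ I1].
- apply: (@J_tr k gT c L V U (InfC X) (InfC Y) P (minfc ct) _ PU (minfc_cmap ct)) => i t; rewrite toc_Inf.
  exact: (cinf_trace ct (sU _ PU) (gmap_ghom (toc f i)).1 (e i)).
- by apply: J_heq (J_zero _ _ _); rewrite fmap_zero.
- by apply: J_heq (J_add I1 I2); rewrite fmap_add.
- by apply: J_heq I1; apply: fmap_heq.
Qed.

Lemma Inf_acyclic (X : CCL) : acyclic X -> acyclic (InfC X).
Proof.
move=> [ex h]; split; first exact: cinf_exact.
by move=> /h; apply: cinf_contractible.
Qed.

Variable A : CCL.

Definition io : hom A (InfC A) :=
  @ofc k gT c L V A (InfC A) (mkchmap (cinj_cmap (cob A) 0)).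
Definition pr : hom (InfC A) A :=
  @ofc k gT c L V (InfC A) A (mkchmap (cprj_cmap (cob A) 0)).
Definition sg : hom (InfC A) (InfC A) :=
  @ofc k gT c L V (InfC A) (InfC A) (mkchmap (cuniv_cmap (fun n => cinj_cmap (cob A) n.+1))).

Lemma pred_cmap n : cmap L (fun i (x : cob A i) =>
  (if n is m.+1 then inj m x else 0) : cinf (cob A) i).
Proof.
case: n => [|n]; last exact: cinj_cmap.
split=> [i|i x]; last by rewrite linear0.
by split=> [a x y|q qL m]; rewrite ?scaler0 ?addr0 ?linear0.
Qed.
Definition sg' : hom (InfC A) (InfC A) :=
  @ofc k gT c L V (InfC A) (InfC A) (mkchmap (cuniv_cmap pred_cmap)).

Lemma io_inj i x : toc io i x = inj 0 x. Proof. by []. Qed.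
Lemma pr_inj i n x : toc pr i (inj n x) = if n == 0%N then x else 0.
Proof. exact: prj_inj. Qed.
Lemma sg_inj i n x : toc sg i (inj n x) = inj n.+1 x.
Proof. exact: (cuniv_inj (fun n => cinj_cmap (cob A) n.+1)). Qed.
Lemma sg'_inj i n x : toc sg' i (inj n x) = if n is m.+1 then inj m x else 0.
Proof. exact: (cuniv_inj pred_cmap). Qed.
Lemma Inf_inj (f : hom A A) i n x : toc (fmap InfC f) i (inj n x) = inj n (toc f i x).
Proof. exact: (cinf_map_inj (toc f)). Qed.

Lemma Inf_ext (Y : CCL) (f g : hom (InfC A) Y) :
  (forall i n x, toc f i (inj n x) = toc g i (inj n x)) -> f =h g.
Proof.
move=> e; apply: CC_ext => i; apply: cinf_ext => [a x y|a x y|n x].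
- exact: (gmapP (gmap_ghom (toc f i))).
- exact: (gmapP (gmap_ghom (toc g i))).
- exact: e.
Qed.

Lemma telescope_relations (e : hom A A) :
  [/\ pr \oc io =h hid A, sg' \oc sg =h hid _ & (sg \oc sg') +h (io \oc pr) =h hid _] /\
  [/\ fmap InfC e \oc sg =h sg \oc fmap InfC e, fmap InfC e \oc sg' =h sg' \oc fmap InfC e
    & fmap InfC e \oc io =h io \oc e].
Proof.
split; split.
- by apply: CC_ext => i x; rewrite toc_comp io_inj pr_inj.
- by apply: Inf_ext => i n x; rewrite toc_comp sg_inj sg'_inj toc_id.
- apply: Inf_ext => i n x; rewrite toc_add !toc_comp sg'_inj pr_inj toc_id io_inj.
  case: n => [|n]; first by rewrite linear0 add0r.
  by rewrite sg_inj inj0 addr0.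
- by apply: Inf_ext => i n x; rewrite !toc_comp Inf_inj !sg_inj Inf_inj.
- apply: Inf_ext => i [|n] x; rewrite !toc_comp Inf_inj !sg'_inj ?Inf_inj //.
  by rewrite linear0.
- by apply: CC_ext => i x; rewrite !toc_comp !io_inj Inf_inj.
Qed.
End InfiniteSums.

(** * Idempotents split modulo relatively projective objects *)

Section SplitIdempotents.
Variables (k : comPzRingType) (gT : finGroupType) (c : choices).
Variables (L : {group gT}) (V : gmod k L).
Notation CCL := (CC c V).
Notation AP := (@AProj k gT c L V).
Variables (T : triangulation CCL) (thA : thick T (@acyclic k gT c L V)).
Variables U U' : {set {group gT}}.
Hypothesis sU : forall P, P \in U -> P \subset L.
Hypothesis UU' : forall Q, Q \in U' -> exists2 P : {group gT}, P \in U & Q \subset P.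

Lemma factors_J (X Y : CCL) (f : hom X Y) : acyclic Y ->
  factors (AP U') f <-> J U' f.
Proof.
have sU' := sub_below sU UU'.
move=> aY; split.
  elim=> {f} [W a b [aW rW]||f g _ If _ Ig|f g e _ If].
  - by apply: J_through => //; apply: rel_projective_J.
  - exact: J_zero.
  - exact: J_add.
  - exact: J_heq If.
move=> /(J_factors sU'); elim=> {f} [W a b [P [sPL [PU eW]]]||f g _ If _ Ig|f g e _ If].
- by apply: factors_through; rewrite eW; apply: (AProj_IR T).
- exact: factors_zero.
- exact: factors_add.
- exact: factors_heq If.
Qed.

Lemma zero_AProj (A Z : CCL) : acyclic A -> is_zero Z -> AP U' Z.
Proof.
move=> aA Z0; split.
  apply: (thick_retract thA (i := hzero Z A) (p := hzero A Z)) aA.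
  by rewrite hcomp0r; symmetry.
apply: (J_rel_projective T (sub_below sU UU')).
by apply: J_heq (J_zero _ _ _); symmetry.
Qed.

(** By [fitting], e differs from an idempotent chain map by a left multiple of e^2 - e, hence by an
    element of the ideal. The image of that chain map exists on the level of complexes. *)
Lemma split_idempotent_finite (A : CCL) (e : hom A A) : finite_terms c -> AP U A ->
  J U' ((e \oc e) -h e) ->
  exists B (r : hom A B) (s : hom B A),
    [/\ AP U B, J U' ((r \oc s) -h hid B) & J U' ((s \oc r) -h e)].
Proof.
move=> ft aA Je.
have [p [th [pK hth]]] := fitting (toc e) ((cob_admissible A).1 ft).
have [B [r [s [aB rs sr]]]] := split_chain_idempotent pK (cob_admissible A).
pose B' := mkob V aB.
pose r' : hom A B' := @ofc k gT c L V A B' r.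
pose s' : hom B' A := @ofc k gT c L V B' A s.
have e1 : r' \oc s' =h hid B' by apply: CC_ext => i x; exact: rs.
exists B', r', s'; split.
- exact: (AProj_retract thA sU e1).
- by apply: J_heq (J_zero _ _ _); rewrite e1 haddNr.
have sU' := sub_below sU UU'.
have := J_opp sU' (J_compl (@ofc k gT c L V A A th) sU' Je).
apply: J_heq; apply: CC_ext => i x.
rewrite toc_opp toc_comp !toc_add !toc_opp !toc_comp ofcE -hth opprB.
by congr (_ - _); symmetry; exact: sr.
Qed.

(** The relations between shifts, e and the 0-th copy hold for chain maps. Idempotency holds modulo
    the ideal only, and [Inf_J] carries it from A to the countable sum. *)
Lemma split_idempotent_infinite (A : CCL) (e : hom A A) : ~~ finite_terms c -> AP U A ->
  J U' ((e \oc e) -h e) ->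
  exists B (r : hom A B) (s : hom B A),
    [/\ AP U B, J U' ((r \oc s) -h hid B) & J U' ((s \oc r) -h e)].
Proof.
move=> nf aA Je; have sU' := sub_below sU UU'.
pose S := InfC V nf A; have aS : AP U S.
  split; first exact: Inf_acyclic aA.1.
  apply: (J_rel_projective T sU).
  have := Inf_J nf sU (rel_projective_J sU aA.2).
  by apply: J_heq; rewrite fmap_id.
have ee := (factors_J _ aA.1).2 Je.
have EE : factors (AP U') ((fmap (InfC V nf) e \oc fmap (InfC V nf) e) -h fmap (InfC V nf) e).
  apply: (factors_J _ aS.1).2.
  have := Inf_J nf sU' Je; apply: J_heq.
  by rewrite fmap_add fmap_opp fmap_comp.
have [t1 t2] := telescope_relations nf e.
have Pr (X D : CCL) (i : hom X D) (p : hom D X) : p \oc i =h hid X -> AP U D -> AP U X.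
  exact: (AProj_retract thA sU).
have Pb (X Y D : CCL) : is_biproduct X Y D -> AP U X -> AP U Y -> AP U D.
  exact: (AProj_biproduct thA sU).
have Qb (X Y D : CCL) : is_biproduct X Y D -> AP U' X -> AP U' Y -> AP U' D.
  exact: (AProj_biproduct thA sU').
have QP (X : CCL) : AP U' X -> AP U X by exact: AProj_mono.
have Qz (Z : CCL) : is_zero Z -> AP U' Z by exact: zero_AProj aA.1.
have [B [r [s [aB rs sr]]]] := telescope_split T Pr Pb Qb QP Qz aA aS t1 t2 ee EE.
exists B, r, s; split=> //; first exact: (factors_J _ aB.1).1.
exact: (factors_J _ aA.1).1.
Qed.

Lemma AStab_idempotents_split : idempotents_split (AStab c V U U').
Proof.
move=> A e ee; have aA := aob_AProj A.
have Je : J U' ((toa e \oc toa e) -h toa e).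
  have := (AStab_heqP T sU UU' (e \oc e) e).1 ee; rewrite toa_comp; exact.
have [B [r [s [aB rs sr]]]] : exists B (r : hom (aob A) B) (s : hom B (aob A)),
    [/\ AP U B, J U' ((r \oc s) -h hid B) & J U' ((s \oc r) -h toa e)].
  have [ft|nf] := boolP (finite_terms c); first exact: split_idempotent_finite.
  exact: split_idempotent_infinite.
pose B' : AStab c V U U' := mka U' aB.
exists B', (ofa (Y := B') r), (ofa (X := B') s); split.
  apply: (AStab_heqP T sU UU' _ _).2; rewrite toa_comp toa_id !ofaK; exact: rs.
apply: (AStab_heqP T sU UU' _ _).2; rewrite toa_comp (ofaK (Y := B') r) (ofaK (X := B') s); exact: sr.
Qed.
End SplitIdempotents.

Section StableFunctor.
Variables (C D : pcat) (P Q : C -> Prop) (P' Q' : D -> Prop) (F : functor C D).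
Variables (h3 : carries F P P')
  (h4 : carries (full_functor h3) (fun X => Q (sval X)) (fun X => Q' (sval X))).

Lemma stable_functor_map (X Y : quot (fun X : full P => Q (sval X))) (f : hom X Y) :
  qfh (fmap (quot_functor h4) f) = fmap F (qfh f).
Proof. by []. Qed.
End StableFunctor.

(** * Conjugates and intersections of the subgroups in P, X and Y *)

Section Subgroups.
Variables (gT : finGroupType) (G H : {group gT}) (sHG : H \subset G).
Variable PP : {set {group gT}}.
Hypothesis sPPH : forall P : {group gT}, P \in PP -> P \subset H.
Notation XX := (collX G H PP).
Notation YY := (collY G H PP).

Lemma collXP (Q : {group gT}) : Q \in XX -> exists (P1 P2 : {group gT}) g,
  [/\ P1 \in PP, P2 \in PP, g \in G, g \notin H & (Q : {set gT}) = (P1 :^ g^-1)%g :&: P2].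
Proof.
rewrite inE => /existsP[P1 /andP[h1 /existsP[P2 /andP[h2 /existsP[g /andP[]]]]]].
rewrite inE => /andP[gH gG] /eqP ->.
by exists P1, P2, g.
Qed.

Lemma collX_in (P1 P2 : {group gT}) g : P1 \in PP -> P2 \in PP -> g \in G -> g \notin H ->
  ((P1 :^ g^-1) :&: P2)%G \in XX.
Proof.
move=> h1 h2 gG gH; rewrite inE; apply/existsP; exists P1; rewrite h1.
apply/existsP; exists P2; rewrite h2; apply/existsP; exists g.
by rewrite inE gH gG /=.
Qed.

Lemma collYP (Q : {group gT}) : Q \in YY -> exists (P : {group gT}) g,
  [/\ P \in PP, g \in G, g \notin H & (Q : {set gT}) = (P :^ g^-1)%g :&: H].
Proof.
rewrite inE => /existsP[P /andP[h1 /existsP[g /andP[]]]].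
rewrite inE => /andP[gH gG] /eqP ->.
by exists P, g.
Qed.

Lemma collY_in (P : {group gT}) g : P \in PP -> g \in G -> g \notin H ->
  ((P :^ g^-1) :&: H)%G \in YY.
Proof.
move=> h1 gG gH; rewrite inE; apply/existsP; exists P; rewrite h1.
by apply/existsP; exists g; rewrite inE gH gG /=.
Qed.

Lemma collX_below Q : Q \in XX -> exists2 P : {group gT}, P \in PP & Q \subset P.
Proof.
by move=> /collXP[P1 [P2 [g [_ h2 _ _ ->]]]]; exists P2 => //; apply: subsetIr.
Qed.

Lemma collX_subH Q : Q \in XX -> Q \subset H.
Proof. by move=> /collX_below[P /sPPH sPH sQP]; apply: subset_trans sPH. Qed.

Lemma collY_subH Q : Q \in YY -> Q \subset H.
Proof. by move=> /collYP[P [g [_ _ _ ->]]]; apply: subsetIr. Qed.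

Lemma collX_collY Q : Q \in XX -> exists2 P : {group gT}, P \in YY & Q \subset P.
Proof.
move=> /collXP[P1 [P2 [g [h1 h2 gG gH ->]]]].
exists ((P1 :^ g^-1) :&: H)%G; first exact: collY_in.
by apply: setIS; apply: sPPH.
Qed.

Lemma subU P : P \in PP :|: YY -> P \subset H.
Proof. by rewrite inE => /orP[/sPPH|/collY_subH]. Qed.

(** Conjugating gP_1g^-1 by h in H replaces g by hg, which is still outside H; cutting with P gives
    a subgroup of a member of X. This is the input for J_Y J_P <= J_X. *)
Lemma collY_mul (Q P : {group gT}) h : Q \in YY -> P \in PP -> h \in H ->
  exists2 R : {group gT}, R \in XX & (Q :^ h^-1)%g :&: P \subset R.
Proof.
move=> /collYP[P1 [g [h1 gG gH ->]]] PP' hH.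
have hgG : (h * g)%g \in G by rewrite groupM // (subsetP sHG).
have hgH : (h * g)%g \notin H by rewrite groupMl.
exists ((P1 :^ (h * g)^-1) :&: P)%G; first exact: collX_in.
by apply: setSI; rewrite /= conjIg invMg conjsgM subsetIl.
Qed.

Lemma repr_dcoset_notin (Q : {group gT}) D : Q \subset H -> D \in dcosets H Q G ->
  D != H -> repr D \notin H.
Proof.
move=> sQH DD; apply: contra => DH.
have [_ <-] := dcosets_repr sHG (subset_trans sQH sHG) DD.
by rewrite mulgA rcoset_id // mulGSid.
Qed.

Lemma PP_collY (Q : {group gT}) D : Q \in PP -> D \in dcosets H Q G -> D != H ->
  exists2 P : {group gT}, P \in YY & (Q :^ (repr D)^-1)%g :&: H \subset P.
Proof.
move=> QP DD DH; have sQH := sPPH QP.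
have [DG _] := dcosets_repr sHG (subset_trans sQH sHG) DD.
exists ((Q :^ (repr D)^-1) :&: H)%G => //.
by apply: collY_in => //; exact: (repr_dcoset_notin sQH DD DH).
Qed.

Lemma PP_PPcollY (Q : {group gT}) D : Q \in PP -> D \in dcosets H Q G ->
  exists2 P : {group gT}, P \in PP :|: YY & (Q :^ (repr D)^-1)%g :&: H \subset P.
Proof.
move=> QP DD; have [->|DH] := eqVneq D H.
  exists Q; first by rewrite inE QP.
  by rewrite repr_group invg1 conjsg1 subsetIl.
by have [P PY sP] := PP_collY QP DD DH; exists P => //; rewrite inE PY orbT.
Qed.

(** Let d be the double coset representative and Q the intersection of gP_1g^-1 with P_2. If d lies
    in H then dg is outside H and P_1 is used; otherwise d itself is outside H and P_2 is used. *)
Lemma XX_collY (Q : {group gT}) D : Q \in XX -> D \in dcosets H Q G ->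
  exists2 P : {group gT}, P \in YY & (Q :^ (repr D)^-1)%g :&: H \subset P.
Proof.
move=> QX DD; have sQH := collX_subH QX.
have [DG _] := dcosets_repr sHG (subset_trans sQH sHG) DD.
have [P1 [P2 [g [h1 h2 gG gH eQ]]]] := collXP QX.
have [DH|DH] := boolP (repr D \in H).
  exists ((P1 :^ (repr D * g)^-1) :&: H)%G.
    by apply: collY_in => //; [exact: groupM | rewrite groupMl].
  by apply: setSI; rewrite /= eQ conjIg invMg conjsgM subsetIl.
exists ((P2 :^ (repr D)^-1) :&: H)%G; first exact: collY_in.
by apply: setSI; rewrite /= eQ conjIg subsetIr.
Qed.
End Subgroups.

(** * Full faithfulness and density up to retracts *)

Section Correspondence.
Variables (k : comPzRingType) (gT : finGroupType) (c : choices).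
Variables (G H : {group gT}) (sHG : H \subset G) (V : gmod k G).
Variable PP : {set {group gT}}.
Hypothesis sPPH : forall P : {group gT}, P \in PP -> P \subset H.
Let VH := gres sHG V.
Notation XX := (collX G H PP).
Notation YY := (collY G H PP).
Notation CG := (CC c V).
Notation CH := (CC c VH).
Notation IndC := (IndC c sHG V).
Notation ResC := (ResC c sHG V).
Notation unitC := (@unitC k gT c G H sHG V).
Notation projC := (@projC k gT c G H sHG V).
Notation counitC := (@counitC k gT c G H sHG V).
Notation APG := (@AProj k gT c G V).
Notation APH := (@AProj k gT c H VH).
Variable TG : triangulation CG.
Variables (TH : triangulation CH) (thH : thick TH (@acyclic k gT c H VH)).

Let sXXH Q : Q \in XX -> Q \subset H := collX_subH sPPH (Q := Q).
Let sYYH Q : Q \in YY -> Q \subset H := @collY_subH gT G H PP Q.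
Let sUH Q : Q \in PP :|: YY -> Q \subset H := subU sPPH (P := Q).
Let sPPG P : P \in PP -> P \subset G.
Proof. by move=> /sPPH h; apply: subset_trans sHG. Qed.
Let sXXG P : P \in XX -> P \subset G.
Proof. by move=> /sXXH h; apply: subset_trans sHG. Qed.

Lemma acyclic_Ind (A : CH) : acyclic A -> acyclic (IndC A).
Proof.
move=> [ex h]; split; first exact: exact_cind.
by move=> /h; apply: contractible_cind.
Qed.

Lemma acyclic_Res (X : CG) : acyclic X -> acyclic (ResC X).
Proof. by move=> [ex h]; split=> // /h; apply: contractible_cres. Qed.

Lemma AProj_Ind (U : {set {group gT}}) (A : CH) : (forall P : {group gT}, P \in U -> P \subset H) ->
  APH U A -> APG U (IndC A).
Proof.
move=> sU [aA rA]; split; first exact: acyclic_Ind.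
apply: (J_rel_projective TG); first by move=> P /sU h; apply: subset_trans sHG.
have := J_Ind sU (rel_projective_J sU rA); apply: J_heq; exact: fmap_id.
Qed.

Lemma AProj_Res (U W : {set {group gT}}) (X : CG) : (forall P : {group gT}, P \in U -> P \subset G) ->
  (forall P : {group gT}, P \in W -> P \subset H) ->
  (forall (Q : {group gT}) (D : {set gT}), Q \in U -> D \in dcosets H Q G ->
     exists2 P : {group gT}, P \in W & (Q :^ (repr D)^-1)%g :&: H \subset P) ->
  APG U X -> APH W (ResC X).
Proof.
move=> sU sW h [aX rX]; split; first exact: acyclic_Res.
apply: (J_rel_projective TH sW).
have := J_Res sHG sU sW h (rel_projective_J sU rX); apply: J_heq; exact: fmap_id.
Qed.

(** f is f times the identity of A, which lies in J_P, so f belongs to J_Y J_P. *)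
Lemma J_YY_XX (A B : CH) (f : hom A B) : APH PP A -> J YY f -> J XX f.
Proof.
move=> [_ rA] Jf; apply: (J_heq (hcomp1r f)).
apply: (J_mul sYYH sPPH sXXH _ Jf (rel_projective_J sPPH rA)) => Q P h.
exact: collY_mul.
Qed.

Lemma ResInd_J (A : CH) : APH PP A ->
  J YY (hid (ResC (IndC A)) -h (unitC A \oc projC A)).
Proof.
move=> [_ rA].
have := unit_proj_J sPPH sYYH (PP_collY sHG sPPH (PP := PP)) (rel_projective_J sPPH rA).
apply: J_heq; rewrite hcomp1l; apply: hadd_heq; last exact: heq_refl.
by rewrite !fmap_id.
Qed.

Lemma J_adjoint (A : CH) (X : CG) (f : hom (IndC A) X) : APH PP A ->
  J YY (fmap ResC f \oc unitC A) -> J XX f.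
Proof.
move=> aA Jf; apply: (J_heq (heq_sym (adjoint_factor f))).
apply: (J_compl _ sXXG); apply: (J_Ind sXXH); exact: J_YY_XX.
Qed.

(** Restricting Ind f gives an element of J_Y, from which f is recovered by composing with the unit
    of A and the projection onto B; then [J_YY_XX] improves J_Y to J_X. *)
Lemma Ind_faithful (A B : CH) (f : hom A B) : APH PP A -> J XX (fmap IndC f) -> J XX f.
Proof.
move=> aA /(J_Res sHG sXXG sYYH (XX_collY sHG sPPH (PP := PP))) Jf.
apply: J_YY_XX => //.
have := J_compl (projC B) sYYH (J_compr (unitC A) sYYH Jf).
apply: J_heq; rewrite unitC_nat hcompA projC_unitC hcomp1l; reflexivity.
Qed.

Lemma Ind_full (A B : CH) (g : hom (IndC A) (IndC B)) : APH PP A -> APH PP B ->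
  exists f : hom A B, J XX (fmap IndC f -h g).
Proof.
move=> aA aB.
(* By Mackey, up to J YY the morphism u lands in the summand B of Res Ind B. *)
pose u := fmap ResC g \oc unitC A.
exists (projC B \oc u).
apply: J_adjoint => //.
have := J_opp sYYH (J_compr u sYYH (ResInd_J aB)).
apply: J_heq.
have e1 : fmap ResC (fmap IndC (projC B \oc u) -h g) \oc unitC A =h
    (unitC B \oc (projC B \oc u)) -h u.
  by rewrite fmap_add fmap_opp hcompDl hcompNl unitC_nat.
rewrite e1 hcompDl hcomp1l hcompNl hcompA hoppD hoppK haddC.
reflexivity.
Qed.

Lemma tunit_cmap (X : CG) : @cmap k gT G G G (cob X) (cob (IndC (ResC X)))
  (ctr H G (fun i (x : cob X i) => @ind_unit k gT H G (cob (ResC X) i) x : cob (IndC (ResC X)) i)).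
Proof.
apply: ctr_cmap => //; have [h1 h2] := cind_unit_cmap sHG (cob (ResC X)).
by split=> // i; have [g1 g2] := h1 i.
Qed.
Definition tunitC (X : CG) : hom X (IndC (ResC X)) :=
  @ofc k gT c G V X (IndC (ResC X)) (mkchmap (tunit_cmap X)).

Lemma trace_factor (X Y : CG) (phi : hom (ResC X) (ResC Y)) i x :
  toc (counitC Y \oc (fmap IndC phi \oc tunitC X)) i x =
  tr H G (fun x : cob X i => toc phi i x : cob Y i) x.
Proof.
rewrite toc_comp.
rewrite -[LHS]/(tr H G (fun t => ind_proj (t : gind G (cob (ResC Y) i)) : cob Y i) _).
rewrite (tr_compr sHG _ _ (gmap_ghom (toc (fmap IndC phi \oc tunitC X) i))).
apply: tr_ext => s; rewrite toc_comp.
transitivity (toc phi i (ind_proj (toc (tunitC X) i s : gind G (cob (ResC X) i)))).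
  exact: (proj_gind_map (toc phi i) (toc (tunitC X) i s)).
congr (toc phi i _).
exact: (@proj_tr_unit k gT H G sHG (cob (ResC X) i) G (cob X i) (fun x => x)).
Qed.

(** Traces from P to G pass through H, and a trace from H factors through Ind Res Y by
    [trace_factor]. The morphism over H in the middle remains in the ideal. *)
Lemma J_trace (U : {set {group gT}}) (X Y : CG) (f : hom X Y) :
  (forall P, P \in U -> P \subset H) -> J U f ->
  exists phi : hom (ResC X) (ResC Y), J U phi /\
    f =h counitC Y \oc (fmap IndC phi \oc tunitC X).
Proof.
move=> sU; elim=> {f} [P th f PU ct e||f g _ [u [Ju eu]] _ [v [Jv ev]]|f g e _ [u [Ju eu]]].
- have sPH := sU _ PU.
  have ctH : @cmap k gT P H H (cob (ResC X)) (cob (ResC Y)) th.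
    by have [h1 h2] := ct; split=> // i; have [g1 g2] := h1 i.
  pose ph : hom (ResC X) (ResC Y) := @ofc k gT c H VH (ResC X) (ResC Y)
    (mkchmap (ctr_cmap (subxx H) (subxx H) sPH ctH)).
  exists ph; split; first exact: (J_tr PU ctH).
  apply: CC_ext => i x; rewrite trace_factor e /ctr.
  by rewrite -(tr_trans (subxx G) (subxx G) _ sPH sHG (ct.1 i)).
- exists (hzero _ _); split; first exact: J_zero.
  by rewrite fmap_zero hcomp0l hcomp0r.
- exists (u +h v); split; first exact: J_add.
  by rewrite fmap_add hcompDl hcompDr eu ev.
- by exists u; split=> //; rewrite -e.
Qed.

Lemma J_union (U W : {set {group gT}}) (X Y : CH) (f : hom X Y) : J (U :|: W) f ->
  exists f1 f2, [/\ J U f1, J W f2 & f =h f1 +h f2].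
Proof.
elim=> {f} [P th f PU ct e||f g _ [f1 [f2 [J1 J2 ef]]] _ [g1 [g2 [J1' J2' eg]]]|f g e _ [f1 [f2 [J1 J2 ef]]]].
- move: PU; rewrite inE => /orP[PU|PW].
    exists f, (hzero _ _); split; [exact: J_tr PU ct e | exact: J_zero | exact: heq_sym (hadd0r f)].
  exists (hzero _ _), f; split; [exact: J_zero | exact: J_tr PW ct e | exact: heq_sym (hadd0 f)].
- exists (hzero _ _), (hzero _ _); split; [exact: J_zero | exact: J_zero | exact: heq_sym (hadd0 _)].
- exists (f1 +h g1), (f2 +h g2); split; [exact: J_add | exact: J_add |].
  exact: heq_trans (hadd_heq ef eg) (haddACA _ _ _ _).
- by exists f1, f2; split=> //; exact: heq_trans (heq_sym e) ef.
Qed.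

Lemma PP_through (X Y : CH) (f : hom X Y) : acyclic Y -> J PP f ->
  exists A (a : hom X A) (b : hom A Y), APH PP A /\ f =h b \oc a.
Proof.
move=> aY Jf.
have same (Q : {group gT}) : Q \in PP -> exists2 P : {group gT}, P \in PP & Q \subset P.
  by exists Q.
have bip (X' Y' D : CH) : is_biproduct X' Y' D -> APH PP X' -> APH PP Y' -> APH PP D.
  exact: (AProj_biproduct thH sPPH).
have zero (Z : CH) : is_zero Z -> APH PP Z by exact: (zero_AProj thH sPPH same aY).
exact: (factors_one TH bip zero ((factors_J TH sPPH same f aY).2 Jf)).
Qed.

(** X is a retract of Ind Res X, but Res X need not be P-projective. The middle morphism from
    [J_trace] lies in J_P and factors through a P-projective A, which takes the place of Res X. *)
Lemma Ind_retract (X : CG) : APG PP X -> exists A : CH, APH PP A /\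
  exists (a : hom X (IndC A)) (b : hom (IndC A) X), b \oc a =h hid X.
Proof.
move=> [aX rX].
have [phi [Jphi e]] := J_trace sPPH (rel_projective_J sPPG rX).
have [A [a [b [aA ephi]]]] := PP_through (acyclic_Res aX) Jphi.
exists A; split=> //; exists (fmap IndC a \oc tunitC X), (counitC X \oc fmap IndC b).
by rewrite e ephi fmap_comp !hcompA.
Qed.

(** The identity of X is a sum of a morphism in J_P and one in J_Y. The first factors through a
    P-projective object, the second is the error. *)
Lemma J_retract_PP (X : CH) : APH (PP :|: YY) X -> exists A : CH, APH PP A /\
  exists (a : hom X A) (b : hom A X), J YY ((b \oc a) -h hid X).
Proof.
move=> [aX rX].
have [f1 [f2 [J1 J2 e]]] := J_union (rel_projective_J sUH rX).
have [A [a [b [aA e1]]]] := PP_through aX J1.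
exists A; split=> //; exists a, b; have := J_opp sYYH J2; apply: J_heq.
by rewrite -e1 e hoppD haddA haddNr hadd0.
Qed.
End Correspondence.

(** * Functors between stable categories, tested on ideals *)

Section StableFunctors.
Variables (C D : pcat) (P Q : C -> Prop) (P' Q' : D -> Prop) (F : functor C D).
Variables (h3 : carries F P P')
  (h4 : carries (full_functor h3) (fun X => Q (sval X)) (fun X => Q' (sval X))).
Variables (IC : forall A B : C, hom A B -> Prop) (ID : forall A B : D, hom A B -> Prop).

Definition stable_ideal (E : pcat) (S S' : E -> Prop) (I : forall A B : E, hom A B -> Prop) :=
  forall (X Y : quot (fun W : full S => S' (sval W))) (f g : hom X Y),
    f =h g <-> I _ _ (qfh f -h qfh g).

Hypothesis idealC : stable_ideal P Q IC.
Hypothesis idealD : stable_ideal P' Q' ID.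
Hypothesis ID_heq : forall (A B : D) (f g : hom A B), f =h g -> ID f -> ID g.

Lemma stable_fully_faithful :
  (forall (A B : C) (f : hom A B), P A -> ID (fmap F f) -> IC f) ->
  (forall (A B : C) (g : hom (F A) (F B)), P A -> P B ->
     exists f : hom A B, ID (fmap F f -h g)) ->
  fully_faithful (quot_functor h4).
Proof.
move=> faith full; split=> [X Y f g /idealD e|X Y g].
  apply/idealC; apply: faith; first exact: qfo_prop.
  by apply: ID_heq e; rewrite !stable_functor_map fmap_add fmap_opp.
have [f hf] := full _ _ (qfh g) (qfo_prop X) (qfo_prop Y).
by exists (hqf f); apply/idealD; rewrite stable_functor_map hqfK.
Qed.

Lemma stable_retract (Y : quot (fun W : full P' => Q' (sval W))) :
  (exists A, P A /\ exists (a : hom (qfo Y) (F A)) (b : hom (F A) (qfo Y)),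
     ID ((b \oc a) -h hid _)) ->
  exists (X : quot (fun W : full P => Q (sval W)))
    (a : hom Y (quot_functor h4 X)) (b : hom (quot_functor h4 X) Y), b \oc a =h hid Y.
Proof.
move=> [A [PA [a [b e]]]].
pose X : quot (fun W : full P => Q (sval W)) := exist _ A PA.
exists X, (hqf (Y := quot_functor h4 X) a), (hqf (X := quot_functor h4 X) b).
apply/idealD; rewrite qfh_comp (hqfK (Y := quot_functor h4 X) a).
by rewrite (hqfK (X := quot_functor h4 X) b).
Qed.
End StableFunctors.

Section StableIsomorphism.
Variables (C D E : pcat) (P Q : C -> Prop) (P' Q' : D -> Prop) (P'' Q'' : E -> Prop).
Variables (F : functor C D) (G : functor D E) (K : functor C E).
Variables (f3 : carries F P P') (g3 : carries G P' P'') (k3 : carries K P P'').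
Variables
  (f4 : carries (full_functor f3) (fun X => Q (sval X)) (fun X => Q' (sval X)))
  (g4 : carries (full_functor g3) (fun X => Q' (sval X)) (fun X => Q'' (sval X)))
  (k4 : carries (full_functor k3) (fun X => Q (sval X)) (fun X => Q'' (sval X))).
Variable IE : forall A B : E, hom A B -> Prop.
Hypothesis idealE : stable_ideal P'' Q'' IE.
Hypothesis IE0 : forall (A B : E) (f : hom A B), f =h hzero A B -> IE f.

Lemma stable_nat_iso (a : forall A : C, hom (G (F A)) (K A)) (b : forall A, hom (K A) (G (F A))) :
  (forall A, P A -> IE ((b A \oc a A) -h hid _)) ->
  (forall A, a A \oc b A =h hid _) ->
  (forall A B (f : hom A B), a B \oc fmap G (fmap F f) =h fmap K f \oc a A) ->
  nat_iso (fcomp (quot_functor g4) (quot_functor f4)) (quot_functor k4).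
Proof.
move=> ba ab nat.
pose H1 := fcomp (quot_functor g4) (quot_functor f4); pose H2 := quot_functor k4.
pose a' (X : quot (fun W : full P => Q (sval W))) : hom (H1 X) (H2 X) :=
  hqf (X := H1 X) (Y := H2 X) (a (qfo X)).
pose b' (X : quot (fun W : full P => Q (sval W))) : hom (H2 X) (H1 X) :=
  hqf (X := H2 X) (Y := H1 X) (b (qfo X)).
have a'E X : qfh (a' X) = a (qfo X) by exact: hqfK.
have b'E X : qfh (b' X) = b (qfo X) by exact: hqfK.
exists a', b'; split=> [X|X|X Y f].
- apply/idealE; rewrite qfh_comp a'E b'E; exact: ba (qfo_prop X).
- apply/idealE; rewrite qfh_comp a'E b'E; apply: IE0.
  by rewrite ab; exact: haddNr.
apply/idealE; rewrite !qfh_comp !a'E; apply: IE0.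
have e1 : qfh (fmap H1 f) = fmap G (fmap F (qfh f)) by [].
have e2 : qfh (fmap H2 f) = fmap K (qfh f) by [].
by rewrite e1 e2 nat; exact: haddNr.
Qed.
End StableIsomorphism.

(** * The functor induced by the identity on complexes *)

Section IdentityFunctor.
Variables (k : comPzRingType) (gT : finGroupType) (c : choices).
Variables (H : {group gT}) (V : gmod k H).

Lemma id_adm : carries (fid (CpxCat k H)) (fun X => admissible c X) (fun X => admissible c X).
Proof. by []. Qed.
Definition IdB : functor (BC k c H) (BC k c H) := full_functor id_adm.

(** [full_functor] rebuilds the proof of admissibility, so objects are fixed by proof irrelevance
    and not by computation. Hence the comparison maps [id_in] and [id_out]. *)
Lemma IdB_ob (A : BC k c H) : IdB A = A.
Proof. by case: A => x h; apply: eq_exist. Qed.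

Lemma id_null : carries IdB (null_objects (c := c) V) (null_objects (c := c) V).
Proof. by move=> A; rewrite IdB_ob. Qed.
Definition IdC : functor (CC c V) (CC c V) := quot_functor id_null.

Lemma IdC_ob (A : CC c V) : IdC A = A. Proof. exact: IdB_ob. Qed.

Definition id_in (A : CC c V) : hom A (IdC A) := @ofc k gT c H V A (IdC A) (cm_id (cob A)).
Definition id_out (A : CC c V) : hom (IdC A) A := @ofc k gT c H V (IdC A) A (cm_id (cob A)).

Lemma id_inK (A : CC c V) : id_out A \oc id_in A =h hid A.
Proof. by apply: CC_ext => i x; rewrite toc_comp. Qed.
Lemma id_outK (A : CC c V) : id_in A \oc id_out A =h hid (IdC A).
Proof. by apply: CC_ext => i x; rewrite toc_comp. Qed.
Lemma id_in_nat (A B : CC c V) (f : hom A B) : id_in B \oc f =h fmap IdC f \oc id_in A.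
Proof. by apply: CC_ext => i x; rewrite !toc_comp. Qed.
End IdentityFunctor.

(** * The three functors on stable categories and their triangle *)

Section CorrespondenceFunctors.
Variables (k : comPzRingType) (gT : finGroupType) (c : choices).
Variables (G H : {group gT}) (sHG : H \subset G) (V : gmod k G).
Variable PP : {set {group gT}}.
Hypothesis sPPH : forall P : {group gT}, P \in PP -> P \subset H.
Let VH := gres sHG V.
Notation XX := (collX G H PP).
Notation YY := (collY G H PP).
Notation CG := (CC c V).
Notation CH := (CC c VH).
Notation IndC := (IndC c sHG V).
Notation ResC := (ResC c sHG V).
Notation IdC := (@IdC k gT c H VH).
Notation unitC := (@unitC k gT c G H sHG V).
Notation projC := (@projC k gT c G H sHG V).
Notation APG := (@AProj k gT c G V).
Notation APH := (@AProj k gT c H VH).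
Notation JH := (@J k gT c H VH).
Notation JG := (@J k gT c G V).
Variable TG : triangulation CG.
Variables (TH : triangulation CH) (thH : thick TH (@acyclic k gT c H VH)).

Let sXXH Q : Q \in XX -> Q \subset H := collX_subH sPPH (Q := Q).
Let sYYH Q : Q \in YY -> Q \subset H := @collY_subH gT G H PP Q.
Let sUH Q : Q \in PP :|: YY -> Q \subset H := subU sPPH (P := Q).
Let sPPG P : P \in PP -> P \subset G.
Proof. by move=> /sPPH h; apply: subset_trans sHG. Qed.
Let sXXG P : P \in XX -> P \subset G.
Proof. by move=> /sXXH h; apply: subset_trans sHG. Qed.
Let YYU Q : Q \in YY -> exists2 P : {group gT}, P \in PP :|: YY & Q \subset P.
Proof. by move=> QY; exists Q; rewrite // inE QY orbT. Qed.
Let PPU Q : Q \in PP -> exists2 P : {group gT}, P \in PP :|: YY & Q \subset P.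
Proof. by move=> QP; exists Q; rewrite // inE QP. Qed.
Let XXP Q : Q \in XX -> exists2 P : {group gT}, P \in PP & Q \subset P.
Proof. exact: collX_below. Qed.

Lemma Ind_carries : carries IndC (APH PP) (APG PP).
Proof. by move=> A; exact: (AProj_Ind TG sPPH (A := A)). Qed.
Lemma Ind_stable_carries : carries (full_functor Ind_carries)
  (fun X => APH XX (sval X)) (fun X => APG XX (sval X)).
Proof. by move=> A; exact: (AProj_Ind TG sXXH (A := sval A)). Qed.
Definition IndS : functor (AStab c VH PP XX) (AStab c V PP XX) :=
  quot_functor Ind_stable_carries.

(** The trivial double coset contributes a trace from a member of P, the others contribute traces
    from members of Y; this is why the target is enlarged to the union. *)
Lemma Res_carries : carries ResC (APG PP) (APH (PP :|: YY)).
Proof. by move=> X; exact: (AProj_Res TH sPPG sUH (PP_PPcollY sHG sPPH (PP := PP)) (X := X)). Qed.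
Lemma Res_stable_carries : carries (full_functor Res_carries)
  (fun X => APG XX (sval X)) (fun X => APH YY (sval X)).
Proof. by move=> X; exact: (AProj_Res TH sXXG sYYH (XX_collY sHG sPPH (PP := PP)) (X := sval X)). Qed.
Definition ResS : functor (AStab c V PP XX) (AStab c VH (PP :|: YY) YY) :=
  quot_functor Res_stable_carries.

Lemma Id_carries : carries IdC (APH PP) (APH (PP :|: YY)).
Proof. by move=> A; rewrite IdC_ob; exact: (AProj_mono TH sUH PPU). Qed.
Lemma Id_stable_carries : carries (full_functor Id_carries)
  (fun X => APH XX (sval X)) (fun X => APH YY (sval X)).
Proof.
move=> A AX; change (APH YY (IdC (sval A))); rewrite IdC_ob.
exact: (AProj_mono TH sYYH (collX_collY sPPH (PP := PP)) AX).
Qed.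
Definition IdS : functor (AStab c VH PP XX) (AStab c VH (PP :|: YY) YY) :=
  quot_functor Id_stable_carries.

Let idealHX : stable_ideal (APH PP) (APH XX) (JH XX) := AStab_heqP TH sPPH XXP.
Let idealHY : stable_ideal (APH (PP :|: YY)) (APH YY) (JH YY) := AStab_heqP TH sUH YYU.
Let idealG : stable_ideal (APG PP) (APG XX) (JG XX) := AStab_heqP TG sPPG XXP.

Lemma IndS_ff : fully_faithful IndS.
Proof.
have h1 (A B : CH) (f : hom A B) : APH PP A -> JG XX (fmap IndC f) -> JH XX f.
  exact: Ind_faithful.
have h2 (A B : CH) (g : hom (IndC A) (IndC B)) : APH PP A -> APH PP B ->
  exists f : hom A B, JG XX (fmap IndC f -h g) by exact: Ind_full.
exact (@stable_fully_faithful CH CG (APH PP) (APH XX) (APG PP) (APG XX) IndC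
  Ind_carries Ind_stable_carries (JH XX) (JG XX) idealHX idealG (@J_heq k gT c G V XX) h1 h2).
Qed.

Lemma IndS_retract (Y : AStab c V PP XX) :
  exists X (a : hom Y (IndS X)) (b : hom (IndS X) Y), b \oc a =h hid Y.
Proof.
have h : exists A, APH PP A /\ exists (a : hom (aob Y) (IndC A)) (b : hom (IndC A) (aob Y)),
    JG XX ((b \oc a) -h hid (aob Y)).
  have [A [aA [a [b e]]]] := Ind_retract sPPH thH (aob_AProj Y).
  exists A; split=> //; exists a, b; apply: (J_heq _ (J_zero XX (aob Y) (aob Y))).
  by rewrite e haddNr; reflexivity.
exact (@stable_retract CH CG (APH PP) (APH XX) (APG PP) (APG XX) IndC
  Ind_carries Ind_stable_carries (JG XX) idealG Y h).
Qed.

Lemma IndS_equivalence : is_equivalence IndS.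
Proof.
exact: (ff_retract_equivalence IndS_ff (AStab_idempotents_split thH sPPH XXP) IndS_retract).
Qed.

Lemma IdS_ff : fully_faithful IdS.
Proof.
have h1 (A B : CH) (f : hom A B) : APH PP A -> JH YY (fmap IdC f) -> JH XX f.
  move=> aA Jf; apply: (J_YY_XX sPPH aA).
  have := J_compl (id_out B) sYYH (J_compr (id_in A) sYYH Jf); apply: J_heq.
  by rewrite -id_in_nat hcompA id_inK hcomp1l; reflexivity.
have h2 (A B : CH) (g : hom (IdC A) (IdC B)) : APH PP A -> APH PP B ->
    exists f : hom A B, JH YY (fmap IdC f -h g).
  move=> _ _; exists (id_out B \oc (g \oc id_in A)).
  apply: (J_heq _ (J_zero YY (IdC A) (IdC B))).
  apply: CC_ext => i x; rewrite toc_add toc_opp; symmetry; exact: subrr.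
exact (@stable_fully_faithful CH CH (APH PP) (APH XX) (APH (PP :|: YY)) (APH YY) IdC
  Id_carries Id_stable_carries (JH XX) (JH YY) idealHX idealHY (@J_heq k gT c H VH YY) h1 h2).
Qed.

Lemma IdS_retract (Y : AStab c VH (PP :|: YY) YY) :
  exists X (a : hom Y (IdS X)) (b : hom (IdS X) Y), b \oc a =h hid Y.
Proof.
have h : exists A, APH PP A /\ exists (a : hom (aob Y) (IdC A)) (b : hom (IdC A) (aob Y)),
    JH YY ((b \oc a) -h hid (aob Y)).
  have [A [aA [a [b e]]]] := J_retract_PP sPPH thH (aob_AProj Y).
  exists A; split=> //; exists (id_in A \oc a), (b \oc id_out A).
  by apply: J_heq e; rewrite hcompA -(hcompA b) id_inK hcomp1r; reflexivity.
exact (@stable_retract CH CH (APH PP) (APH XX) (APH (PP :|: YY)) (APH YY) IdC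
  Id_carries Id_stable_carries (JH YY) idealHY Y h).
Qed.

Lemma IdS_equivalence : is_equivalence IdS.
Proof.
exact: (ff_retract_equivalence IdS_ff (AStab_idempotents_split thH sPPH XXP) IdS_retract).
Qed.

(** The projection of Res Ind A onto A is natural and split by the unit exactly; by [ResInd_J] the
    other composite is the identity modulo J_Y. *)
Lemma ResS_IndS : nat_iso (fcomp ResS IndS) IdS.
Proof.
pose a (A : CH) : hom (ResC (IndC A)) (IdC A) := id_in A \oc projC A.
pose b (A : CH) : hom (IdC A) (ResC (IndC A)) := unitC A \oc id_out A.
have ba (A : CH) : APH PP A -> JH YY ((b A \oc a A) -h hid _).
  move=> aA; have := J_opp sYYH (ResInd_J sPPH aA); apply: J_heq.
  by rewrite /a /b hcompA -(hcompA (unitC A)) id_inK hcomp1r hoppD hoppK haddC; reflexivity.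
have ab (A : CH) : a A \oc b A =h hid _.
  rewrite /a /b hcompA -(hcompA (id_in A)) projC_unitC hcomp1r; exact: id_outK.
have nat (A B : CH) (f : hom A B) : a B \oc fmap ResC (fmap IndC f) =h fmap IdC f \oc a A.
  rewrite /a -hcompA projC_nat !hcompA id_in_nat; reflexivity.
have J0 (A B : CH) (f : hom A B) : f =h hzero A B -> JH YY f.
  by move=> e; apply: (J_heq (heq_sym e)); apply: J_zero.
exact (@stable_nat_iso CH CG CH (APH PP) (APH XX) (APG PP) (APG XX) (APH (PP :|: YY)) (APH YY)
  IndC ResC IdC Ind_carries Res_carries Id_carries Ind_stable_carries Res_stable_carries
  Id_stable_carries (JH YY) idealHY J0 a b ba ab nat).
Qed.

Lemma IndS_induced : induced_by (Ind k H G) IndS.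
Proof.
by exists (Ind_adm sHG), (@Ind_null k gT c G H sHG V), Ind_carries, Ind_stable_carries.
Qed.

Lemma ResS_induced : induced_by (Res k sHG) ResS.
Proof.
by exists (Res_adm sHG), (@Res_null k gT c G H sHG V), Res_carries, Res_stable_carries.
Qed.

Lemma IdS_induced : induced_by (fid (CpxCat k H)) IdS.
Proof.
by exists (@id_adm k gT c H), (@id_null k gT c H VH), Id_carries, Id_stable_carries.
Qed.
End CorrespondenceFunctors.

Theorem theorem8p3
  (k : comPzRingType) (gT : finGroupType) (G H : {group gT})
  (sHG : H \subset G)
  (PP : {set {group gT}}) (PP_neq0 : PP != set0)
  (sPPH : forall P : {group gT}, P \in PP -> P \subset H)
  (c : choices)
  (V : gmod k G) (V_fin_gen : fin_gen V) (V_free : k_free V)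
  (thickG : thick_in_CC (@acyclic k gT c G V))
  (thickH : thick_in_CC (@acyclic k gT c H (gres sHG V))) :
  let VH := gres sHG V in
  let XX := collX G H PP in
  let YY := collY G H PP in
  exists (I : functor (AStab c VH PP XX) (AStab c V PP XX))
         (R : functor (AStab c V PP XX) (AStab c VH PP XX)),
    [/\ induced_by (Ind k H G) I,
        exists (Rs : functor (AStab c V PP XX) (AStab c VH (PP :|: YY) YY))
               (J : functor (AStab c VH PP XX) (AStab c VH (PP :|: YY) YY))
               (D : functor (AStab c VH (PP :|: YY) YY) (AStab c VH PP XX)),
          [/\ induced_by (Res k sHG) Rs, induced_by (fid (CpxCat k H)) J,
              inverse_equivalences J D & R = fcomp D Rs]
      & inverse_equivalences I R].

Proof.
have [TG _] := thickG; have [TH [_ thH]] := thickH.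
(* D is the equivalence that discards Y-projective summands, a quasi-inverse of the functor induced
   by the identity. *)
have [D eD] := IdS_equivalence sPPH thH.
exists (@IndS k gT c G H sHG V PP sPPH TG), (fcomp D (@ResS k gT c G H sHG V PP sPPH TH)); split.
- exact: IndS_induced.
- exists (@ResS k gT c G H sHG V PP sPPH TH), (IdS sPPH TH), D; split=> //; [exact: ResS_induced | exact: IdS_induced].
- apply: (inverse_from_triangle (IndS_equivalence sPPH TG thH) eD).
  exact: ResS_IndS.
Qed.
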